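(* Let $\tau\in\mathbb{C}$ with $\operatorname{Im}\tau>0$, put $q=e^{2\pi i\tau}$, and let $m,n$ be positive integers. Suppose $y_1,y_2,\dots,y_n$ are complex numbers with $y_1+y_2+\cdots+y_n=0$. Then for all $z\in\mathbb{C}$, $$\sum_{k=0}^{mn-1}q^{k^2/2}e^{2kiz}\prod_{j=1}^{n}\theta_3\!\left(mz+y_j+km\pi\tau\,\big|\,m^2n\tau\right)=F_{m,n}(y_1,\dots,y_n|\tau)\,\theta_3(z|\tau),$$ where $$F_{m,n}(y_1,\dots,y_n|\tau)=\frac{(-i\tau)^{\frac{1-n}{2}}}{(m^2n)^{\frac n2}}\,e^{\frac{y_1^2+\cdots+y_n^2}{m^2n\pi\tau i}}\;G_{m,n}\!\left(\frac{y_1}{m^2n\tau},\dots,\frac{y_n}{m^2n\tau}\,\Big|\,-\frac{1}{m^2n\tau}\right)$$ $$=\sum_{k=0}^{n-1}q^{-\frac{m^2k^2}{2}}\sum_{\substack{r_1,\dots,r_n\in\mathbb{Z}\\ r_1+\cdots+r_n=k}}q^{\frac12 m^2n(r_1^2+\cdots+r_n^2)}e^{-2i(r_1y_1+\cdots+r_ny_n)}.$$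
   Context: Throughout, $q=e^{2\pi i\tau}$ with $\operatorname{Im}\tau>0$ (and $q^{a}$ means $e^{2\pi i\tau a}$). The Jacobi theta function is $\theta_3(z|\tau)=\sum_{n=-\infty}^{\infty}q^{n^2/2}e^{2niz}$. For complex $y_1,\dots,y_n$ with $y_1+\cdots+y_n=0$, $$G_{m,n}(y_1,\dots,y_n|\tau)=mn\sum_{\substack{r_1,\dots,r_n\in\mathbb{Z}\\ r_1+\cdots+r_n=0}}q^{\frac12(r_1^2+\cdots+r_n^2)}e^{2i(r_1y_1+\cdots+r_ny_n)}.$$ The power $(-i\tau)^{\frac{1-n}{2}}$ is taken with the principal branch. *)

(* Defs.v *)
From Stdlib Require Import Reals Lra Lia ZArith List.
From Coquelicot Require Import Coquelicot.
Import ListNotations.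
Open Scope C_scope.

Definition cexp (w : C) : C :=
  (exp (Re w) * cos (Im w), exp (Re w) * sin (Im w))%R.

(** Principal argument, with values in (-PI, PI]. *)
Definition Carg (w : C) : R :=
  let x := Re w in let y := Im w in
  if Rlt_dec 0 x then atan (y / x)
  else if Rlt_dec x 0 then
         (if Rle_dec 0 y then atan (y / x) + PI else atan (y / x) - PI)%R
  else if Rlt_dec 0 y then (PI / 2)%R
  else if Rlt_dec y 0 then (- (PI / 2))%R
  else 0%R.

Definition Clog (w : C) : C := (ln (Cmod w), Carg w).
Definition Cpow (w a : C) : C :=
  if Ceq_dec w 0 then 0 else cexp (a * Clog w).

Definition qpow (tau a : C) : C := cexp (2 * RtoC PI * Ci * tau * a).

Definition csum_list (l : list C) : C := fold_right Cplus 0 l.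
Definition cprod_list (l : list C) : C := fold_right Cmult 1 l.
Definition csum_nat (n : nat) (f : nat -> C) : C := csum_list (map f (seq 0 n)).
Definition cprod_nat (n : nat) (f : nat -> C) : C := cprod_list (map f (seq 0 n)).

Definition Clim (u : nat -> C) : C :=
  (real (Lim_seq (fun N => Re (u N))), real (Lim_seq (fun N => Im (u N)))).

Definition zrange (N : nat) : list Z :=
  map (fun k => (Z.of_nat k - Z.of_nat N)%Z) (seq 0 (2 * N + 1)).

Fixpoint zbox (N : nat) (n : nat) : list (list Z) :=
  match n with
  | O => [ [] ]
  | S n' => flat_map (fun r => map (cons r) (zbox N n')) (zrange N)
  end.

(** Sum over all of Z^n of an (absolutely summable) family, as the limit of the
    partial sums over the cubes [-N,N]^n. *)
Definition latsum (n : nat) (f : list Z -> C) : C :=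
  Clim (fun N => csum_list (map f (zbox N n))).

(** Sum over Z of an absolutely summable family, via symmetric partial sums. *)
Definition zsum (f : Z -> C) : C := Clim (fun N => csum_list (map f (zrange N))).

Definition ZtoC (k : Z) : C := RtoC (IZR k).
Definition NtoC (k : nat) : C := RtoC (INR k).

(** r_1 + ... + r_n,  r_1^2 + ... + r_n^2,  r_1 y_1 + ... + r_n y_n
    (with y_{j+1} represented by y j). *)
Definition zsumv (r : list Z) : Z := fold_right Z.add 0%Z r.
Definition zsumsq (r : list Z) : Z := fold_right (fun a s => a * a + s)%Z 0%Z r.
Fixpoint zdot (r : list Z) (y : nat -> C) : C :=
  match r with
  | [] => 0
  | a :: r' => ZtoC a * y 0%nat + zdot r' (fun j => y (S j))
  end.

Definition theta3 (z tau : C) : C :=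
  zsum (fun k => qpow tau (ZtoC k * ZtoC k / 2) * cexp (2 * ZtoC k * Ci * z)).

Definition Gmn (m n : nat) (y : nat -> C) (tau : C) : C :=
  NtoC m * NtoC n *
  latsum n (fun r => if Z.eq_dec (zsumv r) 0 then
                       qpow tau (ZtoC (zsumsq r) / 2) * cexp (2 * Ci * zdot r y)
                     else 0).

Definition Fmn (m n : nat) (y : nat -> C) (tau : C) : C :=
  let M := NtoC m * NtoC m * NtoC n in
  Cpow (- Ci * tau) ((1 - NtoC n) / 2)
  / RtoC (Rpower (INR m * INR m * INR n) (INR n / 2))
  * cexp (csum_nat n (fun j => y j * y j) / (M * RtoC PI * tau * Ci))
  * Gmn m n (fun j => y j / (M * tau)) (- 1 / (M * tau)).

Definition Fmn_alt (m n : nat) (y : nat -> C) (tau : C) : C :=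
  csum_nat n (fun k =>
    qpow tau (- (NtoC m * NtoC m * NtoC k * NtoC k) / 2) *
    latsum n (fun r => if Z.eq_dec (zsumv r) (Z.of_nat k) then
                         qpow tau (NtoC m * NtoC m * NtoC n * ZtoC (zsumsq r) / 2)
                         * cexp (- (2 * Ci * zdot r y))
                       else 0)).

(* Main.v *)
Require Import Defs.
From Stdlib Require Import Reals ZArith List.
From Stdlib Require Import Lra Lia Permutation Classical ClassicalEpsilon.
From Coquelicot Require Import Coquelicot.
Import ListNotations.
Open Scope C_scope.

(** Expanding the theta functions, the left-hand side becomes an absolutely
    convergent sum over pairs [(k, r)] with [0 <= k < m n] and [r] in [Z^n].
    Re-indexing this sum by division with remainder factors it as [Fmn_alt] times
    [theta3 z tau].  Applying first Jacobi's imaginary transformation to every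
    factor, and summing the roots of unity in [k], factors it as [Fmn] times
    [theta3 z tau].  Both identities hold for all [z], and [theta3] is not
    identically zero, hence [Fmn = Fmn_alt].

    Jacobi's transformation is proved without integrals.  The periodization of
    the Gaussian [x |-> exp (x^2 / (pi i tau))] is recovered by a discrete Fourier
    transform with [2 K + 1] points.  Its coefficients are Riemann sums of
    [exp (- x^2)] along lines of the complex plane; by a discrete version of
    Cauchy's theorem their limit does not depend on the line, and second
    differences bound the [k]-th one by [O (1 / k^2)], so the limit [K -> oo] may
    be taken term by term.  The remaining constant is found at [tau = i]. *)

(** * Unordered sums *)

(** [Clim] has a value even where nothing converges, so sums defined by it can be manipulated only
    where summability is known. The proof therefore works with [hsum], which carries absolute
    summability together with the value and is stable under bijections, products and restriction;
    uniqueness of limits leads back to [zsum] and [latsum]. The two forms of F are related by a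
    theta inversion in n - 1 dimensions, on the lattice of vectors of sum zero. Comparing two
    factorizations over the same [theta3 z tau] reduces it to the inversion in dimension one. The
    Gaussian integral is not computed beforehand. Up to explicit factors, all coefficients only have
    to approach one sequence [gauss_mean K], independent of [z], [tau] and [k]; a single known
    instance with nonzero theta value then determines its limit, and [tau = i], [z = 0] is a fixed
    point of the transformation. The lines have direction [grho tau], a square root of i / (pi tau);
    Im tau > 0 puts it in the sector |arg| < pi/4, where exp (- x^2) decays, and this sector is
    convex and contains 1. *)

Definition lsum {I : Type} (f : I -> C) (L : list I) : C := csum_list (map f L).

Definition rsum {I : Type} (g : I -> R) (L : list I) : R :=
  fold_right Rplus 0%R (map g L).

Definition bounded_sums {I : Type} (P : I -> Prop) (f : I -> C) (B : R) : Prop :=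
  forall L, NoDup L -> (forall x, In x L -> P x) ->
  (rsum (fun x => Cmod (f x)) L <= B)%R.

(** Convergence along the net of finite duplicate-free lists. The predicate [P] plays the role of
    the index set, so that restriction needs no subtypes; the bound is a clause of its own because
    the existence, product and subfamily lemmas start from it. *)
Definition hsum {I : Type} (P : I -> Prop) (f : I -> C) (s : C) : Prop :=
  (exists B, bounded_sums P f B) /\
  forall eps : R, (0 < eps)%R ->
  exists L0, NoDup L0 /\ (forall x, In x L0 -> P x) /\
  forall L, NoDup L -> incl L0 L -> (forall x, In x L -> P x) ->
  (Cmod (lsum f L - s) < eps)%R.

Section FiniteSums.
Context {I : Type}.
Implicit Types (f g : I -> C) (L : list I).

Lemma lsum_cons f x L : lsum f (x :: L) = f x + lsum f L.
Proof. reflexivity. Qed.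

Lemma lsum_app f L1 L2 : lsum f (L1 ++ L2) = lsum f L1 + lsum f L2.
Proof.
  induction L1 as [|x L1 IH]; cbn [app];
    [change (lsum f []) with (RtoC 0); ring|].
  rewrite !lsum_cons, IH; ring.
Qed.

Lemma lsum_ext f g L : (forall x, In x L -> f x = g x) -> lsum f L = lsum g L.
Proof. intros H; unfold lsum; f_equal; apply map_ext_in; auto. Qed.

Lemma lsum_plus f g L : lsum (fun x => f x + g x) L = lsum f L + lsum g L.
Proof.
  induction L as [|x L IH]; [unfold lsum; cbn; ring|].
  rewrite !lsum_cons, IH; ring.
Qed.

Lemma lsum_scal (c : C) f L : lsum (fun x => c * f x) L = c * lsum f L.
Proof.
  induction L as [|x L IH]; [unfold lsum; cbn; ring|].
  rewrite !lsum_cons, IH; ring.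
Qed.

Lemma lsum_zero f L : (forall x, In x L -> f x = 0) -> lsum f L = 0.
Proof.
  intros H; induction L as [|x L IH]; [reflexivity|].
  rewrite lsum_cons, H, IH; [ring|intros; apply H; right; auto|left; auto].
Qed.

Lemma lsum_perm f L1 L2 : Permutation L1 L2 -> lsum f L1 = lsum f L2.
Proof.
  induction 1; rewrite ?lsum_cons; [reflexivity|congruence|ring|congruence].
Qed.

Lemma lsum_map {J : Type} (phi : J -> I) f (L : list J) :
  lsum f (map phi L) = lsum (fun x => f (phi x)) L.
Proof. unfold lsum; now rewrite map_map. Qed.

Lemma Cmod_lsum f L : (Cmod (lsum f L) <= rsum (fun x => Cmod (f x)) L)%R.
Proof.
  induction L as [|x L IH]; [unfold lsum, rsum; cbn; rewrite Cmod_0; lra|].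
  rewrite lsum_cons; unfold rsum; cbn; fold (rsum (fun x => Cmod (f x)) L).
  eapply Rle_trans; [apply Cmod_triangle|lra].
Qed.

Lemma rsum_le (g1 g2 : I -> R) L :
  (forall x, In x L -> (g1 x <= g2 x)%R) -> (rsum g1 L <= rsum g2 L)%R.
Proof.
  unfold rsum; induction L as [|x L IH]; cbn; intros H; [lra|].
  apply Rplus_le_compat; auto.
Qed.

Lemma rsum_ext (g1 g2 : I -> R) L :
  (forall x, In x L -> g1 x = g2 x) -> rsum g1 L = rsum g2 L.
Proof. intros H; unfold rsum; f_equal; apply map_ext_in; auto. Qed.

Lemma rsum_plus (g1 g2 : I -> R) L :
  rsum (fun x => g1 x + g2 x)%R L = (rsum g1 L + rsum g2 L)%R.
Proof. unfold rsum; induction L as [|x L IH]; cbn; [|rewrite IH]; ring. Qed.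

Lemma rsum_scal (c : R) (g : I -> R) L :
  rsum (fun x => c * g x)%R L = (c * rsum g L)%R.
Proof. unfold rsum; induction L as [|x L IH]; cbn; [|rewrite IH]; ring. Qed.

Lemma rsum_app (g : I -> R) L1 L2 : rsum g (L1 ++ L2) = (rsum g L1 + rsum g L2)%R.
Proof. unfold rsum; induction L1 as [|x L IH]; cbn; [|rewrite IH]; ring. Qed.

Lemma rsum_map {J : Type} (phi : J -> I) (g : I -> R) (L : list J) :
  rsum g (map phi L) = rsum (fun x => g (phi x)) L.
Proof. unfold rsum; now rewrite map_map. Qed.

Lemma rsum_nonneg (g : I -> R) L : (forall x, (0 <= g x)%R) -> (0 <= rsum g L)%R.
Proof.
  intros H; unfold rsum; induction L as [|x L IH]; cbn; [lra|].
  specialize (H x); lra.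
Qed.

Lemma rsum_perm (g : I -> R) L1 L2 : Permutation L1 L2 -> rsum g L1 = rsum g L2.
Proof. unfold rsum; induction 1; cbn; lra. Qed.

Lemma NoDup_incl_split L1 L2 : NoDup L1 -> incl L1 L2 ->
  exists L3, Permutation L2 (L1 ++ L3).
Proof.
  revert L2; induction L1 as [|x L1 IH]; intros L2 ND HI; [now exists L2|].
  inversion ND; subst.
  destruct (in_split x L2) as (a & b & ->); [apply HI; left; auto|].
  destruct (IH (a ++ b)) as [L3 HL3]; auto.
  - intros y Hy; assert (Hy' : In y (a ++ x :: b)) by (apply HI; right; auto).
    apply in_app_or in Hy'; apply in_or_app.
    destruct Hy' as [?|[->|?]]; auto; contradiction.
  - exists L3; cbn; rewrite <- HL3; symmetry; apply Permutation_middle.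
Qed.

Lemma rsum_incl (g : I -> R) L1 L2 : (forall x, (0 <= g x)%R) ->
  NoDup L1 -> incl L1 L2 -> (rsum g L1 <= rsum g L2)%R.
Proof.
  intros Hg ND HI; destruct (NoDup_incl_split L1 L2 ND HI) as [L3 HP].
  rewrite (rsum_perm g _ _ HP), rsum_app.
  pose proof (rsum_nonneg g L3 Hg); lra.
Qed.

(** Makes [nodup] available on lists over an arbitrary index type. *)
Lemma eq_dec_classical (x y : I) : {x = y} + {x <> y}.
Proof. apply excluded_middle_informative. Qed.

Lemma NoDup_union (P : I -> Prop) L1 L2 :
  (forall x, In x L1 -> P x) -> (forall x, In x L2 -> P x) ->
  exists L, NoDup L /\ incl L1 L /\ incl L2 L /\ (forall x, In x L -> P x).
Proof.
  intros H1 H2; exists (nodup eq_dec_classical (L1 ++ L2)); repeat split.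
  - apply NoDup_nodup.
  - intros x Hx; apply nodup_In, in_or_app; auto.
  - intros x Hx; apply nodup_In, in_or_app; auto.
  - intros x Hx; apply nodup_In, in_app_or in Hx; destruct Hx; auto.
Qed.

End FiniteSums.

Section Hsum.
Context {I : Type}.
Implicit Types (P Q : I -> Prop) (f g : I -> C).

Lemma hsum_unique P f s t : hsum P f s -> hsum P f t -> s = t.
Proof.
  intros [_ Hs] [_ Ht]; destruct (Ceq_dec (s - t) 0) as [E|E].
  { replace s with (s - t + t) by ring; rewrite E; ring. }
  exfalso; apply Cmod_gt_0 in E.
  destruct (Hs (Cmod (s - t) / 2)%R) as (L1 & N1 & P1 & H1); [lra|].
  destruct (Ht (Cmod (s - t) / 2)%R) as (L2 & N2 & P2 & H2); [lra|].
  destruct (NoDup_union P L1 L2 P1 P2) as (L & NL & I1 & I2 & PL).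
  specialize (H1 L NL I1 PL); specialize (H2 L NL I2 PL).
  assert (T : (Cmod (s - t) <= Cmod (lsum f L - s) + Cmod (lsum f L - t))%R).
  { replace (s - t) with (- (lsum f L - s) + (lsum f L - t)) by ring.
    eapply Rle_trans; [apply Cmod_triangle|rewrite Cmod_opp; lra]. }
  lra.
Qed.

Lemma hsum_ext P f g s : (forall x, P x -> f x = g x) -> hsum P f s -> hsum P g s.
Proof.
  intros E [[B HB] H]; split.
  - exists B; intros L NL PL; rewrite <- (rsum_ext (fun x => Cmod (f x))); auto.
    intros x Hx; rewrite E; auto.
  - intros eps Heps; destruct (H eps Heps) as (L0 & N0 & P0 & H0).
    exists L0; repeat split; auto; intros L NL IL PL.
    rewrite <- (lsum_ext f); auto.
Qed.

Lemma hsum_value P f s t : s = t -> hsum P f s -> hsum P f t.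
Proof. now intros ->. Qed.

Lemma bounded_sums_ge0 P f B : bounded_sums P f B -> (0 <= B)%R.
Proof.
  intros H; specialize (H [] (NoDup_nil _)); unfold rsum in H; cbn in H.
  apply H; intros x [].
Qed.

Lemma hsum_Cmod_le P f s B : hsum P f s -> bounded_sums P f B -> (Cmod s <= B)%R.
Proof.
  intros [_ H] HB; apply Rnot_lt_le; intros Hlt.
  destruct (H (Cmod s - B)%R) as (L & NL & PL & HL); [lra|].
  specialize (HL L NL (incl_refl L) PL); specialize (HB L NL PL).
  pose proof (Cmod_lsum f L) as HC.
  pose proof (Cmod_triangle (lsum f L) (- (lsum f L - s))) as T.
  rewrite Cmod_opp in T; replace (lsum f L + - (lsum f L - s)) with s in T by ring.
  lra.
Qed.

Lemma hsum_plus P f g s t : hsum P f s -> hsum P g t ->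
  hsum P (fun x => f x + g x) (s + t).
Proof.
  intros [[B HB] Hs] [[D HD] Ht]; split.
  - exists (B + D)%R; intros L NL PL.
    eapply Rle_trans; [apply rsum_le; intros x _; apply Cmod_triangle|].
    rewrite rsum_plus; specialize (HB L NL PL); specialize (HD L NL PL); lra.
  - intros eps Heps.
    destruct (Hs (eps / 2)%R) as (L1 & N1 & P1 & H1); [lra|].
    destruct (Ht (eps / 2)%R) as (L2 & N2 & P2 & H2); [lra|].
    destruct (NoDup_union P L1 L2 P1 P2) as (L & NL & I1 & I2 & PL).
    exists L; repeat split; auto; intros L' NL' IL' PL'.
    specialize (H1 L' NL' (incl_tran I1 IL') PL').
    specialize (H2 L' NL' (incl_tran I2 IL') PL').
    rewrite lsum_plus.
    replace (lsum f L' + lsum g L' - (s + t))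
      with ((lsum f L' - s) + (lsum g L' - t)) by ring.
    eapply Rle_lt_trans; [apply Cmod_triangle|lra].
Qed.

Lemma hsum_scal P (c : C) f s : hsum P f s -> hsum P (fun x => c * f x) (c * s).
Proof.
  intros [[B HB] Hs]; split.
  - exists (Cmod c * B)%R; intros L NL PL.
    rewrite (rsum_ext _ (fun x => Cmod c * Cmod (f x))%R);
      [|intros; apply Cmod_mult].
    rewrite rsum_scal; apply Rmult_le_compat_l; [apply Cmod_ge_0|auto].
  - intros eps Heps; pose proof (Cmod_ge_0 c) as Hc.
    destruct (Hs (eps / (Cmod c + 1))%R) as (L1 & N1 & P1 & H1).
    { apply Rdiv_lt_0_compat; lra. }
    exists L1; repeat split; auto; intros L NL IL PL.
    specialize (H1 L NL IL PL).
    rewrite lsum_scal; replace (c * lsum f L - c * s) with (c * (lsum f L - s)) by ring.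
    rewrite Cmod_mult.
    apply Rle_lt_trans with (Cmod c * (eps / (Cmod c + 1)))%R.
    { apply Rmult_le_compat_l; lra. }
    replace (Cmod c * (eps / (Cmod c + 1)))%R
      with (eps - eps / (Cmod c + 1))%R by (field; lra).
    assert (0 < eps / (Cmod c + 1))%R by (apply Rdiv_lt_0_compat; lra); lra.
Qed.

Lemma hsum_zero P : hsum P (fun _ => 0) 0.
Proof.
  split.
  - exists 0%R; intros L _ _; rewrite (rsum_ext _ (fun x => 0 * 0)%R).
    + rewrite rsum_scal; lra.
    + intros; rewrite Cmod_0; ring.
  - intros eps Heps; exists []; repeat split; [constructor|intros ? []|].
    intros L _ _ _; rewrite lsum_zero by auto.
    replace (0 - 0 : C) with (0 : C) by ring; rewrite Cmod_0; lra.
Qed.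

Lemma hsum_minus P f g s t : hsum P f s -> hsum P g t ->
  hsum P (fun x => f x - g x) (s - t).
Proof.
  intros Hf Hg; apply hsum_value with (s + (-1) * t); [ring|].
  eapply hsum_ext; [|apply hsum_plus; [exact Hf|apply (hsum_scal _ (-1) _ _ Hg)]].
  intros x _; cbn; ring.
Qed.

Lemma hsum_csum_nat P (K : nat) (f : nat -> I -> C) (s : nat -> C) :
  (forall k, (k < K)%nat -> hsum P (f k) (s k)) ->
  hsum P (fun x => csum_nat K (fun k => f k x)) (csum_nat K s).
Proof.
  unfold csum_nat; intros H.
  assert (G : forall l, (forall k, In k l -> (k < K)%nat) ->
    hsum P (fun x => csum_list (map (fun k => f k x) l)) (csum_list (map s l))).
  { induction l as [|k l IH]; cbn; intros Hl; [apply hsum_zero|].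
    apply hsum_plus; auto. }
  apply G; intros k Hk; apply in_seq in Hk; lia.
Qed.

(** A list inside [P] and [Q] can be padded with those entries of [L0] that lie outside [Q]: they
    contribute zero, and the padded list contains [L0]. *)
Lemma hsum_support P Q f s : (forall x, P x -> ~ Q x -> f x = 0) ->
  hsum P f s -> hsum (fun x => P x /\ Q x) f s.
Proof.
  intros HZ [[B HB] Hs]; split.
  - exists B; intros L NL PL; apply HB; auto; intros x Hx; apply PL; auto.
  - intros eps Heps; destruct (Hs eps Heps) as (L0 & N0 & P0 & H0).
    set (q := fun x => if excluded_middle_informative (Q x)
                       then true else false).
    assert (Hq : forall x, q x = true <-> Q x).
    { intros x; unfold q; destruct (excluded_middle_informative (Q x));
        split; auto; discriminate. }
    exists (filter q L0); repeat split.
    + now apply NoDup_filter.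
    + apply filter_In in H; apply P0, H.
    + apply filter_In in H; apply Hq, H.
    + intros L NL IL PL.
      set (D := filter (fun x => negb (q x)) L0).
      assert (HD : forall x, In x D -> In x L0 /\ ~ Q x).
      { intros x Hx; apply filter_In in Hx; destruct Hx as [Hx1 Hx2]; split; auto.
        rewrite <- Hq; destruct (q x); [discriminate|congruence]. }
      assert (E : lsum f (L ++ D) = lsum f L).
      { rewrite lsum_app, (lsum_zero f D); [ring|].
        intros x Hx; apply HD in Hx; apply HZ; [apply P0|]; tauto. }
      rewrite <- E; apply H0.
      * apply NoDup_app; auto; [now apply NoDup_filter|].
        intros x HxL HxD; apply HD in HxD; apply PL in HxL; tauto.
      * intros x Hx; apply in_or_app; destruct (q x) eqn:Eq.
        -- left; apply IL, filter_In; auto.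
        -- right; apply filter_In; rewrite Eq; auto.
      * intros x Hx; apply in_app_or in Hx; destruct Hx as [Hx|Hx];
          [apply PL; auto|apply P0, HD; auto].
Qed.

(** Filtering a list by [Q] removes only vanishing terms. *)
Lemma hsum_extend P Q f s : (forall x, P x -> ~ Q x -> f x = 0) ->
  hsum (fun x => P x /\ Q x) f s -> hsum P f s.
Proof.
  intros HZ [[B HB] Hs].
  set (q := fun x => if excluded_middle_informative (Q x)
                     then true else false).
  assert (Hq : forall x, q x = true <-> Q x).
  { intros x; unfold q; destruct (excluded_middle_informative (Q x));
      split; auto; discriminate. }
  assert (HR : forall L, (forall x, In x L -> P x) ->
     rsum (fun x => Cmod (f x)) L = rsum (fun x => Cmod (f x)) (filter q L)
     /\ lsum f L = lsum f (filter q L)).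
  { induction L as [|x L IH]; intros PL; [split; reflexivity|].
    destruct IH as [IH1 IH2]; [intros; apply PL; right; auto|].
    cbn [filter]; destruct (q x) eqn:Eq.
    - rewrite !lsum_cons, IH2; unfold rsum in *; cbn; rewrite IH1; auto.
    - assert (E : f x = 0).
      { apply HZ; [apply PL; left; auto|rewrite <- Hq, Eq; discriminate]. }
      rewrite lsum_cons, <- IH2, E; unfold rsum in *; cbn; rewrite <- IH1, E, Cmod_0.
      split; ring. }
  assert (HF : forall L, (forall x, In x L -> P x) ->
     forall x, In x (filter q L) -> P x /\ Q x).
  { intros L PL x Hx; apply filter_In in Hx; rewrite Hq in Hx; split; [apply PL|]; tauto. }
  split.
  - exists B; intros L NL PL; rewrite (proj1 (HR L PL)); apply HB;
      [now apply NoDup_filter|eauto].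
  - intros eps Heps; destruct (Hs eps Heps) as (L0 & N0 & P0 & H0).
    exists L0; repeat split; auto; [intros; apply P0; auto|].
    intros L NL IL PL; rewrite (proj2 (HR L PL)); apply H0;
      [now apply NoDup_filter| |eauto].
    intros x Hx; apply filter_In; split; [apply IL; auto|apply Hq, P0; auto].
Qed.

(** Each family is extended by zero to the union; by disjointness the two extensions add up to
    [f]. *)
Lemma hsum_union P Q f s t : (forall x, P x -> ~ Q x) ->
  hsum P f s -> hsum Q f t -> hsum (fun x => P x \/ Q x) f (s + t).
Proof.
  intros D HP HQ.
  set (ind := fun (S : I -> Prop) x =>
     if excluded_middle_informative (S x) then f x else 0).
  assert (G : forall S u, (forall x, S x -> P x \/ Q x) -> hsum S f u ->
            hsum (fun x => P x \/ Q x) (ind S) u).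
  { intros S u HS Hu; apply hsum_extend with S.
    - intros x _ Hx; unfold ind;
        destruct (excluded_middle_informative (S x)); tauto.
    - destruct Hu as [[B HB] Hu]; apply (hsum_ext _ f).
      + intros x [_ Hx]; unfold ind;
        destruct (excluded_middle_informative (S x)); tauto.
      + split.
        * exists B; intros L NL PL; apply HB; auto; intros x Hx; apply PL; auto.
        * intros eps Heps; destruct (Hu eps Heps) as (L0 & N0 & P0 & H0).
          exists L0; split; [auto|split; [intros x Hx; split; auto|]].
          intros L NL IL PL; apply H0; auto; intros x Hx; apply PL; auto. }
  eapply hsum_ext; [|apply hsum_plus;
    [apply (G P s); [tauto|exact HP]|apply (G Q t); [tauto|exact HQ]]].
  intros x Hx; cbn; unfold ind;
    destruct (excluded_middle_informative (P x));
    destruct (excluded_middle_informative (Q x));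
    try ring; [exfalso; eapply D; eauto|tauto].
Qed.

Lemma hsum_pred_ext P Q f s : (forall x, P x <-> Q x) -> hsum P f s -> hsum Q f s.
Proof.
  intros E [[B HB] Hs]; split.
  - exists B; intros L NL PL; apply HB; auto; intros x Hx; apply E, PL; auto.
  - intros eps Heps; destruct (Hs eps Heps) as (L0 & N0 & P0 & H0).
    exists L0; split; [auto|split; [intros x Hx; apply E, P0, Hx|]].
    intros L NL IL PL; apply H0; auto; intros x Hx; apply E, PL; auto.
Qed.

(** The value is the supremum of the finite sums, approached monotonically. *)
Lemma hsum_real_nonneg P (g : I -> R) B :
  (forall x, P x -> (0 <= g x)%R) ->
  (forall L, NoDup L -> (forall x, In x L -> P x) -> (rsum g L <= B)%R) ->
  exists s, hsum P (fun x => RtoC (g x)) s.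
Proof.
  intros Hg HB.
  assert (HL : forall L, lsum (fun x => RtoC (g x)) L = RtoC (rsum g L)).
  { induction L as [|x L IH]; [reflexivity|].
    rewrite lsum_cons, IH; unfold rsum; cbn; now rewrite RtoC_plus. }
  destruct (completeness (fun r => exists L, NoDup L /\ (forall x, In x L -> P x)
                                  /\ r = rsum g L)) as [S [HS1 HS2]].
  - exists B; intros r (L & NL & PL & ->); auto.
  - exists 0%R, []; repeat split; [constructor|intros ? []].
  - exists (RtoC S); split.
    + exists B; intros L NL PL.
      rewrite (rsum_ext _ g); auto.
      intros x Hx; rewrite Cmod_R; apply Rabs_pos_eq; auto.
    + intros eps Heps.
      assert (HE : exists L, NoDup L /\ (forall x, In x L -> P x)
                      /\ (S - eps < rsum g L)%R).
      { apply NNPP; intros HN.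
        assert (S <= S - eps)%R; [|lra].
        apply HS2; intros r (L & NL & PL & ->); apply Rnot_lt_le; intros Hlt.
        apply HN; exists L; auto. }
      destruct HE as (L0 & N0 & P0 & H0); exists L0; repeat split; auto.
      intros L NL IL PL.
      assert (rsum g L <= S)%R by (apply HS1; exists L; auto).
      assert (rsum g L0 <= rsum g L)%R.
      (* [rsum_incl] asks for nonnegativity everywhere, whereas [g] is nonnegative only on [P]. *)
      { set (g' := fun x => Rmax 0 (g x)).
        assert (Hg' : forall L, (forall x, In x L -> P x) -> rsum g L = rsum g' L).
        { intros L' PL'; apply rsum_ext; intros x Hx; unfold g'; rewrite Rmax_right; auto. }
        rewrite !Hg' by auto; apply rsum_incl; auto; intros; apply Rmax_l. }
      rewrite HL, <- RtoC_minus, Cmod_R; apply Rabs_def1; lra.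
Qed.

(** Real and imaginary parts are each split into a positive and a negative part, all dominated by
    [Cmod (f x)]. *)
Lemma hsum_exists P f B : bounded_sums P f B -> exists s, hsum P f s.
Proof.
  intros HB.
  assert (G : forall g : I -> R, (forall x, Rabs (g x) <= Cmod (f x))%R ->
            exists s, hsum P (fun x => RtoC (g x)) s).
  { intros g Hg.
    assert (D : forall h : I -> R, (forall x, (0 <= h x <= Cmod (f x))%R) ->
            exists s, hsum P (fun x => RtoC (h x)) s).
    { intros h Hh; apply hsum_real_nonneg with B; [intros; apply Hh|].
      intros L NL PL; eapply Rle_trans; [|apply (HB L NL PL)].
      apply rsum_le; intros; apply Hh. }
    destruct (D (fun x => Rmax 0 (g x))) as [s1 H1].
    { intros x; specialize (Hg x); split; [apply Rmax_l|].
      apply Rmax_lub; [apply Cmod_ge_0|]; pose proof (Rle_abs (g x)); lra. }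
    destruct (D (fun x => Rmax 0 (- g x))) as [s2 H2].
    { intros x; specialize (Hg x); split; [apply Rmax_l|].
      apply Rmax_lub; [apply Cmod_ge_0|].
      pose proof (Rle_abs (- g x)) as K; rewrite Rabs_Ropp in K; lra. }
    exists (s1 - s2); eapply hsum_ext; [|apply hsum_minus; eauto].
    intros x _; cbn; rewrite <- RtoC_minus; f_equal.
    unfold Rmax; destruct (Rle_dec 0 (g x)); destruct (Rle_dec 0 (- g x)); lra. }
  destruct (G (fun x => Re (f x))) as [s1 H1].
  { intros x; apply re_le_Cmod. }
  destruct (G (fun x => Im (f x))) as [s2 H2].
  { intros x; eapply Rle_trans; [|apply Rmax_Cmod]; apply Rmax_r. }
  exists (s1 + Ci * s2); eapply hsum_ext;
    [|apply hsum_plus; [exact H1|apply hsum_scal, H2]].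
  intros x _; cbn; destruct (f x) as [a b]; unfold Ci, Cmult, Cplus, RtoC; cbn;
    f_equal; ring.
Qed.

Lemma bounded_sums_le P f (g : I -> R) B :
  (forall x, P x -> (Cmod (f x) <= g x)%R) ->
  (forall L, NoDup L -> (forall x, In x L -> P x) -> (rsum g L <= B)%R) ->
  bounded_sums P f B.
Proof.
  intros Hg HB L NL PL; eapply Rle_trans; [|apply (HB L NL PL)].
  apply rsum_le; auto.
Qed.

End Hsum.

Lemma hsum_single {I : Type} (P : I -> Prop) (f : I -> C) (x0 : I) :
  (forall x, P x <-> x = x0) -> hsum P f (f x0).
Proof.
  intros HP.
  assert (G : forall L, NoDup L -> incl [x0] L -> (forall x, In x L -> P x) ->
            Permutation [x0] L).
  { intros L NL IL PL; apply NoDup_Permutation; auto; [repeat constructor; auto|].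
    intros x; split; [apply IL|]; intros Hx; left; symmetry; apply HP, PL, Hx. }
  split.
  - exists (Cmod (f x0)); intros L NL PL.
    apply Rle_trans with (rsum (fun x => Cmod (f x)) [x0]); [|unfold rsum; cbn; lra].
    apply rsum_incl; auto; [intros; apply Cmod_ge_0|].
    intros x Hx; left; symmetry; apply HP, PL, Hx.
  - intros eps Heps; exists [x0]; repeat split.
    + repeat constructor; auto.
    + intros x [<-|[]]; now apply HP.
    + intros L NL IL PL; rewrite <- (lsum_perm _ _ _ (G L NL IL PL)).
      unfold lsum; cbn [map csum_list fold_right].
      match goal with |- (Cmod ?x < _)%R => replace x with (RtoC 0) by ring end.
      rewrite Cmod_0; auto.
Qed.

Lemma hsum_subset {I : Type} (P Q : I -> Prop) (f : I -> C) (s : C) :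
  hsum P f s -> exists t, hsum (fun x => P x /\ Q x) f t.
Proof.
  intros [[B HB] _]; apply hsum_exists with B.
  intros L NL PL; apply HB; auto; intros x Hx; apply PL; auto.
Qed.

Lemma hsum_reindex {I J : Type} (P : I -> Prop) (Q : J -> Prop)
  (phi : I -> J) (psi : J -> I) (g : J -> C) (s : C) :
  (forall x, P x -> Q (phi x)) -> (forall y, Q y -> P (psi y)) ->
  (forall x, P x -> psi (phi x) = x) -> (forall y, Q y -> phi (psi y) = y) ->
  hsum Q g s -> hsum P (fun x => g (phi x)) s.
Proof.
  intros HPQ HQP H1 H2 [[B HB] Hs].
  assert (HN : forall L, NoDup L -> (forall x, In x L -> P x) -> NoDup (map phi L)).
  { induction L as [|x L IH]; intros NL PL; [constructor|].
    inversion NL; subst; cbn; constructor.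
    - intros Hx; apply in_map_iff in Hx; destruct Hx as (y & E & Hy).
      assert (y = x); [|congruence].
      rewrite <- (H1 y), <- (H1 x), E; auto; apply PL; [left|right]; auto.
    - apply IH; auto; intros; apply PL; right; auto. }
  split.
  - exists B; intros L NL PL.
    rewrite <- (rsum_map phi (fun y => Cmod (g y))); apply HB; auto.
    intros y Hy; apply in_map_iff in Hy; destruct Hy as (x & <- & Hx); auto.
  - intros eps Heps; destruct (Hs eps Heps) as (L0 & N0 & P0 & H0).
    exists (nodup eq_dec_classical (map psi L0)); repeat split.
    + apply NoDup_nodup.
    + intros x Hx; apply nodup_In, in_map_iff in Hx; destruct Hx as (y & <- & Hy); auto.
    + intros L NL IL PL; rewrite <- (lsum_map phi g); apply H0; auto.
      * intros y Hy; rewrite <- (H2 y) by auto; apply in_map, IL, nodup_In, in_map; auto.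
      * intros y Hy; apply in_map_iff in Hy; destruct Hy as (x & <- & Hx); auto.
Qed.

(** * Products and finite unions of summable families *)

Lemma lsum_list_prod {I J : Type} (f : I -> C) (g : J -> C) L1 L2 :
  lsum (fun p => f (fst p) * g (snd p)) (list_prod L1 L2) = lsum f L1 * lsum g L2.
Proof.
  induction L1 as [|x L1 IH]; [unfold lsum; cbn; ring|].
  cbn [list_prod]; rewrite lsum_app, IH, lsum_cons, lsum_map; cbn.
  rewrite lsum_scal; ring.
Qed.

Lemma rsum_list_prod {I J : Type} (f : I -> R) (g : J -> R) L1 L2 :
  rsum (fun p => f (fst p) * g (snd p))%R (list_prod L1 L2) = (rsum f L1 * rsum g L2)%R.
Proof.
  induction L1 as [|x L1 IH]; [unfold rsum; cbn; ring|].
  cbn [list_prod]; rewrite rsum_app, IH, rsum_map; cbn.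
  rewrite rsum_scal; unfold rsum; cbn; ring.
Qed.

Lemma NoDup_list_prod {I J : Type} (L1 : list I) (L2 : list J) :
  NoDup L1 -> NoDup L2 -> NoDup (list_prod L1 L2).
Proof.
  intros N1 N2; induction N1 as [|x L1 Hx N1 IH]; cbn; [constructor|].
  apply NoDup_app; auto.
  - apply NoDup_map_NoDup_ForallPairs; auto.
    intros a b _ _ E; congruence.
  - intros [a b] Ha Hb; apply in_map_iff in Ha; destruct Ha as (c & E & _).
    apply in_prod_iff in Hb; inversion E; subst; tauto.
Qed.

(** A list of pairs lies in the product of its two projections, which gives the bound [A * B] and
    hence some value [u]. That [u = s * t] is tested on rectangles [list_prod M1 M2], where the
    finite sum factors. *)
Lemma hsum_prod {I J : Type} (P : I -> Prop) (Q : J -> Prop) (f : I -> C) (g : J -> C)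
  (s t : C) : hsum P f s -> hsum Q g t ->
  hsum (fun p => P (fst p) /\ Q (snd p)) (fun p => f (fst p) * g (snd p)) (s * t).
Proof.
  intros Hf Hg; pose proof Hf as [[A HA] Hs]; pose proof Hg as [[B HB] Ht].
  set (PQ := fun p : I * J => P (fst p) /\ Q (snd p)).
  set (F := fun p : I * J => f (fst p) * g (snd p)).
  assert (HF : bounded_sums PQ F (A * B)).
  { intros L NL PL; unfold F.
    set (L1 := nodup eq_dec_classical (map fst L)).
    set (L2 := nodup eq_dec_classical (map snd L)).
    rewrite (rsum_ext _ (fun p => Cmod (f (fst p)) * Cmod (g (snd p)))%R);
      [|intros; apply Cmod_mult].
    apply Rle_trans with
      (rsum (fun p => Cmod (f (fst p)) * Cmod (g (snd p)))%R (list_prod L1 L2)).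
    - apply rsum_incl; auto.
      + intros; apply Rmult_le_pos; apply Cmod_ge_0.
      + intros [a b] Hab; apply in_prod; apply nodup_In;
          [apply (in_map fst _ (a, b))|apply (in_map snd _ (a, b))]; auto.
    - rewrite (rsum_list_prod (fun x => Cmod (f x)) (fun x => Cmod (g x))).
      apply Rmult_le_compat; try (apply rsum_nonneg; intros; apply Cmod_ge_0).
      + apply HA; [apply NoDup_nodup|]; intros x Hx.
        apply nodup_In, in_map_iff in Hx; destruct Hx as (p & <- & Hp); apply PL, Hp.
      + apply HB; [apply NoDup_nodup|]; intros x Hx.
        apply nodup_In, in_map_iff in Hx; destruct Hx as (p & <- & Hp); apply PL, Hp. }
  destruct (hsum_exists _ _ _ HF) as [u Hu].
  replace (s * t) with u; auto.
  destruct (Ceq_dec (u - s * t) 0) as [E|E].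
  { replace u with (u - s * t + s * t) by ring; rewrite E; ring. }
  exfalso; apply Cmod_gt_0 in E; set (d := Cmod (u - s * t)) in *.
  assert (HA0 : (0 <= A)%R) by (eapply bounded_sums_ge0; eauto).
  pose proof (Cmod_ge_0 t) as Ht0.
  (* Chosen so that the total error [e + A e + e |t|] is less than [d]. *)
  set (e := (d / (2 * (A + Cmod t + 2)))%R).
  assert (He : (0 < e)%R) by (apply Rdiv_lt_0_compat; lra).
  destruct Hu as [_ Hu]; destruct (Hu e He) as (L0 & N0 & P0 & H0).
  destruct (Hs e He) as (L1 & N1 & P1 & H1).
  destruct (Ht e He) as (L2 & N2 & P2 & H2).
  destruct (NoDup_union P (map fst L0) L1) as (M1 & NM1 & I1 & I1' & PM1); auto.
  { intros x Hx; apply in_map_iff in Hx; destruct Hx as (p & <- & Hp); apply P0, Hp. }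
  destruct (NoDup_union Q (map snd L0) L2) as (M2 & NM2 & I2 & I2' & PM2); auto.
  { intros x Hx; apply in_map_iff in Hx; destruct Hx as (p & <- & Hp); apply P0, Hp. }
  specialize (H1 M1 NM1 I1' PM1); specialize (H2 M2 NM2 I2' PM2).
  assert (H3 : (Cmod (lsum F (list_prod M1 M2) - u) < e)%R).
  { apply H0.
    - now apply NoDup_list_prod.
    - intros [a b] Hab; apply in_prod; [apply I1, (in_map fst _ (a, b))
                                       |apply I2, (in_map snd _ (a, b))]; auto.
    - intros [a b] Hab; apply in_prod_iff in Hab; split; cbn; [apply PM1|apply PM2]; tauto. }
  unfold F in H3; rewrite lsum_list_prod in H3.
  assert (HM1 : (Cmod (lsum f M1) <= A)%R).
  { eapply Rle_trans; [apply Cmod_lsum|apply HA; auto]. }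
  set (a := lsum f M1) in *; set (b := lsum g M2) in *.
  assert (T : (d <= e + (A * e + e * Cmod t))%R).
  { unfold d; replace (u - s * t) with (- (a * b - u) + (a * (b - t) + (a - s) * t)) by ring.
    eapply Rle_trans; [apply Cmod_triangle|]; rewrite Cmod_opp.
    apply Rplus_le_compat; [lra|].
    eapply Rle_trans; [apply Cmod_triangle|]; rewrite !Cmod_mult.
    apply Rplus_le_compat; apply Rmult_le_compat; try apply Cmod_ge_0; lra. }
  assert (d = 2 * (A + Cmod t + 2) * e)%R by (unfold e; field; lra).
  nra.
Qed.

(** Turns a finite sum of series into one series over pairs, so that a later change of variables may
    mix [k] with the inner index. *)
Lemma hsum_sigma_list {I K : Type} (P : I -> Prop) (f : K -> I -> C) (s : K -> C)
  (l : list K) : NoDup l -> (forall k, In k l -> hsum P (f k) (s k)) ->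
  hsum (fun p => In (fst p) l /\ P (snd p)) (fun p => f (fst p) (snd p)) (lsum s l).
Proof.
  intros Nl; induction Nl as [|k l Hk Nl IH]; intros H.
  - apply hsum_ext with (fun _ => 0); [intros x [[] _]|apply hsum_zero].
  - rewrite lsum_cons.
    apply hsum_pred_ext with (fun p : K * I =>
      (fst p = k /\ P (snd p)) \/ (In (fst p) l /\ P (snd p))).
    { intros [k' x]; cbn; intuition congruence. }
    apply hsum_union.
    + intros [k' x]; cbn; intros [-> _] [? _]; contradiction.
    + apply hsum_ext with (fun p => f k (snd p)); [intros [k' x] [E _]; cbn in *; now subst|].
      apply hsum_reindex with (Q := P) (phi := snd) (psi := fun x => (k, x));
        cbn; auto; try tauto.
      * intros [k' x] [E _]; cbn in *; congruence.
      * apply H; left; auto.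
    + apply IH; intros; apply H; right; auto.
Qed.

(** * From unordered sums to limits of partial sums *)

Lemma Clim_unique (u : nat -> C) (l : C) :
  is_lim_seq (fun n => Cmod (u n - l)) 0 -> Clim u = l.
Proof.
  intros H; unfold Clim; destruct l as [a b].
  assert (G : forall (v : nat -> R) (c : R),
     (forall n, (Rabs (v n - c) <= Cmod (u n - (a, b)))%R) -> real (Lim_seq v) = c).
  { intros v c Hv; rewrite (is_lim_seq_unique v c); auto.
    replace (Finite c) with (Finite (0 + c)) by (f_equal; ring).
    apply is_lim_seq_ext with (fun n => (v n - c) + c)%R; [intros; ring|].
    apply is_lim_seq_plus' with (l1 := 0%R); [|apply is_lim_seq_const].
    apply is_lim_seq_abs_0, is_lim_seq_le_le with (fun _ => 0%R)
      (fun n => Cmod (u n - (a, b))); auto.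
    - intros n; split; auto; apply Rabs_pos.
    - apply is_lim_seq_const. }
  f_equal; apply G; intros n.
  - change (Re (u n) - a)%R with (Re (u n - (a, b))); apply re_le_Cmod.
  - eapply Rle_trans; [|apply Rmax_Cmod]; apply Rmax_r.
Qed.

Lemma hsum_exhaust {I : Type} (P : I -> Prop) (f : I -> C) (s : C) (L : nat -> list I) :
  hsum P f s -> (forall N, NoDup (L N)) -> (forall N x, In x (L N) -> P x) ->
  (forall N, incl (L N) (L (S N))) -> (forall x, P x -> exists N, In x (L N)) ->
  is_lim_seq (fun N => Cmod (lsum f (L N) - s)) 0.
Proof.
  intros [_ Hs] HN HP HI HE.
  assert (Hm : forall N M, (N <= M)%nat -> incl (L N) (L M)).
  { induction 1; [apply incl_refl|eapply incl_tran; eauto]. }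
  apply is_lim_seq_spec; intros eps; destruct (Hs eps (cond_pos eps)) as (L0 & N0 & P0 & H0).
  assert (HL : forall l, (forall x, In x l -> P x) -> exists N, incl l (L N)).
  { induction l as [|x l IH]; intros Pl; [exists 0%nat; intros ? []|].
    destruct IH as [N1 H1]; [intros; apply Pl; right; auto|].
    destruct (HE x) as [N2 H2]; [apply Pl; left; auto|].
    exists (N1 + N2)%nat; intros y [<-|Hy].
    - eapply Hm; [|exact H2]; lia.
    - eapply Hm; [|apply H1, Hy]; lia. }
  destruct (HL L0 P0) as [N HN0]; exists N; intros n Hn.
  rewrite Rminus_0_r, Rabs_pos_eq by apply Cmod_ge_0.
  apply H0; auto; [|apply HP].
  eapply incl_tran; [exact HN0|apply Hm; auto].
Qed.

(** * Sums over the integers and over integer vectors *)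

Definition anyZ : Z -> Prop := fun _ => True.

Lemma zrange_S (N : nat) :
  zrange (S N) = (- Z.of_nat (S N))%Z :: zrange N ++ [Z.of_nat (S N)].
Proof.
  unfold zrange; replace (2 * S N + 1)%nat with (S (2 * N + 1 + 1)) by lia.
  cbn [seq map]; f_equal.
  rewrite seq_app, map_app; f_equal.
  - rewrite <- seq_shift, map_map; apply map_ext; intros; lia.
  - cbn [seq map]; f_equal; lia.
Qed.

Lemma In_zrange (N : nat) (k : Z) : In k (zrange N) <-> (Z.abs k <= Z.of_nat N)%Z.
Proof.
  unfold zrange; rewrite in_map_iff; split.
  - intros (x & <- & Hx); apply in_seq in Hx; lia.
  - intros H; exists (Z.to_nat (k + Z.of_nat N)); rewrite in_seq; lia.
Qed.

Lemma NoDup_zrange (N : nat) : NoDup (zrange N).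
Proof.
  apply NoDup_map_NoDup_ForallPairs; [|apply seq_NoDup].
  intros a b _ _; lia.
Qed.

Lemma list_Z_bounded (L : list Z) : exists N, incl L (zrange N).
Proof.
  induction L as [|x L [N IH]]; [exists 0%nat; intros ? []|].
  exists (Z.to_nat (Z.abs x) + N)%nat; intros y [<-|Hy]; apply In_zrange; [lia|].
  apply IH, In_zrange in Hy; lia.
Qed.

Lemma zsum_hsum (f : Z -> C) (s : C) : hsum anyZ f s -> zsum f = s.
Proof.
  intros H; apply Clim_unique.
  apply (hsum_exhaust anyZ f s zrange H).
  - apply NoDup_zrange.
  - exact (fun _ _ _ => Logic.I).
  - intros N x; rewrite !In_zrange; lia.
  - intros x _; exists (Z.to_nat (Z.abs x)); apply In_zrange; lia.
Qed.

Lemma In_zbox (N n : nat) (r : list Z) :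
  In r (zbox N n) <-> length r = n /\ incl r (zrange N).
Proof.
  revert r; induction n as [|n IH]; intros r; cbn [zbox].
  - split.
    + intros [<-|[]]; split; [reflexivity|intros ? []].
    + intros [H _]; destruct r; [left; auto|discriminate].
  - rewrite in_flat_map; split.
    + intros (a & Ha & Hr); apply in_map_iff in Hr; destruct Hr as (r' & <- & Hr).
      apply IH in Hr; destruct Hr as [Hl Hi]; split; [cbn; lia|].
      intros x [<-|Hx]; auto.
    + intros [Hl Hi]; destruct r as [|a r]; [discriminate|].
      exists a; split; [apply Hi; left; auto|apply in_map, IH; split].
      * cbn in Hl; lia.
      * intros x Hx; apply Hi; right; auto.
Qed.

Lemma NoDup_zbox (N n : nat) : NoDup (zbox N n).
Proof.
  induction n as [|n IH]; cbn [zbox]; [repeat constructor; auto|].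
  induction (NoDup_zrange N) as [|a l Ha Nl IHl]; cbn [flat_map]; [constructor|].
  apply NoDup_app; auto.
  - apply NoDup_map_NoDup_ForallPairs; auto; intros x y _ _; congruence.
  - intros r H1 H2; apply in_map_iff in H1; destruct H1 as (r1 & <- & _).
    apply in_flat_map in H2; destruct H2 as (b & Hb & H2).
    apply in_map_iff in H2; destruct H2 as (r2 & E & _); congruence.
Qed.

Definition vec (n : nat) : list Z -> Prop := fun r => length r = n.

Lemma latsum_hsum (n : nat) (f : list Z -> C) (s : C) : hsum (vec n) f s -> latsum n f = s.
Proof.
  intros H; apply Clim_unique.
  apply (hsum_exhaust (vec n) f s (fun N => zbox N n) H).
  - intros; apply NoDup_zbox.
  - intros N x Hx; apply In_zbox in Hx; apply Hx.
  - intros N x; rewrite !In_zbox; intros [H1 H2]; split; auto.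
    intros y Hy; apply H2 in Hy; rewrite In_zrange in *; lia.
  - intros x Hx; destruct (list_Z_bounded x) as [N HN]; exists N; apply In_zbox; auto.
Qed.

Fixpoint vprod (f : nat -> Z -> C) (r : list Z) : C :=
  match r with
  | [] => 1
  | a :: r' => f 0%nat a * vprod (fun j => f (S j)) r'
  end.

Lemma cprod_nat_S (n : nat) (f : nat -> C) :
  cprod_nat (S n) f = f 0%nat * cprod_nat n (fun j => f (S j)).
Proof. unfold cprod_nat; cbn [seq map]; now rewrite <- seq_shift, map_map. Qed.

Lemma csum_nat_S (n : nat) (f : nat -> C) :
  csum_nat (S n) f = f 0%nat + csum_nat n (fun j => f (S j)).
Proof. unfold csum_nat; cbn [seq map]; now rewrite <- seq_shift, map_map. Qed.

Lemma csum_nat_ext (n : nat) (f g : nat -> C) :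
  (forall k, (k < n)%nat -> f k = g k) -> csum_nat n f = csum_nat n g.
Proof. intros H; apply lsum_ext; intros k Hk; apply in_seq in Hk; apply H; lia. Qed.

Lemma csum_nat_scal (n : nat) (c : C) (f : nat -> C) :
  csum_nat n (fun k => c * f k) = c * csum_nat n f.
Proof. apply lsum_scal. Qed.

Lemma csum_nat_plus (n : nat) (f g : nat -> C) :
  csum_nat n (fun k => f k + g k) = csum_nat n f + csum_nat n g.
Proof. apply lsum_plus. Qed.

Lemma csum_nat_const (n : nat) (c : C) : csum_nat n (fun _ => c) = NtoC n * c.
Proof.
  induction n as [|n IH]; [unfold csum_nat, NtoC; cbn; ring|].
  rewrite csum_nat_S, IH; unfold NtoC; rewrite S_INR, RtoC_plus; ring.
Qed.

(** Multiplies out a finite product of series over the integers, by induction through Z^(n+1) = Z x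
    Z^n. *)
Lemma hsum_vprod (n : nat) (f : nat -> Z -> C) (s : nat -> C) :
  (forall j, (j < n)%nat -> hsum anyZ (f j) (s j)) ->
  hsum (vec n) (vprod f) (cprod_nat n s).
Proof.
  revert f s; induction n as [|n IH]; intros f s H.
  - apply (hsum_single (vec 0) (vprod f) []).
    intros [|a r]; split; [reflexivity|reflexivity|discriminate|discriminate].
  - rewrite cprod_nat_S.
    apply hsum_ext with (fun r => f 0%nat (hd 0%Z r) * vprod (fun j => f (S j)) (tl r)).
    { intros [|a r]; [discriminate|reflexivity]. }
    apply (hsum_reindex (vec (S n)) (fun p => anyZ (fst p) /\ vec n (snd p))
             (fun r => (hd 0%Z r, tl r)) (fun p => fst p :: snd p)
             (fun p => f 0%nat (fst p) * vprod (fun j => f (S j)) (snd p))).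
    + intros [|a r] Hr; [discriminate|]; split; [exact Logic.I|]; unfold vec in *; cbn in *; lia.
    + intros [a r] [_ Hr]; unfold vec in *; cbn in *; lia.
    + intros [|a r] Hr; [discriminate|reflexivity].
    + intros [a r] _; reflexivity.
    + apply hsum_prod; [apply H; lia|].
      apply IH; intros; apply H; lia.
Qed.

(** * Affine maps of integer vectors *)

(** Both changes of variables in Z^n have this form: [e = -1] reflects and [e = 1] keeps the vector,
    followed by a translation along (1, ..., 1). *)
Definition vaff (e t : Z) (r : list Z) : list Z := map (fun a => e * a + t)%Z r.

Lemma vec_vaff n e t r : vec n r -> vec n (vaff e t r).
Proof. unfold vec, vaff; now rewrite length_map. Qed.

Lemma vaff_vaff e t e' t' r : vaff e t (vaff e' t' r) = vaff (e * e') (e * t' + t) r.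
Proof. unfold vaff; rewrite map_map; apply map_ext; intros; ring. Qed.

Lemma vaff_id r : vaff 1 0 r = r.
Proof.
  unfold vaff; rewrite <- (map_id r) at 2; apply map_ext; intros; ring.
Qed.

Lemma zsumv_vaff n e t r : vec n r ->
  zsumv (vaff e t r) = (e * zsumv r + Z.of_nat n * t)%Z.
Proof.
  unfold vec; intros <-; induction r as [|a r IH]; [cbn; ring|].
  change (zsumv (vaff e t (a :: r))) with (e * a + t + zsumv (vaff e t r))%Z.
  change (zsumv (a :: r)) with (a + zsumv r)%Z.
  rewrite IH; cbn [length]; lia.
Qed.

Lemma zsumsq_vaff n e t r : vec n r ->
  zsumsq (vaff e t r)
  = (e * e * zsumsq r + 2 * e * t * zsumv r + Z.of_nat n * t * t)%Z.
Proof.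
  unfold vec; intros <-; induction r as [|a r IH]; [cbn; ring|].
  change (zsumsq (vaff e t (a :: r)))
    with ((e * a + t) * (e * a + t) + zsumsq (vaff e t r))%Z.
  change (zsumv (a :: r)) with (a + zsumv r)%Z.
  change (zsumsq (a :: r)) with (a * a + zsumsq r)%Z.
  rewrite IH; cbn [length]; lia.
Qed.

Lemma ZtoC_plus a b : ZtoC (a + b) = ZtoC a + ZtoC b.
Proof. unfold ZtoC; now rewrite plus_IZR, RtoC_plus. Qed.
Lemma ZtoC_mult a b : ZtoC (a * b) = ZtoC a * ZtoC b.
Proof. unfold ZtoC; now rewrite mult_IZR, RtoC_mult. Qed.
Lemma ZtoC_opp a : ZtoC (- a) = - ZtoC a.
Proof. unfold ZtoC; now rewrite opp_IZR, RtoC_opp. Qed.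
Lemma ZtoC_nat n : ZtoC (Z.of_nat n) = NtoC n.
Proof. unfold ZtoC, NtoC; now rewrite INR_IZR_INZ. Qed.

Lemma zdot_vaff n e t r y : vec n r ->
  zdot (vaff e t r) y = ZtoC e * zdot r y + ZtoC t * csum_nat n y.
Proof.
  unfold vec; intros <-; revert y; induction r as [|a r IH]; intros y.
  - unfold csum_nat; cbn; ring.
  - cbn [length]; rewrite csum_nat_S; cbn [vaff map zdot]; fold (vaff e t r).
    rewrite IH, ZtoC_plus, ZtoC_mult; ring.
Qed.

(** * The complex exponential *)

Lemma Re_plus (a b : C) : Re (a + b) = (Re a + Re b)%R.
Proof. reflexivity. Qed.
Lemma Im_plus (a b : C) : Im (a + b) = (Im a + Im b)%R.
Proof. reflexivity. Qed.

Lemma cexp_plus (a b : C) : cexp (a + b) = cexp a * cexp b.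
Proof.
  unfold cexp, Cmult; rewrite Re_plus, Im_plus, exp_plus, cos_plus, sin_plus; cbn.
  f_equal; ring.
Qed.

Lemma cexp_0 : cexp 0 = 1.
Proof. unfold cexp, RtoC; cbn; rewrite exp_0, cos_0, sin_0; f_equal; ring. Qed.

Lemma Cmod_cexp (a : C) : Cmod (cexp a) = exp (Re a).
Proof.
  unfold Cmod, cexp; cbn.
  replace (_ + _)%R with (exp (Re a) * exp (Re a)
             * (Rsqr (sin (Im a)) + Rsqr (cos (Im a))))%R by (unfold Rsqr; ring).
  rewrite sin2_cos2, Rmult_1_r; apply sqrt_square; left; apply exp_pos.
Qed.

Lemma cexp_neq_0 (a : C) : cexp a <> 0.
Proof. apply Cmod_gt_0; rewrite Cmod_cexp; apply exp_pos. Qed.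

Lemma cexp_opp (a : C) : cexp (- a) = / cexp a.
Proof.
  assert (E : cexp (- a) * cexp a = 1).
  { rewrite <- cexp_plus, <- cexp_0; f_equal; ring. }
  transitivity (cexp (- a) * cexp a * / cexp a); [field; apply cexp_neq_0|].
  rewrite E; field; apply cexp_neq_0.
Qed.

Lemma cexp_R (x : R) : cexp (RtoC x) = RtoC (exp x).
Proof. unfold cexp, RtoC; cbn; rewrite cos_0, sin_0; f_equal; ring. Qed.

Lemma cexp_2piZ (k : Z) : cexp (2 * RtoC PI * Ci * ZtoC k) = 1.
Proof.
  assert (H1 : cexp (2 * RtoC PI * Ci) = 1).
  { unfold cexp, RtoC, Ci; cbn.
    replace (_ - _)%R with 0%R by ring; replace (_ + _)%R with (2 * PI)%R by ring.
    rewrite exp_0, cos_2PI, sin_2PI; f_equal; ring. }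
  assert (Hn : forall n, cexp (2 * RtoC PI * Ci * NtoC n) = 1).
  { induction n as [|n IH].
    - rewrite <- cexp_0; f_equal; unfold NtoC; cbn; ring.
    - replace (2 * RtoC PI * Ci * NtoC (S n))
        with (2 * RtoC PI * Ci * NtoC n + 2 * RtoC PI * Ci)
        by (unfold NtoC; rewrite S_INR, RtoC_plus; ring).
      rewrite cexp_plus, IH, H1; ring. }
  destruct (Z_le_gt_dec 0 k).
  - rewrite <- (Z2Nat.id k), ZtoC_nat by lia; auto.
  - replace k with (- Z.of_nat (Z.to_nat (- k)))%Z by lia.
    rewrite ZtoC_opp, ZtoC_nat.
    replace (2 * RtoC PI * Ci * - NtoC (Z.to_nat (- k)))
      with (- (2 * RtoC PI * Ci * NtoC (Z.to_nat (- k)))) by ring.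
    rewrite cexp_opp, Hn; field.
Qed.

Lemma Rabs_sin_le (x : R) : (Rabs (sin x) <= Rabs x)%R.
Proof.
  assert (G : forall t, (0 <= t)%R -> (Rabs (sin t) <= t)%R).
  { intros t Ht; destruct (Req_dec t 0) as [->|Hn]; [rewrite sin_0, Rabs_R0; lra|].
    destruct (Rle_dec t 1).
    - rewrite Rabs_pos_eq; [left; apply sin_lt_x; lra|].
      apply sin_ge_0; pose proof PI2_1; lra.
    - pose proof (SIN_bound t); apply Rabs_le; lra. }
  destruct (Rle_dec 0 x) as [H|H].
  - rewrite (Rabs_pos_eq x) by lra; auto.
  - rewrite <- Rabs_Ropp, <- sin_neg, (Rabs_left x) by lra; apply G; lra.
Qed.

Lemma one_minus_cos (x : R) : (1 - cos x = 2 * (sin (x / 2) * sin (x / 2)))%R.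
Proof. replace x with (2 * (x / 2))%R at 1 by field; rewrite cos_2a_sin; ring. Qed.

Lemma one_minus_cos_le (x : R) : (0 <= 1 - cos x <= Rabs x * Rabs x / 2)%R.
Proof.
  rewrite one_minus_cos; pose proof (Rabs_sin_le (x / 2)) as H.
  replace (sin (x / 2) * sin (x / 2))%R with (Rabs (sin (x / 2)) * Rabs (sin (x / 2)))%R
    by (rewrite <- Rabs_mult; apply Rabs_pos_eq; nra).
  replace (Rabs (x / 2)) with (Rabs x / 2)%R in H.
  - pose proof (Rabs_pos (sin (x / 2))); nra.
  - unfold Rdiv; rewrite Rabs_mult, (Rabs_pos_eq (/ 2)); lra.
Qed.

(** Mean value theorem with 1 - cos c = 2 sin^2 (c/2) <= |c|. Quadratic order is what
    [cexp_taylor1_le] asks for. *)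
Lemma sin_minus_id_le (x : R) : (Rabs (sin x - x) <= Rabs x * Rabs x)%R.
Proof.
  destruct (MVT_gen (fun t => sin t - t)%R 0 x (fun t => cos t - 1)%R) as (c & Hc & E).
  - intros t _; auto_derive; [auto|ring].
  - intros t _; apply continuity_pt_minus; [apply continuity_sin|apply continuity_pt_id].
  - rewrite sin_0 in E; replace (sin x - x)%R with ((cos c - 1) * (x - 0))%R by lra.
    rewrite Rabs_mult, Rminus_0_r; apply Rmult_le_compat_r; [apply Rabs_pos|].
    rewrite Rabs_minus_sym.
    assert (H : (Rabs c <= Rabs x)%R).
    { unfold Rmin, Rmax in Hc; destruct (Rle_dec 0 x);
        [rewrite !Rabs_pos_eq|rewrite !Rabs_left1]; lra. }
    pose proof (one_minus_cos_le c) as H1; rewrite one_minus_cos in *.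
    pose proof (Rabs_sin_le (c / 2)) as H2; pose proof (SIN_bound (c / 2)) as H3.
    replace (Rabs (c / 2)) with (Rabs c / 2)%R in H2
      by (unfold Rdiv; rewrite Rabs_mult, (Rabs_pos_eq (/ 2)); lra).
    rewrite Rabs_pos_eq by tauto.
    assert (sin (c / 2) * sin (c / 2) <= Rabs (sin (c / 2)))%R; [|lra].
    unfold Rabs; destruct (Rcase_abs (sin (c / 2))); nra.
Qed.

Lemma exp_minus_1_le (a : R) : (Rabs (exp a - 1) <= Rabs a * exp (Rabs a))%R.
Proof.
  pose proof (exp_ineq1_le a) as H1; pose proof (exp_ineq1_le (- a)) as H2.
  pose proof (exp_pos a) as H3.
  assert (H4 : (exp a * exp (- a) = 1)%R) by (rewrite <- exp_plus, Rplus_opp_r; apply exp_0).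
  destruct (Rle_dec 0 a).
  - rewrite (Rabs_pos_eq a), Rabs_pos_eq by lra; nra.
  - rewrite (Rabs_left a) by lra; rewrite Rabs_left1 by nra.
    assert (1 <= exp (- a))%R by lra; nra.
Qed.

Lemma exp_taylor1_le (a : R) : (Rabs (exp a - 1 - a) <= Rabs a * Rabs a * exp (Rabs a))%R.
Proof.
  pose proof (exp_ineq1_le a) as H1; pose proof (exp_ineq1_le (- a)) as H2.
  pose proof (exp_pos a) as H3.
  assert (H4 : (exp a * exp (- a) = 1)%R) by (rewrite <- exp_plus, Rplus_opp_r; apply exp_0).
  rewrite Rabs_pos_eq by lra.
  assert (H5 : (exp a - 1 <= a * exp a)%R) by nra.
  destruct (Rle_dec 0 a).
  - rewrite (Rabs_pos_eq a) by lra; nra.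
  - rewrite (Rabs_left a) by lra.
    assert (1 <= exp (- a))%R by lra.
    apply Rle_trans with (a * a)%R; nra.
Qed.

Lemma exp_le (x y : R) : (x <= y)%R -> (exp x <= exp y)%R.
Proof. intros [H| ->]; [left; now apply exp_increasing|lra]. Qed.

Lemma Im_le_Cmod (a : C) : (Rabs (Im a) <= Cmod a)%R.
Proof. eapply Rle_trans; [|apply Rmax_Cmod]; apply Rmax_r. Qed.

Lemma Cmod_le_Re_Im (a : C) : (Cmod a <= Rabs (Re a) + Rabs (Im a))%R.
Proof.
  replace a with (RtoC (Re a) + Ci * RtoC (Im a)) at 1.
  - eapply Rle_trans; [apply Cmod_triangle|].
    rewrite Cmod_mult, Cmod_Ci, !Cmod_R; lra.
  - destruct a; unfold RtoC, Ci, Cplus, Cmult; cbn; f_equal; ring.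
Qed.

(** The real and the imaginary part split into two errors each, and each of the four is at most
    |X|^2 exp |X|. *)
Lemma cexp_taylor1_le (X : C) :
  (Cmod (cexp X - 1 - X) <= 5 * (Cmod X * Cmod X * exp (Cmod X)))%R.
Proof.
  eapply Rle_trans; [apply Cmod_le_Re_Im|].
  destruct X as [a b]; set (M := Cmod (a, b)).
  assert (Ha : (Rabs a <= M)%R) by apply (re_le_Cmod (a, b)).
  assert (Hb : (Rabs b <= M)%R) by apply (Im_le_Cmod (a, b)).
  change (Re (cexp (a, b) - 1 - (a, b))) with (exp a * cos b - 1 - a)%R.
  change (Im (cexp (a, b) - 1 - (a, b))) with (exp a * sin b - 0 - b)%R.
  replace (exp a * cos b - 1 - a)%R with ((exp a - 1 - a) + - (exp a * (1 - cos b)))%R by ring.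
  replace (exp a * sin b - 0 - b)%R with (exp a * (sin b - b) + (exp a - 1) * b)%R by ring.
  set (E := exp M); assert (HE : (0 < E)%R) by apply exp_pos.
  assert (Ea : (exp a <= E)%R).
  { apply exp_le; pose proof (Rle_abs a); lra. }
  assert (Eb : (exp (Rabs a) <= E)%R).
  { apply exp_le; lra. }
  pose proof (Rabs_pos a); pose proof (Rabs_pos b); pose proof (exp_pos a).
  pose proof (exp_pos (Rabs a)).
  pose proof (one_minus_cos_le b) as [C1 C2].
  assert (HM : (Rabs b * Rabs b <= M * M)%R) by nra.
  assert (HM' : (Rabs a * Rabs a <= M * M)%R) by nra.
  assert (HM2 : (Rabs a * Rabs b <= M * M)%R) by nra.
  assert (HMM : (0 <= M * M)%R) by nra.
  assert (T1 : (Rabs (exp a - 1 - a) <= M * M * E)%R).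
  { eapply Rle_trans; [apply exp_taylor1_le|]; apply Rmult_le_compat; try nra. }
  assert (T2 : (Rabs (- (exp a * (1 - cos b))) <= M * M * E)%R).
  { rewrite Rabs_Ropp, Rabs_mult, (Rabs_pos_eq (exp a)), (Rabs_pos_eq (1 - cos b)) by lra.
    rewrite Rmult_comm; apply Rmult_le_compat; lra. }
  assert (T3 : (Rabs (exp a * (sin b - b)) <= M * M * E)%R).
  { rewrite Rabs_mult, (Rabs_pos_eq (exp a)) by lra; rewrite Rmult_comm.
    apply Rmult_le_compat; try lra; [apply Rabs_pos|].
    eapply Rle_trans; [apply sin_minus_id_le|auto]. }
  assert (T4 : (Rabs ((exp a - 1) * b) <= M * M * E)%R).
  { rewrite Rabs_mult; pose proof (exp_minus_1_le a).
    apply Rle_trans with (Rabs a * exp (Rabs a) * Rabs b)%R;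
      [apply Rmult_le_compat_r; auto|].
    replace (Rabs a * exp (Rabs a) * Rabs b)%R
      with (Rabs a * Rabs b * exp (Rabs a))%R by ring.
    apply Rmult_le_compat; try lra; nra. }
  eapply Rle_trans; [apply Rplus_le_compat; apply Rabs_triang|].
  assert (0 <= M * M * E)%R by nra; lra.
Qed.

(** * Summation of exponentially decaying families *)

(** A two-sided geometric series. The growth 1/h is compensated by the weight h of a Riemann sum,
    which makes the later bounds uniform in the step. *)
Lemma rsum_exp_le (h : R) (L : list Z) : (0 < h <= 1)%R -> NoDup L ->
  (rsum (fun n => exp (- (h * Rabs (IZR n)))) L <= 4 / h)%R.
Proof.
  intros Hh NL; destruct (list_Z_bounded L) as [N HN].
  apply Rle_trans with (rsum (fun n => exp (- (h * Rabs (IZR n)))) (zrange N)).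
  { apply rsum_incl; auto; intros; left; apply exp_pos. }
  set (b := exp (- h)).
  (* From exp h >= 1 + h one gets 1 - exp (- h) >= h / (1 + h), and h <= 1. *)
  assert (Hb : (1 - b >= h / 2)%R).
  { unfold b; pose proof (exp_ineq1_le h) as H1; pose proof (exp_pos (- h)) as H2.
    assert (H3 : (exp h * exp (- h) = 1)%R) by (rewrite <- exp_plus, Rplus_opp_r; apply exp_0).
    nra. }
  assert (Hb0 : (0 < b)%R) by apply exp_pos.
  assert (G : forall N, ((1 - b) * rsum (fun n => exp (- (h * Rabs (IZR n)))) (zrange N)
                 = 1 + b - 2 * exp (- (h * INR (S N))))%R).
  { induction N0 as [|K IH].
    - unfold rsum, zrange; cbn -[IZR]; rewrite Rabs_R0, Rmult_0_r, Ropp_0, exp_0.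
      rewrite Rmult_1_r; fold b; ring.
    - rewrite zrange_S.
      change (rsum ?g (?x :: ?l ++ ?l')) with (g x + rsum g (l ++ l'))%R.
      rewrite rsum_app, opp_IZR, Rabs_Ropp, <- INR_IZR_INZ.
      unfold rsum at 2; cbn [map fold_right].
      rewrite <- INR_IZR_INZ, Rabs_pos_eq by apply pos_INR.
      replace (exp (- (h * INR (S (S K))))) with (exp (- (h * INR (S K))) * b)%R.
      + nra.
      + unfold b; rewrite <- exp_plus, (S_INR (S K)); f_equal; ring. }
  specialize (G N); pose proof (exp_pos (- (h * INR (S N)))) as Hp.
  assert (Hb1 : (b < 1)%R) by lra.
  set (R := rsum _ _) in *.
  assert (HR : ((1 - b) * R <= 2)%R) by lra.
  assert (HR0 : (0 <= R)%R) by (apply rsum_nonneg; intros; left; apply exp_pos).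
  apply Rmult_le_reg_r with h; [lra|].
  replace (4 / h * h)%R with 4%R by (field; lra); nra.
Qed.

Lemma zsum_exp_decay (f : Z -> C) (B h : R) : (0 < h <= 1)%R ->
  (forall n, (Cmod (f n) <= B * exp (- (h * Rabs (IZR n))))%R) ->
  hsum anyZ f (zsum f) /\ (Cmod (zsum f) <= 4 * B / h)%R.
Proof.
  intros Hh Hf.
  assert (HB : bounded_sums anyZ f (4 * B / h)).
  { apply bounded_sums_le with (fun n => B * exp (- (h * Rabs (IZR n))))%R; [auto|].
    intros L NL _; rewrite rsum_scal.
    replace (4 * B / h)%R with (B * (4 / h))%R by (field; lra).
    apply Rmult_le_compat_l; [|apply rsum_exp_le; auto].
    specialize (Hf 0%Z); pose proof (Cmod_ge_0 (f 0%Z)).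
    rewrite Rabs_R0, Rmult_0_r, Ropp_0, exp_0 in Hf; lra. }
  destruct (hsum_exists _ _ _ HB) as [s Hs].
  rewrite (zsum_hsum f s Hs); split; auto.
  eapply hsum_Cmod_le; eauto.
Qed.

(** Complete the square: [D] is the exponential of the maximum of B (1 + u) + u - kappa u^2. *)
Lemma gauss_le_exp (B kappa : R) : (0 < kappa)%R ->
  exists D, (0 < D)%R /\ forall u, (0 <= u)%R ->
  (exp (B * (1 + u) - kappa * (u * u)) <= D * exp (- u))%R.
Proof.
  intros Hk; exists (exp (B + (B + 1) * (B + 1) / (4 * kappa)))%R; split; [apply exp_pos|].
  intros u Hu; rewrite <- exp_plus; apply exp_le.
  assert (0 <= kappa * ((u - (B + 1) / (2 * kappa)) * (u - (B + 1) / (2 * kappa))))%R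
    by (apply Rmult_le_pos; [lra|apply Rle_0_sqr]).
  replace (kappa * ((u - (B + 1) / (2 * kappa)) * (u - (B + 1) / (2 * kappa))))%R
    with (kappa * (u * u) - (B + 1) * u + (B + 1) * (B + 1) / (4 * kappa))%R in H
    by (field; lra).
  set (q := ((B + 1) * (B + 1) / (4 * kappa))%R) in *; lra.
Qed.

(** Absorbs powers of a large quantity into an exponential, which the Gaussian decay then
    dominates. *)
Lemma exp_mul_nat_ge (U : R) (p : nat) : (1 <= U)%R -> (U ^ p <= exp (INR p * U))%R.
Proof.
  intros HU; induction p as [|p IH].
  - cbn; rewrite Rmult_0_l, exp_0; lra.
  - rewrite S_INR, Rmult_plus_distr_r, exp_plus, Rmult_1_l, Rmult_comm; cbn [pow].
    rewrite Rmult_comm, (Rmult_comm (exp U)).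
    pose proof (exp_ineq1_le U); apply Rmult_le_compat; try lra.
    apply pow_le; lra.
Qed.

(** * Riemann sums of the Gaussian along complex lines *)

Definition gauss (x : C) : C := cexp (- (x * x)).

Definition gline (h : R) (w rho : C) (n : Z) : C := w + rho * RtoC (h * IZR n).

(** Riemann sum of step [h] for the integral of exp (- x^2) dx along the line [w + rho R]. *)
Definition riemann_gauss (h : R) (w rho : C) : C :=
  zsum (fun n => rho * RtoC h * gauss (gline h w rho n)).

Lemma Cmod_mult_le (a b : C) (x y : R) :
  (Cmod a <= x)%R -> (Cmod b <= y)%R -> (Cmod (a * b) <= x * y)%R.
Proof.
  intros Ha Hb; rewrite Cmod_mult; apply Rmult_le_compat; auto; apply Cmod_ge_0.
Qed.

Lemma Cmod_plus_le (a b : C) (x y : R) :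
  (Cmod a <= x)%R -> (Cmod b <= y)%R -> (Cmod (a + b) <= x + y)%R.
Proof. intros Ha Hb; eapply Rle_trans; [apply Cmod_triangle|lra]. Qed.

Lemma Cmod_minus_le (a b : C) (x y : R) :
  (Cmod a <= x)%R -> (Cmod b <= y)%R -> (Cmod (a - b) <= x + y)%R.
Proof. intros Ha Hb; apply Cmod_plus_le; auto; rewrite Cmod_opp; auto. Qed.

Lemma gauss_plus (x e : C) : gauss (x + e) = gauss x * cexp (- (2 * x * e) - e * e).
Proof. unfold gauss; rewrite <- cexp_plus; f_equal; ring. Qed.

Lemma Re_ge_opp_Cmod (a : C) : (- Cmod a <= Re a)%R.
Proof. pose proof (re_le_Cmod a) as H; apply Rabs_le_between in H; lra. Qed.

(** In the expanded square only [u^2 rho^2] is quadratic in [u], and its real part is at least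
    [kappa u^2]; the other two terms are bounded through [A]. *)
Lemma Cmod_gauss_line (w rho : C) (A kappa u : R) : (1 <= A)%R ->
  (Cmod w <= A)%R -> (Cmod rho <= A)%R -> (kappa <= Re (rho * rho))%R ->
  (Cmod (gauss (w + rho * RtoC u))
   <= exp (2 * (A * A) * (1 + Rabs u) - kappa * (Rabs u * Rabs u)))%R.
Proof.
  intros HA Hw Hr Hk; unfold gauss; rewrite Cmod_cexp; apply exp_le.
  replace (Re (- ((w + rho * RtoC u) * (w + rho * RtoC u))))
    with (- Re (w * w) - 2 * Re (RtoC u * (w * rho)) - u * u * Re (rho * rho))%R
    by (destruct w, rho; unfold RtoC; cbn; ring).
  pose proof (Re_ge_opp_Cmod (w * w)) as H1.
  pose proof (Re_ge_opp_Cmod (RtoC u * (w * rho))) as H2.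
  pose proof (Cmod_mult_le _ _ _ _ Hw Hw) as H3.
  assert (H4 : (Cmod (RtoC u * (w * rho)) <= Rabs u * (A * A))%R).
  { apply Cmod_mult_le; [rewrite Cmod_R; lra|apply Cmod_mult_le; auto]. }
  replace (Rabs u * Rabs u)%R with (u * u)%R
    by (rewrite <- Rabs_mult, Rabs_pos_eq; nra).
  assert (0 <= A * A)%R by nra.
  assert (kappa * (u * u) <= u * u * Re (rho * rho))%R by nra.
  lra.
Qed.

Lemma hsum_gauss_line (w rho : C) (kappa : R) : (0 < kappa <= Re (rho * rho))%R ->
  forall h c B, (0 < h <= 1)%R ->
  (forall n, (Cmod (c n) <= B * (1 + Rabs (h * IZR n)))%R) ->
  exists s, hsum anyZ (fun n => c n * gauss (gline h w rho n)) s.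
Proof.
  intros [Hk Hkr] h c B Hh Hc.
  set (A := (1 + Cmod w + Cmod rho)%R).
  pose proof (Cmod_ge_0 w); pose proof (Cmod_ge_0 rho).
  destruct (gauss_le_exp (1 + 2 * (A * A)) kappa Hk) as (D & HD & HG).
  assert (HB : (0 <= B)%R).
  { specialize (Hc 0%Z); rewrite Rmult_0_r, Rabs_R0 in Hc.
    pose proof (Cmod_ge_0 (c 0%Z)); lra. }
  exists (zsum (fun n => c n * gauss (gline h w rho n))).
  apply (zsum_exp_decay _ (B * D) h Hh); intros n.
  set (u := (h * IZR n)%R).
  replace (h * Rabs (IZR n))%R with (Rabs u)
    by (unfold u; rewrite Rabs_mult, (Rabs_pos_eq h); lra).
  eapply Rle_trans.
  { apply Cmod_mult_le; [apply Hc|].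
    apply (Cmod_gauss_line w rho A kappa); unfold A; auto; lra. }
  fold u; rewrite (Rmult_assoc B (1 + _)%R), (Rmult_assoc B D).
  apply Rmult_le_compat_l; auto.
  eapply Rle_trans; [|apply (HG (Rabs u)), Rabs_pos].
  replace ((1 + 2 * (A * A)) * (1 + Rabs u) - kappa * (Rabs u * Rabs u))%R
    with ((1 + Rabs u) + (2 * (A * A) * (1 + Rabs u) - kappa * (Rabs u * Rabs u)))%R by ring.
  rewrite exp_plus; apply Rmult_le_compat_r; [left; apply exp_pos|].
  pose proof (exp_ineq1_le (1 + Rabs u)); lra.
Qed.

Lemma hsum_riemann_gauss (h : R) (w rho : C) :
  (0 < h <= 1)%R -> (0 < Re (rho * rho))%R ->
  hsum anyZ (fun n => rho * RtoC h * gauss (gline h w rho n)) (riemann_gauss h w rho).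
Proof.
  intros Hh Hr.
  destruct (hsum_gauss_line w rho (Re (rho * rho)) (conj Hr (Rle_refl _)) h
              (fun _ => rho * RtoC h) (Cmod (rho * RtoC h)) Hh) as [s Hs].
  - intros n; pose proof (Cmod_ge_0 (rho * RtoC h)); pose proof (Rabs_pos (h * IZR n)); nra.
  - unfold riemann_gauss; now rewrite (zsum_hsum _ s Hs).
Qed.

(** The discrete contour integral of [gauss] around the cell with vertices [x], [x + rho h], [x + d]
    and [x + rho h + d + drho h]: each edge is multiplied by the value at its lower or left end. It
    is written with differences of [gauss] so that the cancellation can be read off. *)
Definition quad_error (x rho d drho : C) (h : R) : C :=
  (gauss (x + rho * RtoC h) - gauss x) * (d + drho * RtoC h)
  - (gauss (x + d) - gauss x) * (rho + drho) * RtoC h.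

(* The contributions of first order in [h] and [d] cancel because [gauss] is
   holomorphic, so that only third order terms remain. *)
Lemma quad_error_factor (x rho d drho : C) (h : R) :
  let X1 := - (2 * x * (rho * RtoC h)) - rho * RtoC h * (rho * RtoC h) in
  let X2 := - (2 * x * d) - d * d in
  quad_error x rho d drho h
  = gauss x * (- (2 * x * RtoC h * (drho * (rho * RtoC h - d)))
      + ((cexp X1 - 1 - X1) - rho * RtoC h * (rho * RtoC h)) * (d + drho * RtoC h)
      - ((cexp X2 - 1 - X2) - d * d) * ((rho + drho) * RtoC h)).
Proof.
  intros X1 X2; unfold quad_error; rewrite !gauss_plus; fold X1 X2.
  generalize (cexp X1) (cexp X2); intros c1 c2; unfold X1, X2; ring.
Qed.

(** Here [V] majorizes the point and [p] measures the distance of the lines. The order h p (h + p)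
    leaves p (h + p) after summation over about 1/h relevant cells, hence O(h) after about 1/p moves
    with p <= h. *)
Lemma quad_error_bound (x rho d drho : C) (h p A V : R) :
  (0 < h <= 1)%R -> (0 < p <= 1)%R -> (1 <= A <= V)%R ->
  (Cmod x <= V)%R -> (Cmod rho <= A)%R -> (Cmod d <= V * p)%R -> (Cmod drho <= V * p)%R ->
  (Cmod (quad_error x rho d drho h)
   <= 120 * (h * p * (h + p)) * exp (5 * V + 3 * (A * V) + 3 * (V * V * p))
      * Cmod (gauss x))%R.
Proof.
  intros Hh Hp HA Hx Hr Hd Hdr; rewrite quad_error_factor.
  set (X1 := - (2 * x * (rho * RtoC h)) - rho * RtoC h * (rho * RtoC h)).
  set (X2 := - (2 * x * d) - d * d).
  set (E1 := exp (3 * (A * V))); set (E2 := exp (3 * (V * V * p))).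
  assert (C2 : Cmod 2 = 2%R) by (rewrite Cmod_R; apply Rabs_pos_eq; lra).
  assert (Ch : Cmod (RtoC h) = h) by (rewrite Cmod_R; apply Rabs_pos_eq; lra).
  assert (HE1 : (1 <= E1)%R).
  { unfold E1; rewrite <- exp_0; apply exp_le; nra. }
  assert (HVV : (1 <= V * V)%R) by nra.
  assert (HVVp : (0 <= V * V * p)%R) by nra.
  assert (HE2 : (1 <= E2)%R).
  { unfold E2; rewrite <- exp_0; apply exp_le; lra. }
  assert (Hrh : (Cmod (rho * RtoC h) <= A * h)%R) by (apply Cmod_mult_le; lra).
  (* [|rho| <= A] keeps the exponent of [E1] linear in [V]. Along the line [V] grows like [u], so a
     constant multiple of V^2 could outgrow the Gaussian; the exponent of [E2] is quadratic but
     carries the small factor [p]. *)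
  assert (B1 : (Cmod X1 <= 3 * (A * V) * h)%R).
  { unfold X1.
    apply Rle_trans with (2 * V * (A * h) + (A * h) * (A * h))%R.
    - apply Cmod_minus_le; [rewrite Cmod_opp|]; repeat apply Cmod_mult_le; lra.
    - assert (A * h * (A * h) <= A * V * h)%R; [|lra].
      replace (A * h * (A * h))%R with (A * h * A * h)%R by ring.
      apply Rmult_le_compat_r; [lra|].
      rewrite Rmult_assoc; apply Rmult_le_compat_l; nra. }
  assert (B1' : (Cmod X1 <= 3 * (A * V))%R) by (assert (0 <= A * V)%R by nra; nra).
  assert (B1'' : (Cmod X1 <= 3 * (V * V) * h)%R).
  { eapply Rle_trans; [exact B1|]; apply Rmult_le_compat_r; nra. }
  assert (B2 : (Cmod X2 <= 3 * (V * V * p))%R).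
  { unfold X2.
    apply Rle_trans with (2 * V * (V * p) + (V * p) * (V * p))%R.
    - apply Cmod_minus_le; [rewrite Cmod_opp|]; repeat apply Cmod_mult_le; lra.
    - replace (V * p * (V * p))%R with (V * V * p * p)%R by ring; nra. }
  assert (Sq1 : (Cmod X1 * Cmod X1 <= 9 * V ^ 4 * (h * h))%R).
  { replace (9 * V ^ 4 * (h * h))%R with (3 * (V * V) * h * (3 * (V * V) * h))%R by ring.
    apply Rmult_le_compat; auto; apply Cmod_ge_0. }
  assert (Sq2 : (Cmod X2 * Cmod X2 <= 9 * V ^ 4 * (p * p))%R).
  { replace (9 * V ^ 4 * (p * p))%R with (3 * (V * V * p) * (3 * (V * V * p)))%R by ring.
    apply Rmult_le_compat; auto; apply Cmod_ge_0. }
  assert (HV4 : (V * V <= V ^ 4)%R) by (replace (V ^ 4)%R with (V * V * (V * V))%R by ring; nra).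
  assert (R1 : (Cmod ((cexp X1 - 1 - X1) - rho * RtoC h * (rho * RtoC h))
                <= 46 * V ^ 4 * (h * h) * E1)%R).
  { apply Rle_trans with (5 * (9 * V ^ 4 * (h * h) * E1) + A * h * (A * h))%R.
    - apply Cmod_minus_le; [|apply Cmod_mult_le; auto].
      eapply Rle_trans; [apply cexp_taylor1_le|].
      apply Rmult_le_compat_l; [lra|].
      apply Rmult_le_compat; auto; [|left; apply exp_pos|apply exp_le; auto].
      apply Rmult_le_pos; apply Cmod_ge_0.
    - assert (A * h * (A * h) <= V ^ 4 * (h * h) * E1)%R; [|lra].
      replace (A * h * (A * h))%R with (A * A * (h * h) * 1)%R by ring.
      apply Rmult_le_compat; try nra; apply Rmult_le_compat; nra. }
  assert (R2 : (Cmod ((cexp X2 - 1 - X2) - d * d) <= 46 * V ^ 4 * (p * p) * E2)%R).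
  { apply Rle_trans with (5 * (9 * V ^ 4 * (p * p) * E2) + V * p * (V * p))%R.
    - apply Cmod_minus_le; [|apply Cmod_mult_le; auto].
      eapply Rle_trans; [apply cexp_taylor1_le|].
      apply Rmult_le_compat_l; [lra|].
      apply Rmult_le_compat; auto; [|left; apply exp_pos|apply exp_le; auto].
      apply Rmult_le_pos; apply Cmod_ge_0.
    - assert (V * p * (V * p) <= V ^ 4 * (p * p) * E2)%R; [|lra].
      replace (V * p * (V * p))%R with (V * V * (p * p) * 1)%R by ring.
      apply Rmult_le_compat; nra. }
  assert (Hd' : (Cmod (d + drho * RtoC h) <= 2 * V * p)%R).
  { apply Rle_trans with (V * p + V * p * 1)%R; [|lra].
    apply Cmod_plus_le; auto; apply Cmod_mult_le; lra. }
  assert (Hr' : (Cmod ((rho + drho) * RtoC h) <= 2 * V * h)%R).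
  { apply Cmod_mult_le; [|lra].
    apply Rle_trans with (V + V * p)%R; [apply Cmod_plus_le; lra|nra]. }
  rewrite Rmult_comm with (r2 := Cmod (gauss x)).
  apply Cmod_mult_le; [lra|].
  (* V^4 from the squared exponents, and one more V from the displacement or the direction that they
     multiply. *)
  set (W := (V ^ 5)%R).
  assert (HW : (V ^ 3 <= W)%R).
  { unfold W; replace (V ^ 5)%R with (V * V * V ^ 3)%R by ring.
    assert (0 < V ^ 3)%R by (apply pow_lt; lra); nra. }
  assert (HW0 : (0 < W)%R) by (apply pow_lt; lra).
  apply Rle_trans with
    (2 * V * h * (V * p * (V * h + V * p))
     + 46 * V ^ 4 * (h * h) * E1 * (2 * V * p)
     + 46 * V ^ 4 * (p * p) * E2 * (2 * V * h))%R.
  { apply Cmod_minus_le; [apply Cmod_plus_le|].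
    - rewrite Cmod_opp; repeat apply Cmod_mult_le; try lra.
      apply Cmod_minus_le; auto; apply Cmod_mult_le; lra.
    - apply Cmod_mult_le; auto.
    - apply Cmod_mult_le; auto. }
  replace (2 * V * h * (V * p * (V * h + V * p))
     + 46 * V ^ 4 * (h * h) * E1 * (2 * V * p)
     + 46 * V ^ 4 * (p * p) * E2 * (2 * V * h))%R
    with (h * p * (2 * (h + p) * V ^ 3 + 92 * h * W * E1 + 92 * p * W * E2))%R
    by (unfold W; ring).
  assert (HEE : (E1 <= E1 * E2)%R) by nra.
  assert (HEE' : (E2 <= E1 * E2)%R) by nra.
  assert (HW5 : (W <= exp (5 * V))%R).
  { pose proof (exp_mul_nat_ge V 5) as H5; unfold W; cbn [INR] in H5.
    replace (1 + 1 + 1 + 1 + 1)%R with 5%R in H5 by ring; apply H5; lra. }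
  rewrite !exp_plus; fold E1 E2; set (EE := (E1 * E2)%R) in *.
  replace (120 * (h * p * (h + p)) * (exp (5 * V) * E1 * E2))%R
    with (h * p * (120 * (h + p) * (exp (5 * V) * EE)))%R by (unfold EE; ring).
  apply Rmult_le_compat_l; [nra|].
  assert (HWE : (W * EE <= exp (5 * V) * EE)%R) by (apply Rmult_le_compat_r; nra).
  assert (H1 : (V ^ 3 <= exp (5 * V) * EE)%R).
  { eapply Rle_trans; [|exact HWE]; nra. }
  assert (H2 : (W * E1 <= exp (5 * V) * EE)%R) by nra.
  assert (H3 : (W * E2 <= exp (5 * V) * EE)%R) by nra.
  set (Z := (exp (5 * V) * EE)%R) in *.
  assert (2 * (h + p) * V ^ 3 <= 2 * (h + p) * Z)%R by (apply Rmult_le_compat_l; lra).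
  assert (92 * h * W * E1 <= 92 * h * Z)%R
    by (rewrite Rmult_assoc; apply Rmult_le_compat_l; lra).
  assert (92 * p * W * E2 <= 92 * p * Z)%R
    by (rewrite Rmult_assoc; apply Rmult_le_compat_l; lra).
  assert (0 < Z)%R by (unfold Z; apply Rmult_lt_0_compat; [apply exp_pos|nra]).
  nra.
Qed.

(** Summed over all cells between two neighbouring lines, the transversal edges telescope: shifting
    [n] does not change the sum of [d n * gauss (x n)]. What remains is the difference of the two
    Riemann sums. *)
Lemma riemann_gauss_step (A kappa : R) : (1 <= A)%R -> (0 < kappa)%R ->
  exists D, (0 < D)%R /\ forall (h p : R) (w rho dw drho : C),
  (0 < h <= 1)%R -> (0 < p <= 1)%R -> (12 * (A * A) * p <= kappa)%R ->
  (Cmod w <= A)%R -> (Cmod rho <= A)%R -> (Cmod dw <= A * p)%R -> (Cmod drho <= A * p)%R ->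
  (kappa <= Re (rho * rho))%R -> (kappa <= Re ((rho + drho) * (rho + drho)))%R ->
  (Cmod (riemann_gauss h w rho - riemann_gauss h (w + dw) (rho + drho))
   <= D * (p * (h + p)))%R.
Proof.
  intros HA Hk.
  (* The exponent 5 V + 3 A V with V = A U is at most 8 A^2 U, and [Cmod_gauss_line] adds 2 A^2 U.
     The term 3 V^2 p costs half of the decay [kappa] by the condition on [p]. *)
  destruct (gauss_le_exp (10 * (A * A) + kappa / 2) (kappa / 2)) as (D & HD & HG); [lra|].
  exists (480 * D)%R; split; [lra|].
  intros h p w rho dw drho Hh Hp Hpk Hw Hr Hdw Hdr Hk1 Hk2.
  set (x := gline h w rho); set (d := gline h dw drho).
  assert (E : forall n, x (n + 1)%Z = x n + rho * RtoC h /\ d (n + 1)%Z = d n + drho * RtoC h).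
  { intros n; unfold x, d, gline; rewrite plus_IZR, Rmult_plus_distr_l, RtoC_plus, Rmult_1_r.
    split; ring. }
  destruct (hsum_gauss_line w rho kappa (conj Hk Hk1) h d (A * p) Hh) as [sa Ha].
  { intros n; unfold d, gline; rewrite Rmult_plus_distr_l, Rmult_1_r.
    apply Cmod_plus_le; auto; apply Cmod_mult_le; auto; rewrite Cmod_R; lra. }
  assert (Ha' : hsum anyZ (fun n => d (n + 1)%Z * gauss (x (n + 1)%Z)) sa).
  { apply (hsum_reindex anyZ anyZ (fun n => n + 1)%Z (fun n => n - 1)%Z
             (fun n => d n * gauss (x n))); auto; intros; lia. }
  assert (Hr2 : (0 < Re (rho * rho))%R) by lra.
  assert (Hr3 : (0 < Re ((rho + drho) * (rho + drho)))%R) by lra.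
  pose proof (hsum_riemann_gauss h w rho Hh Hr2) as H1.
  pose proof (hsum_riemann_gauss h (w + dw) (rho + drho) Hh Hr3) as H2.
  set (e := fun n => quad_error (x n) rho (d n) drho h).
  assert (He : hsum anyZ e (riemann_gauss h w rho - riemann_gauss h (w + dw) (rho + drho))).
  { apply hsum_value with (riemann_gauss h w rho - riemann_gauss h (w + dw) (rho + drho)
                           + (sa - sa)); [ring|].
    eapply hsum_ext; [|apply hsum_plus; [apply hsum_minus; [exact H1|exact H2]
                                        |apply hsum_minus; [exact Ha'|exact Ha]]].
    intros n _; cbn beta; unfold e, quad_error.
    destruct (E n) as [-> ->]; fold x.
    replace (gline h (w + dw) (rho + drho) n) with (x n + d n) by (unfold x, d, gline; ring).
    ring. }
  assert (Hb : forall n, (Cmod (e n)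
     <= 120 * (h * p * (h + p)) * D * exp (- (h * Rabs (IZR n))))%R).
  { intros n; set (u := (h * IZR n)%R).
    replace (h * Rabs (IZR n))%R with (Rabs u)
      by (unfold u; rewrite Rabs_mult, (Rabs_pos_eq h); lra).
    set (U := (1 + Rabs u)%R); pose proof (Rabs_pos u) as Hu.
    assert (Hru : Cmod (RtoC u) = Rabs u) by apply Cmod_R.
    eapply Rle_trans.
    { apply (quad_error_bound (x n) rho (d n) drho h p A (A * U)); auto.
      - unfold U; nra.
      - unfold x, gline; fold u; unfold U; rewrite Rmult_plus_distr_l, Rmult_1_r.
        apply Cmod_plus_le; auto; apply Cmod_mult_le; auto; lra.
      - unfold d, gline; fold u; unfold U.
        replace (A * (1 + Rabs u) * p)%R with (A * p + A * p * Rabs u)%R by ring.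
        apply Cmod_plus_le; auto; apply Cmod_mult_le; auto; lra.
      - eapply Rle_trans; [exact Hdr|]; apply Rmult_le_compat_r; [lra|unfold U; nra]. }
    assert (0 <= 120 * (h * p * (h + p)))%R.
    { repeat apply Rmult_le_pos; lra. }
    rewrite !(Rmult_assoc (120 * (h * p * (h + p)))); apply Rmult_le_compat_l; auto.
    eapply Rle_trans; [|apply HG, Hu].
    eapply Rle_trans.
    { apply Rmult_le_compat_l; [left; apply exp_pos|].
      apply (Cmod_gauss_line w rho A kappa u); auto. }
    rewrite <- exp_plus; apply exp_le; fold U.
    assert (HUU : (U * U <= 2 * (1 + Rabs u * Rabs u))%R) 
      by (pose proof (Rle_0_sqr (1 - Rabs u)) as Hs; unfold Rsqr in Hs; unfold U; lra).
    assert (HU1 : (1 <= U)%R) by (unfold U; lra).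
    assert (K1 : (3 * (A * U * (A * U) * p) <= kappa / 2 * (1 + Rabs u * Rabs u))%R).
    { replace (3 * (A * U * (A * U) * p))%R with (12 * (A * A) * p * (U * U / 4))%R by field.
      apply Rle_trans with (kappa * (U * U / 4))%R; [apply Rmult_le_compat_r; nra|].
      replace (kappa / 2 * (1 + Rabs u * Rabs u))%R
        with (kappa * (2 * (1 + Rabs u * Rabs u) / 4))%R by field.
      apply Rmult_le_compat_l; lra. }
    assert (K2 : (5 * (A * U) <= 5 * (A * A * U))%R).
    { assert (A * U <= A * A * U)%R; [|lra]; apply Rmult_le_compat_r; nra. }
    assert (K3 : (kappa / 2 <= kappa / 2 * U)%R) by nra.
    replace (A * (A * U))%R with (A * A * U)%R by ring.
    lra. }
  destruct (zsum_exp_decay e _ h Hh Hb) as [He1 He2].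
  rewrite (hsum_unique _ _ _ _ He He1).
  eapply Rle_trans; [exact He2|]; right; field; lra.
Qed.

(* A discrete form of Cauchy's theorem: the limit of the Riemann sums depends
   neither on the base point nor on the direction of the line. *)
Lemma riemann_gauss_indep (w rho : C) : (Rabs (Im rho) < Re rho)%R ->
  exists D, (0 < D)%R /\ forall h, (0 < h <= 1)%R ->
  (Cmod (riemann_gauss h w rho - riemann_gauss h 0 1) <= D * h)%R.
Proof.
  intros Hr.
  set (A := (2 + Cmod w + Cmod rho)%R).
  set (sg := Rmin 1 (Re rho - Rabs (Im rho))).
  pose proof (Cmod_ge_0 w) as Hw0; pose proof (Cmod_ge_0 rho) as Hr0.
  assert (Hsg : (0 < sg)%R) by (unfold sg; apply Rmin_glb_lt; lra).
  assert (Hsg1 : (sg <= 1)%R) by apply Rmin_l.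
  assert (Hsg2 : (sg <= Re rho - Rabs (Im rho))%R) by apply Rmin_r.
  assert (HA : (1 <= A)%R) by (unfold A; lra).
  destruct (riemann_gauss_step A (sg * sg) HA) as (D & HD & HS); [nra|].
  exists (2 * D)%R; split; [lra|]; intros h Hh.
  (* Steps of length [p] must meet the smallness condition of [riemann_gauss_step]; being also at
     most [h], the 1/p errors D p (h + p) add up to at most 2 D h. *)
  set (q := Rmin (sg * sg / (12 * (A * A))) h).
  assert (HAA : (0 < 12 * (A * A))%R) by nra.
  assert (Hq : (0 < q)%R).
  { apply Rmin_glb_lt; [apply Rdiv_lt_0_compat; nra|lra]. }
  destruct (archimed_cor1 q Hq) as (K & HK & HK0).
  set (p := (/ INR K)%R) in *.
  assert (HKp : (0 < INR K)%R) by (apply lt_0_INR; lia).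
  assert (Hp0 : (0 < p)%R) by (apply Rinv_0_lt_compat; auto).
  assert (Hph : (p <= h)%R) by (pose proof (Rmin_r (sg * sg / (12 * (A * A))) h); unfold q in HK; lra).
  assert (Hpk : (12 * (A * A) * p <= sg * sg)%R).
  { assert (p <= sg * sg / (12 * (A * A)))%R
      by (pose proof (Rmin_l (sg * sg / (12 * (A * A))) h); unfold q in HK; lra).
    apply Rmult_le_compat_l with (r := (12 * (A * A))%R) in H; [|lra].
    replace (12 * (A * A) * (sg * sg / (12 * (A * A))))%R with (sg * sg)%R in H
      by (field; nra); auto. }
  (* Base point and direction move along straight segments from [(0, 1)] to [(w, rho)]. *)
  set (W := fun i => RtoC (INR i * p) * w).
  set (S := fun i => 1 + RtoC (INR i * p) * (rho - 1)).
  assert (Hi : forall i, (i <= K)%nat -> (0 <= INR i * p <= 1)%R).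
  { intros i Hi; apply le_INR in Hi; split; [apply Rmult_le_pos; [apply pos_INR|lra]|].
    apply Rmult_le_compat_r with (r := p) in Hi; [|lra].
    unfold p in Hi at 2; rewrite Rinv_r in Hi; lra. }
  assert (HW : forall i, (i <= K)%nat -> (Cmod (W i) <= A)%R).
  { intros i H; apply Hi in H; unfold W; rewrite Cmod_mult, Cmod_R, Rabs_pos_eq by lra.
    assert (INR i * p * Cmod w <= 1 * Cmod w)%R by (apply Rmult_le_compat_r; lra).
    unfold A; lra. }
  assert (HSA : forall i, (i <= K)%nat -> (Cmod (S i) <= A)%R).
  { intros i H; apply Hi in H; unfold S.
    replace (1 + RtoC (INR i * p) * (rho - 1))
      with (RtoC (1 - INR i * p) + RtoC (INR i * p) * rho)
      by (rewrite RtoC_minus; ring).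
    apply Rle_trans with (1 + 1 * Cmod rho)%R; [|unfold A; lra].
    apply Cmod_plus_le; [rewrite Cmod_R, Rabs_pos_eq; lra|].
    apply Cmod_mult_le; [rewrite Cmod_R, Rabs_pos_eq|]; lra. }
  (* Re (S^2) = (Re S - Im S) (Re S + Im S), and both factors are convex combinations of 1 and a
     number at least [sg], with [sg <= 1]. *)
  assert (HSk : forall i, (i <= K)%nat -> (sg * sg <= Re (S i * S i))%R).
  { intros i H; apply Hi in H; unfold S; set (t := (INR i * p)%R) in *.
    destruct rho as [a b]; unfold Re, Im in Hsg2; cbn in Hsg2.
    assert (Hab : (sg <= a - b /\ sg <= a + b)%R).
    { pose proof (Rle_abs b); pose proof (Rle_abs (- b)) as Hb.
      rewrite Rabs_Ropp in Hb; lra. }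
    unfold RtoC; cbn.
    replace (_ - _)%R with ((1 - t + t * (a - b)) * (1 - t + t * (a + b)))%R by ring.
    apply Rmult_le_compat; nra. }
  assert (HSt : forall i, (i <= K)%nat ->
    (Cmod (riemann_gauss h (W i) (S i) - riemann_gauss h 0 1)
     <= INR i * (D * (p * (h + p))))%R).
  { induction i as [|i IH]; intros HiK.
    - replace (W 0%nat) with (RtoC 0) by (unfold W; cbn; rewrite Rmult_0_l; ring).
      replace (S 0%nat) with (RtoC 1) by (unfold S; cbn; rewrite Rmult_0_l; ring).
      replace (_ - _) with (RtoC 0) by ring; rewrite Cmod_0; cbn; lra.
    - specialize (IH ltac:(lia)).
      assert (EW : W (Datatypes.S i) = W i + RtoC p * w).
      { unfold W; rewrite S_INR, Rmult_plus_distr_r, RtoC_plus, Rmult_1_l; ring. }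
      assert (ES : S (Datatypes.S i) = S i + RtoC p * (rho - 1)).
      { unfold S; rewrite S_INR, Rmult_plus_distr_r, RtoC_plus, Rmult_1_l; ring. }
      assert (HT : (Cmod (riemann_gauss h (W i) (S i)
                      - riemann_gauss h (W i + RtoC p * w) (S i + RtoC p * (rho - 1)))
                <= D * (p * (h + p)))%R).
      { apply HS; auto; try lra.
        - apply HW; lia.
        - apply HSA; lia.
        - rewrite Rmult_comm; apply Cmod_mult_le; [rewrite Cmod_R, Rabs_pos_eq; lra|unfold A; lra].
        - rewrite Rmult_comm; apply Cmod_mult_le; [rewrite Cmod_R, Rabs_pos_eq; lra|].
          apply Rle_trans with (Cmod rho + 1)%R; [|unfold A; lra].
          apply Cmod_minus_le; [lra|rewrite Cmod_1; lra].
        - apply HSk; lia.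
        - rewrite <- ES; apply HSk; lia. }
      rewrite EW, ES, S_INR.
      set (t1 := riemann_gauss h (W i) (S i)) in *; set (t2 := riemann_gauss h (_ + _) _) in *.
      replace (t2 - riemann_gauss h 0 1) with (- (t1 - t2) + (t1 - riemann_gauss h 0 1)) by ring.
      eapply Rle_trans; [apply Cmod_triangle|rewrite Cmod_opp; lra]. }
  specialize (HSt K (Nat.le_refl K)).
  assert (Ep : (INR K * p)%R = 1%R) by (apply Rinv_r; lra).
  unfold W, S in HSt; rewrite Ep in HSt.
  replace (1 * w) with w in HSt by ring; replace (1 + 1 * (rho - 1)) with rho in HSt by ring.
  eapply Rle_trans; [exact HSt|].
  replace (INR K * (D * (p * (h + p))))%R with (INR K * p * (D * (h + p)))%R by ring.
  rewrite Ep; nra.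
Qed.

(** * Roots of unity *)

Lemma PI_neq_0 : RtoC PI <> 0.
Proof. intros H; apply (f_equal Re) in H; cbn in H; pose proof PI_RGT_0; lra. Qed.

Lemma NtoC_neq_0 (n : nat) : (0 < n)%nat -> NtoC n <> 0.
Proof.
  intros Hn H; apply (f_equal Re) in H; cbn in H; apply lt_0_INR in Hn; lra.
Qed.

Lemma NtoC_mult (a b : nat) : NtoC (a * b) = NtoC a * NtoC b.
Proof. unfold NtoC; now rewrite mult_INR, RtoC_mult. Qed.

Lemma cexp_geometric (a : C) (n : nat) :
  (cexp a - 1) * csum_nat n (fun j => cexp (a * NtoC j)) = cexp (a * NtoC n) - 1.
Proof.
  induction n as [|n IH].
  - unfold csum_nat, NtoC; cbn -[cexp]; replace (a * 0) with (RtoC 0) by ring.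
    rewrite cexp_0; ring.
  - rewrite csum_nat_S.
    replace (csum_nat n (fun j => cexp (a * NtoC (S j))))
      with (cexp a * csum_nat n (fun j => cexp (a * NtoC j))).
    + replace (cexp (a * NtoC (S n))) with (cexp a * cexp (a * NtoC n)).
      * replace (cexp (a * NtoC 0)) with (RtoC 1)
          by (rewrite <- cexp_0; f_equal; unfold NtoC; cbn; ring).
        transitivity (cexp a - 1 + cexp a
          * ((cexp a - 1) * csum_nat n (fun j => cexp (a * NtoC j)))); [ring|].
        rewrite IH; ring.
      * rewrite <- cexp_plus; f_equal; unfold NtoC; rewrite S_INR, RtoC_plus; ring.
    + rewrite <- csum_nat_scal; apply csum_nat_ext; intros j _.
      rewrite <- cexp_plus; f_equal; unfold NtoC; rewrite S_INR, RtoC_plus; ring.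
Qed.

Lemma cexp_i_eq_1 (x : R) : cexp (Ci * RtoC x) = 1 -> exists k : Z, x = (2 * PI * IZR k)%R.
Proof.
  intros H; apply (f_equal Re) in H; unfold cexp, Ci, RtoC in H; cbn in H.
  replace (0 * x - 1 * 0)%R with 0%R in H by ring.
  replace (0 * 0 + 1 * x)%R with x in H by ring.
  rewrite exp_0, Rmult_1_l in H.
  pose proof (one_minus_cos x) as H1; rewrite H in H1.
  assert (H2 : sin (x / 2) = 0%R) by nra.
  apply sin_eq_0_0 in H2; destruct H2 as [k Hk]; exists k; lra.
Qed.

Lemma sum_roots_of_unity (N : nat) (s : Z) : (0 < N)%nat ->
  csum_nat N (fun j => cexp (2 * RtoC PI * Ci * ZtoC s / NtoC N * NtoC j))
  = if Z.eq_dec (s mod Z.of_nat N) 0 then NtoC N else 0.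
Proof.
  intros HN; pose proof (NtoC_neq_0 N HN) as HN0.
  destruct (Z.eq_dec (s mod Z.of_nat N) 0) as [H|H].
  - apply Z.mod_divide in H; [|lia]; destruct H as [t ->].
    rewrite (csum_nat_ext _ _ (fun _ => 1)); [rewrite csum_nat_const; ring|].
    intros j _; rewrite <- (cexp_2piZ (t * Z.of_nat j)); f_equal.
    rewrite !ZtoC_mult, !ZtoC_nat; field; auto.
  - set (a := 2 * RtoC PI * Ci * ZtoC s / NtoC N).
    assert (Ha : cexp a <> 1).
    { intros E; apply H, Z.mod_divide; [lia|].
      assert (HNR : (INR N <> 0)%R) by (apply not_0_INR; lia).
      replace a with (Ci * RtoC (2 * PI * IZR s / INR N)) in E.
      - apply cexp_i_eq_1 in E; destruct E as [k Hk]; exists k.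
        pose proof PI_RGT_0; apply eq_IZR; rewrite mult_IZR, <- INR_IZR_INZ.
        apply Rmult_eq_reg_l with (2 * PI / INR N)%R.
        + transitivity (2 * PI * IZR s / INR N)%R; [field; auto|].
          rewrite Hk; field; auto.
        + unfold Rdiv; apply Rmult_integral_contrapositive_currified;
            [lra|apply Rinv_neq_0_compat; auto].
      - unfold a, NtoC, ZtoC; rewrite RtoC_div, !RtoC_mult by auto.
        unfold Cdiv; ring. }
    pose proof (cexp_geometric a N) as G.
    replace (a * NtoC N) with (2 * RtoC PI * Ci * ZtoC s) in G by (unfold a; field; auto).
    rewrite cexp_2piZ in G.
    assert (Ha' : cexp a - 1 <> 0).
    { intros E; apply Ha; replace (cexp a) with (cexp a - 1 + 1) by ring; rewrite E; ring. }
    set (S := csum_nat N _) in *.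
    transitivity ((cexp a - 1) * S / (cexp a - 1)); [field; auto|].
    rewrite G; field; auto.
Qed.

(** * A discrete Tannery theorem *)

(** Telescoping with 1 / (K+1)^2 <= 1/K - 1/(K+1), once for each of the two new indices. *)
Lemma lsum_zrange_tail (b : Z -> C) (B : R) (K0 K : nat) :
  (0 < K0 <= K)%nat ->
  (forall k, (0 < Z.abs k <= Z.of_nat K)%Z -> (Cmod (b k) <= B / (IZR k * IZR k))%R) ->
  (Cmod (lsum b (zrange K)) <= Cmod (lsum b (zrange K0)) + 2 * B * (/ INR K0 - / INR K))%R.
Proof.
  intros [H0 HK]; induction HK as [|K HK IH]; intros Hb; [lra|].
  specialize (IH ltac:(intros k Hk; apply Hb; lia)).
  rewrite zrange_S, lsum_cons, lsum_app.
  assert (Hk : (0 < INR K)%R) by (apply lt_0_INR; lia).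
  assert (Ht : forall k, (IZR k * IZR k = (INR K + 1) * (INR K + 1))%R ->
     (0 < Z.abs k <= Z.of_nat (S K))%Z -> (Cmod (b k) <= B * (/ INR K - / INR (S K)))%R).
  { intros k E Hk'; eapply Rle_trans; [apply Hb; auto|]; rewrite E, S_INR.
    assert (HB : (0 <= B)%R).
    { specialize (Hb k Hk'); rewrite E in Hb.
      pose proof (Cmod_ge_0 (b k)).
      apply Rmult_le_reg_r with (/ ((INR K + 1) * (INR K + 1)))%R.
      - apply Rinv_0_lt_compat; nra.
      - unfold Rdiv in Hb; lra. }
    apply Rmult_le_compat_l; auto.
    replace (/ INR K - / (INR K + 1))%R with (/ (INR K * (INR K + 1)))%R by (field; lra).
    apply Rinv_le_contravar; nra. }
  pose proof (Ht (- Z.of_nat (S K))%Z) as T1; pose proof (Ht (Z.of_nat (S K))) as T2.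
  rewrite opp_IZR, <- INR_IZR_INZ, S_INR in T1; rewrite <- INR_IZR_INZ, S_INR in T2.
  specialize (T1 ltac:(ring) ltac:(lia)); specialize (T2 ltac:(ring) ltac:(lia)).
  rewrite S_INR; set (l := lsum b (zrange K)) in *.
  replace (lsum b [Z.of_nat (S K)]) with (b (Z.of_nat (S K)))
    by (unfold lsum; cbn [map csum_list fold_right]; ring).
  eapply Rle_trans; [apply Cmod_triangle|].
  pose proof (Cmod_triangle l (b (Z.of_nat (S K)))); lra.
Qed.

(** The majorant is required only for [|k| <= K]: coefficients of a transform with [2 K + 1] points
    are periodic in [k], so they cannot decay over all of Z. *)
Lemma tannery_zrange (b : nat -> Z -> C) (B : R) (K1 : nat) :
  (forall K k, (K1 <= K)%nat -> (0 < Z.abs k <= Z.of_nat K)%Z ->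
     (Cmod (b K k) <= B / (IZR k * IZR k))%R) ->
  (forall k, is_lim_seq (fun K => Cmod (b K k)) 0) ->
  is_lim_seq (fun K => Cmod (lsum (b K) (zrange K))) 0.
Proof.
  intros Hb Hl; apply is_lim_seq_spec; intros eps.
  pose proof (cond_pos eps) as He.
  set (B' := (Rabs B + 1)%R); assert (HB' : (0 < B')%R) by (unfold B'; pose proof (Rabs_pos B); lra).
  destruct (archimed_cor1 (eps / (4 * B'))) as (K0 & HK0 & HK0').
  { apply Rdiv_lt_0_compat; lra. }
  assert (HK0p : (0 < INR K0)%R) by (apply lt_0_INR; auto).
  assert (Hlim : is_lim_seq (fun K => rsum (fun k => Cmod (b K k)) (zrange K0)) 0).
  { induction (zrange K0) as [|k l IH]; [apply is_lim_seq_const|].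
    replace (Finite 0) with (Finite (0 + 0)) by (f_equal; ring).
    apply is_lim_seq_plus'; auto. }
  apply is_lim_seq_spec in Hlim.
  assert (He2 : (0 < eps / 2)%R) by lra.
  destruct (Hlim (mkposreal _ He2)) as [K2 HK2]; cbn [pos] in HK2.
  exists (K0 + K1 + K2)%nat; intros K HK; rewrite Rminus_0_r, Rabs_pos_eq by apply Cmod_ge_0.
  eapply Rle_lt_trans.
  { apply (lsum_zrange_tail (b K) B' K0 K); [lia|].
    intros k Hk; eapply Rle_trans; [apply Hb; [lia|auto]|].
    apply Rmult_le_compat_r; [|unfold B'; pose proof (Rle_abs B); lra].
    left; apply Rinv_0_lt_compat; assert (IZR k <> 0)%R by (apply not_0_IZR; lia); nra. }
  specialize (HK2 K ltac:(lia)); rewrite Rminus_0_r in HK2.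
  pose proof (Rle_abs (rsum (fun k => Cmod (b K k)) (zrange K0))).
  pose proof (Cmod_lsum (b K) (zrange K0)).
  assert (0 < / INR K)%R by (apply Rinv_0_lt_compat, lt_0_INR; lia).
  assert (2 * B' * / INR K0 < eps / 2)%R.
  { apply Rmult_lt_compat_l with (r := (2 * B')%R) in HK0; [|lra].
    replace (2 * B' * (eps / (4 * B')))%R with (eps / 2)%R in HK0 by (field; lra); lra. }
  assert (0 < B' * / INR K)%R by nra.
  lra.
Qed.

(** * Jacobi's imaginary transformation *)

Lemma Carg_pos (w : C) : (0 < Re w)%R -> Carg w = atan (Im w / Re w).
Proof. intros H; unfold Carg; destruct (Rlt_dec 0 (Re w)); [reflexivity|contradiction]. Qed.

Lemma cexp_Clog (w : C) : (0 < Re w)%R -> cexp (Clog w) = w.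
Proof.
  intros Hw; unfold cexp, Clog; rewrite Carg_pos by auto.
  destruct w as [x y]; unfold Re, Im in *; cbn [fst snd] in *.
  assert (Hm : Cmod (x, y) = (x * sqrt (1 + (y / x)²))%R).
  { unfold Cmod; cbn [fst snd].
    replace (x ^ 2 + y ^ 2)%R with (x * x * (1 + (y / x)²))%R
      by (unfold Rsqr; field; lra).
    rewrite sqrt_mult_alt, sqrt_square; nra. }
  assert (Hs : (0 < sqrt (1 + (y / x)²))%R).
  { apply sqrt_lt_R0; pose proof (Rle_0_sqr (y / x)); lra. }
  rewrite exp_ln by (rewrite Hm; nra).
  rewrite cos_atan, sin_atan, Hm; f_equal; field; lra.
Qed.

(** The principal square root of -i tau. *)
Definition croot (tau : C) : C := cexp (Clog (- Ci * tau) / 2).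

(** The square root of i / (pi tau) for which [dual_gauss tau x] becomes [gauss (grho tau * x)]. *)
Definition grho (tau : C) : C := / (RtoC (sqrt PI) * croot tau).

Lemma Re_opp_Ci (tau : C) : Re (- Ci * tau) = Im tau.
Proof. destruct tau; cbn; ring. Qed.

Lemma tau_neq_0 (tau : C) : (0 < Im tau)%R -> tau <> 0.
Proof. intros H ->; cbn in H; lra. Qed.

Lemma croot_neq_0 (tau : C) : croot tau <> 0.
Proof. apply cexp_neq_0. Qed.

Lemma croot_sqr (tau : C) : (0 < Im tau)%R -> croot tau * croot tau = - Ci * tau.
Proof.
  intros H; unfold croot; rewrite <- cexp_plus.
  replace (_ + _) with (Clog (- Ci * tau)) by field.
  apply cexp_Clog; now rewrite Re_opp_Ci.
Qed.

Lemma sqrt_PI_neq_0 : RtoC (sqrt PI) <> 0.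
Proof.
  intros H; apply (f_equal Re) in H; cbn in H.
  pose proof (sqrt_lt_R0 PI PI_RGT_0); lra.
Qed.

Lemma sqrt_PI_sqr : RtoC (sqrt PI) * RtoC (sqrt PI) = RtoC PI.
Proof.
  rewrite <- RtoC_mult, sqrt_sqrt; [reflexivity|pose proof PI_RGT_0; lra].
Qed.

Lemma grho_neq_0 (tau : C) : grho tau <> 0.
Proof.
  unfold grho; intros H.
  assert (E : RtoC (sqrt PI) * croot tau <> 0)
    by (apply Cmult_neq_0; [apply sqrt_PI_neq_0|apply croot_neq_0]).
  pose proof (Cinv_r _ E) as E'; rewrite H in E'.
  apply (f_equal Re) in E'; rewrite Cmult_0_r in E'; cbn in E'; lra.
Qed.

Lemma Ci_inv : / Ci = - Ci.
Proof. unfold Cinv, Ci, Copp; cbn; f_equal; field. Qed.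

Lemma Ci_sqr : Ci * Ci = - 1.
Proof. unfold Cmult, Ci, Copp, RtoC; cbn; f_equal; ring. Qed.

Lemma grho_sqr (tau : C) : (0 < Im tau)%R ->
  grho tau * grho tau = Ci / (RtoC PI * tau).
Proof.
  intros H; unfold grho.
  transitivity (/ ((RtoC (sqrt PI) * RtoC (sqrt PI)) * (croot tau * croot tau))).
  - field; split; [apply croot_neq_0|apply sqrt_PI_neq_0].
  - rewrite sqrt_PI_sqr, croot_sqr by auto.
    pose proof (tau_neq_0 tau H); pose proof PI_neq_0; pose proof Ci_nz.
    transitivity (- / Ci / (RtoC PI * tau)); [field; auto|].
    rewrite Ci_inv; field; auto.
Qed.

(** The argument of -i tau lies strictly between -pi/2 and pi/2; the inverse square root halves it
    up to sign, and |arg| < pi/4 means |Im| < Re. *)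
Lemma grho_sector (tau : C) : (0 < Im tau)%R -> (Rabs (Im (grho tau)) < Re (grho tau))%R.
Proof.
  intros H.
  set (t := atan (Im (- Ci * tau) / Re (- Ci * tau))).
  set (r := (exp (- (ln (Cmod (- Ci * tau)) / 2)) / sqrt PI)%R).
  assert (Hs : (0 < sqrt PI)%R) by apply sqrt_lt_R0, PI_RGT_0.
  assert (E : grho tau = RtoC r * (cos (t / 2), - sin (t / 2))%R).
  { transitivity (/ RtoC (sqrt PI) * cexp (- (Clog (- Ci * tau) / 2))).
    - rewrite cexp_opp; unfold grho; fold (croot tau).
      field; split; [apply croot_neq_0|apply sqrt_PI_neq_0].
    - unfold Clog; rewrite Carg_pos by (rewrite Re_opp_Ci; auto); fold t.
      rewrite <- RtoC_inv by lra; unfold r.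
      set (L := ln (Cmod (- Ci * tau))).
      replace (- ((L, t) / 2)) with ((- (L / 2), - (t / 2))%R : C).
      + unfold cexp, Cmult, RtoC; cbn; rewrite cos_neg, sin_neg; unfold Rdiv; f_equal; ring.
      + unfold Cdiv, Cinv, Cmult, Copp, RtoC; cbn; f_equal; field. }
  pose proof (atan_bound (Im (- Ci * tau) / Re (- Ci * tau))) as Ht; fold t in Ht.
  assert (Hr : (0 < r)%R) by (apply Rdiv_lt_0_compat; [apply exp_pos|auto]).
  assert (Hc : (0 < cos (t / 2))%R) by (apply cos_gt_0; lra).
  assert (Hc2 : (0 < cos t)%R) by (apply cos_gt_0; lra).
  replace t with (2 * (t / 2))%R in Hc2 by field; rewrite cos_2a in Hc2.
  rewrite E; destruct (tau) as [a b].
  replace (Im (RtoC r * (cos (t / 2), - sin (t / 2))%R)) with (- (r * sin (t / 2)))%R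
    by (cbn; ring).
  replace (Re (RtoC r * (cos (t / 2), - sin (t / 2))%R)) with (r * cos (t / 2))%R
    by (cbn; ring).
  rewrite Rabs_Ropp, Rabs_mult, (Rabs_pos_eq r) by lra.
  apply Rmult_lt_compat_l; auto.
  apply Rabs_def1; nra.
Qed.

Lemma sector_Re_sqr (r : C) : (Rabs (Im r) < Re r)%R -> (0 < Re (r * r))%R.
Proof.
  destruct r as [a b]; unfold Re, Im; cbn; intros H.
  apply Rabs_def2 in H; nra.
Qed.

Definition dual_gauss (tau x : C) : C := cexp (- Ci * (x * x) / (RtoC PI * tau)).

Lemma dual_gauss_grho (tau x : C) : (0 < Im tau)%R -> dual_gauss tau x = gauss (grho tau * x).
Proof.
  intros H; unfold dual_gauss, gauss; f_equal.
  transitivity (- ((grho tau * grho tau) * (x * x))); [|ring].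
  rewrite grho_sqr by auto; field; split; [now apply tau_neq_0|apply PI_neq_0].
Qed.

Definition theta_term (z tau : C) (k : Z) : C :=
  qpow tau (ZtoC k * ZtoC k / 2) * cexp (2 * ZtoC k * Ci * z).

Lemma theta_term_cexp (z tau : C) (k : Z) :
  theta_term z tau k
  = cexp (Ci * (RtoC PI * tau * (ZtoC k * ZtoC k) + 2 * ZtoC k * z)).
Proof. unfold theta_term, qpow; rewrite <- cexp_plus; f_equal; field. Qed.

Lemma theta_term_bound (z tau : C) : (0 < Im tau)%R ->
  exists D, (0 < D)%R /\ forall k, (Cmod (theta_term z tau k) <= D * exp (- Rabs (IZR k)))%R.
Proof.
  intros H; pose proof PI_RGT_0 as HP.
  destruct (gauss_le_exp (2 * Rabs (Im z)) (PI * Im tau)) as (D & HD & HG); [nra|].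
  exists D; split; auto; intros k; eapply Rle_trans; [|apply HG, Rabs_pos].
  rewrite theta_term_cexp, Cmod_cexp; apply exp_le.
  replace (Re _) with (- (PI * Im tau * (IZR k * IZR k)) - 2 * (IZR k * Im z))%R.
  - rewrite <- Rabs_mult, (Rabs_pos_eq (IZR k * IZR k)) by nra.
    pose proof (Rle_abs (- (IZR k * Im z))) as H1; rewrite Rabs_Ropp, Rabs_mult in H1.
    pose proof (Rabs_pos (Im z)); lra.
  - unfold ZtoC; destruct z, tau; unfold RtoC, Ci; cbn; ring.
Qed.

Lemma theta3_hsum (z tau : C) : (0 < Im tau)%R ->
  hsum anyZ (theta_term z tau) (theta3 z tau).
Proof.
  intros H; destruct (theta_term_bound z tau H) as (D & HD & Hk).
  apply (zsum_exp_decay (theta_term z tau) D 1); [lra|].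
  intros n; rewrite Rmult_1_l; auto.
Qed.

Lemma dual_theta_summable (z tau : C) : (0 < Im tau)%R ->
  exists s, hsum anyZ (fun n => dual_gauss tau (z - RtoC PI * ZtoC n)) s.
Proof.
  intros H; set (r := grho tau * RtoC (- PI)).
  assert (Hr : (0 < Re (r * r))%R).
  { replace (r * r) with (RtoC (PI * PI) * (grho tau * grho tau))
      by (unfold r; rewrite RtoC_mult, RtoC_opp; ring).
    rewrite re_scal_l; apply Rmult_lt_0_compat; [pose proof PI_RGT_0; nra|].
    apply sector_Re_sqr, grho_sector, H. }
  destruct (hsum_gauss_line (grho tau * z) r _ (conj Hr (Rle_refl _)) 1 (fun _ => 1) 1)
    as [s Hs]; [lra| |].
  - intros n; rewrite Cmod_1; pose proof (Rabs_pos (1 * IZR n)); lra.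
  - exists s; eapply hsum_ext; [|exact Hs]; intros n _; cbn beta.
    rewrite dual_gauss_grho, Cmult_1_l by auto; f_equal.
    unfold gline, r, ZtoC; rewrite Rmult_1_l, RtoC_opp; ring.
Qed.

(** * Discrete Fourier transform of the periodized Gaussian *)

(** The [2 K + 1] sample points in a period pi match the frequencies -K, ..., K, a complete residue
    system modulo [2 K + 1]. *)
Definition mesh (K : nat) : R := (PI / INR (2 * K + 1))%R.

Lemma INR_odd_pos (K : nat) : (0 < INR (2 * K + 1))%R.
Proof. apply lt_0_INR; lia. Qed.

Lemma mesh_bounds (K : nat) : (2 <= K)%nat -> (0 < mesh K <= 1)%R.
Proof.
  intros HK; unfold mesh; pose proof (INR_odd_pos K); pose proof PI_4; pose proof PI_RGT_0.
  split; [apply Rdiv_lt_0_compat; lra|].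
  apply Rmult_le_reg_r with (INR (2 * K + 1)); auto.
  replace (PI / INR (2 * K + 1) * INR (2 * K + 1))%R with PI by (field; lra).
  assert (5 <= INR (2 * K + 1))%R by (replace 5%R with (INR 5) by (cbn; ring); apply le_INR; lia).
  lra.
Qed.

Lemma mesh_lim : is_lim_seq mesh 0.
Proof.
  apply is_lim_seq_le_le with (fun _ => 0%R) (fun K => PI * / INR (S K))%R.
  - intros K; pose proof (INR_odd_pos K); pose proof PI_RGT_0.
    assert (0 < INR (S K))%R by (apply lt_0_INR; lia); unfold mesh, Rdiv; split.
    + left; apply Rmult_lt_0_compat; [|apply Rinv_0_lt_compat]; auto.
    + apply Rmult_le_compat_l; [lra|]; apply Rinv_le_contravar; auto; apply le_INR; lia.
  - apply is_lim_seq_const.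
  - replace (Finite 0) with (Finite (PI * 0)) by (f_equal; ring).
    apply (is_lim_seq_mult' _ _ PI 0); [apply is_lim_seq_const|].
    apply (is_lim_seq_incr_1 (fun n => / INR n)%R).
    replace (Finite 0) with (Rbar_inv p_infty) by reflexivity.
    apply is_lim_seq_inv; [apply is_lim_seq_INR|discriminate].
Qed.

Lemma NtoC_mesh (K : nat) : NtoC (2 * K + 1) * RtoC (mesh K) = RtoC PI.
Proof.
  pose proof (INR_odd_pos K); unfold mesh, NtoC; rewrite <- RtoC_mult; f_equal; field; lra.
Qed.

(** Since the phase has period [2 K + 1] in [n], the sum of these terms over all integers [n] is the
    [k]-th transform coefficient of the periodization. *)
Definition dft_term (z tau : C) (K : nat) (k n : Z) : C :=
  / NtoC (2 * K + 1) * dual_gauss tau (z - RtoC (mesh K) * ZtoC n)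
  * cexp (2 * Ci * ZtoC k * (RtoC (mesh K) * ZtoC n)).

(** The closed form of that sum. Writing 1 / (2 K + 1) as [mesh K / PI] produces the weight
    [grho tau * mesh K] of a Riemann sum and leaves 1 / (pi grho). *)
Definition dft_coef (z tau : C) (K : nat) (k : Z) : C :=
  theta_term z tau k / (RtoC PI * grho tau)
  * riemann_gauss (mesh K) (grho tau * (z + RtoC PI * tau * ZtoC k)) (grho tau).

(* Completing the square turns the oscillating factor into a complex translation. *)
Lemma dual_gauss_modulate (z tau x : C) (k : Z) : (0 < Im tau)%R ->
  dual_gauss tau (z - x) * cexp (2 * Ci * ZtoC k * x)
  = theta_term z tau k * dual_gauss tau (z - x + RtoC PI * tau * ZtoC k).
Proof.
  intros H; rewrite theta_term_cexp; unfold dual_gauss; rewrite <- !cexp_plus; f_equal.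
  field; split; [now apply tau_neq_0|apply PI_neq_0].
Qed.

Lemma dft_coef_hsum (z tau : C) (K : nat) (k : Z) : (0 < Im tau)%R -> (2 <= K)%nat ->
  hsum anyZ (dft_term z tau K k) (dft_coef z tau K k).
Proof.
  intros H HK; pose proof (mesh_bounds K HK) as Hh.
  pose proof (sector_Re_sqr _ (grho_sector tau H)) as Hr.
  pose proof (hsum_riemann_gauss (mesh K) (grho tau * (z + RtoC PI * tau * ZtoC k))
                (grho tau) Hh Hr) as HR.
  apply (hsum_scal _ (theta_term z tau k / (RtoC PI * grho tau))) in HR.
  (* The samples run backwards, [z - mesh K * n], while [gline] runs forwards. *)
  apply (hsum_reindex anyZ anyZ Z.opp Z.opp) in HR; try (intros; exact Logic.I);
    try (intros; apply Z.opp_involutive).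
  eapply hsum_ext; [|exact HR]; intros n _; cbn beta; symmetry; unfold dft_term.
  rewrite <- Cmult_assoc, dual_gauss_modulate, dual_gauss_grho by auto.
  replace (gline (mesh K) (grho tau * (z + RtoC PI * tau * ZtoC k)) (grho tau) (- n))
    with (grho tau * (z - RtoC (mesh K) * ZtoC n + RtoC PI * tau * ZtoC k))
    by (unfold gline, ZtoC; rewrite opp_IZR, RtoC_mult, RtoC_opp; ring).
  rewrite <- NtoC_mesh with (K := K).
  assert (RtoC (mesh K) <> 0) by (intros E; apply (f_equal Re) in E; cbn in E; lra).
  field; repeat split; auto; [apply grho_neq_0|apply NtoC_neq_0; lia].
Qed.

(** By orthogonality the sum over all frequencies keeps only the samples with [2 K + 1] dividing
    [n], and these lie at [z - PI * m]. *)
Lemma dft_inversion (z tau s : C) (K : nat) : (0 < Im tau)%R -> (2 <= K)%nat ->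
  hsum anyZ (fun n => dual_gauss tau (z - RtoC PI * ZtoC n)) s ->
  lsum (dft_coef z tau K) (zrange K) = s.
Proof.
  intros H HK Hs; set (N := (2 * K + 1)%nat).
  assert (HN : (0 < N)%nat) by lia; pose proof (NtoC_neq_0 N HN) as HN0.
  set (kk := fun j => (Z.of_nat j - Z.of_nat K)%Z).
  replace (lsum (dft_coef z tau K) (zrange K))
    with (csum_nat N (fun j => dft_coef z tau K (kk j)))
    by (unfold zrange; rewrite lsum_map; reflexivity).
  assert (H1 : hsum anyZ (fun n => csum_nat N (fun j => dft_term z tau K (kk j) n))
                 (csum_nat N (fun j => dft_coef z tau K (kk j)))).
  { apply hsum_csum_nat; intros; apply dft_coef_hsum; auto. }
  set (div := fun n => (n mod Z.of_nat N = 0)%Z).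
  assert (Emesh : RtoC (mesh K) = RtoC PI / NtoC N).
  { rewrite <- (NtoC_mesh K); fold N; field; auto. }
  assert (H2 : hsum anyZ (fun n => if Z.eq_dec (n mod Z.of_nat N) 0
                 then dual_gauss tau (z - RtoC (mesh K) * ZtoC n) else 0)
                 (csum_nat N (fun j => dft_coef z tau K (kk j)))).
  { eapply hsum_ext; [|exact H1]; intros n _; cbn beta; unfold dft_term; fold N.
    set (g := dual_gauss tau (z - RtoC (mesh K) * ZtoC n)).
    (* The phase that moves the frequencies -K, ..., K to 0, ..., 2K; it is 1 on the indices that
       survive. *)
    set (c0 := cexp (- (2 * Ci * NtoC K * (RtoC (mesh K) * ZtoC n)))).
    transitivity (/ NtoC N * g * c0
      * csum_nat N (fun j => cexp (2 * RtoC PI * Ci * ZtoC n / NtoC N * NtoC j))).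
    - rewrite <- csum_nat_scal; apply csum_nat_ext; intros j _.
      rewrite <- (Cmult_assoc (/ NtoC N * g) c0); f_equal; unfold c0; rewrite <- cexp_plus; f_equal.
      unfold kk, Z.sub; rewrite ZtoC_plus, ZtoC_opp, !ZtoC_nat, Emesh.
      field; auto.
    - rewrite sum_roots_of_unity by auto.
      destruct (Z.eq_dec (n mod Z.of_nat N) 0) as [E|E]; [|ring].
      replace c0 with (RtoC 1); [field; auto|].
      apply Z.mod_divide in E; [|lia]; destruct E as [t ->]; symmetry.
      unfold c0; rewrite <- (cexp_2piZ (- (Z.of_nat K * t))); f_equal.
      rewrite ZtoC_opp, !ZtoC_mult, !ZtoC_nat, Emesh; field; auto. }
  apply (hsum_support _ div) in H2.
  2:{ intros n _ Hn; unfold div in Hn; destruct (Z.eq_dec (n mod Z.of_nat N) 0); tauto. }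
  apply (hsum_reindex anyZ _ (fun m => Z.of_nat N * m)%Z (fun n => n / Z.of_nat N)%Z) in H2.
  - eapply hsum_unique; [|exact Hs].
    eapply hsum_ext; [|exact H2]; intros m _; cbn beta.
    rewrite Z.mul_comm, Z.mod_mul by lia.
    destruct (Z.eq_dec 0 0) as [_|]; [|congruence]; f_equal.
    rewrite ZtoC_mult, ZtoC_nat, Emesh; field; auto.
  - intros m _; split; [exact Logic.I|]; unfold div; rewrite Z.mul_comm; apply Z.mod_mul; lia.
  - intros; exact Logic.I.
  - intros m _; rewrite Z.mul_comm; apply Z.div_mul; lia.
  - intros n [_ Hn]; unfold div in Hn; rewrite (Z.div_mod n (Z.of_nat N)) at 2; lia.
Qed.

(** * Quadratic decay of the coefficients *)

(** With exponents P and M for the two shifts, P + M = - 2 e^2: the terms linear in [e] cancel. The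
    constant is 92 = 2 * 45 + 2, from two Taylor remainders and this term. *)
Lemma gauss_second_difference (x e : C) (A U h : R) :
  (1 <= A)%R -> (1 <= U)%R -> (0 < h <= 1)%R -> (Cmod x <= A * U)%R -> (Cmod e <= A * h)%R ->
  (Cmod (gauss (x + e) + gauss (x - e) - 2 * gauss x)
   <= 92 * A ^ 4 * (h * h) * exp ((2 + 3 * (A * A)) * U) * Cmod (gauss x))%R.
Proof.
  intros HA HU Hh Hx He.
  set (P := - (2 * x * e) - e * e); set (M := 2 * x * e - e * e).
  replace (gauss (x + e) + gauss (x - e) - 2 * gauss x)
    with (((cexp P - 1 - P) + (cexp M - 1 - M) - 2 * (e * e)) * gauss x).
  2:{ replace (gauss (x - e)) with (gauss x * cexp M)
        by (unfold gauss, M; rewrite <- cexp_plus; f_equal; ring).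
      rewrite gauss_plus; fold P; generalize (cexp P) (cexp M); intros c1 c2.
      unfold P, M; ring. }
  apply Cmod_mult_le; [|lra].
  assert (C2 : Cmod 2 = 2%R) by (rewrite Cmod_R; apply Rabs_pos_eq; lra).
  set (Q := (3 * (A * A) * U)%R).
  assert (HAA : (1 <= A * A)%R) by nra.
  assert (HQ : (0 <= Q)%R) by (unfold Q; nra).
  assert (Hee : (Cmod (e * e) <= A * A * (h * h))%R).
  { replace (A * A * (h * h))%R with (A * h * (A * h))%R by ring; apply Cmod_mult_le; auto. }
  assert (Hb : (2 * (A * U) * (A * h) + A * A * (h * h) <= Q * h)%R).
  { unfold Q.
    assert (A * A * (h * h) <= A * A * (U * h))%R by (apply Rmult_le_compat_l; nra).
    lra. }
  assert (Hxe : (Cmod (2 * x * e) <= 2 * (A * U) * (A * h))%R)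
    by (repeat apply Cmod_mult_le; lra).
  assert (T : forall X, (Cmod X <= Q * h)%R ->
     (Cmod (cexp X - 1 - X) <= 5 * (9 * A ^ 4 * (h * h) * exp (2 * U) * exp Q))%R).
  { intros X HX; eapply Rle_trans; [apply cexp_taylor1_le|].
    apply Rmult_le_compat_l; [lra|]; apply Rmult_le_compat.
    - apply Rmult_le_pos; apply Cmod_ge_0.
    - left; apply exp_pos.
    - apply Rle_trans with (Q * h * (Q * h))%R.
      + apply Rmult_le_compat; auto; apply Cmod_ge_0.
      + replace (Q * h * (Q * h))%R with (9 * A ^ 4 * (h * h) * U ^ 2)%R by (unfold Q; ring).
        apply Rmult_le_compat_l.
        * apply Rmult_le_pos; [assert (0 < A ^ 4)%R by (apply pow_lt; lra); lra|nra].
        * pose proof (exp_mul_nat_ge U 2 HU) as E; cbn [INR] in E.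
          replace (1 + 1)%R with 2%R in E by ring; exact E.
    - apply exp_le; nra. }
  assert (TP := T P ltac:(eapply Rle_trans; [apply Cmod_minus_le; [rewrite Cmod_opp; exact Hxe|exact Hee]|exact Hb])).
  assert (TM := T M ltac:(eapply Rle_trans; [apply Cmod_minus_le; [exact Hxe|exact Hee]|exact Hb])).
  assert (EE : (exp (2 * U) * exp Q = exp ((2 + 3 * (A * A)) * U))%R)
    by (rewrite <- exp_plus; f_equal; unfold Q; ring).
  rewrite (Rmult_assoc _ (exp (2 * U)) (exp Q)), EE in TP, TM.
  set (Ex := exp ((2 + 3 * (A * A)) * U)) in *.
  assert (HEx : (1 <= Ex)%R) by (unfold Ex; rewrite <- exp_0; apply exp_le; nra).
  eapply Rle_trans.
  { apply Cmod_minus_le; [apply Cmod_plus_le; [exact TP|exact TM]|].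
    apply Cmod_mult_le; [right; exact C2|exact Hee]. }
  assert (A * A * (h * h) <= A ^ 4 * (h * h) * Ex)%R; [|lra].
  replace (A ^ 4)%R with (A * A * (A * A))%R by ring.
  replace (A * A * (h * h))%R with (A * A * (h * h) * 1)%R at 1 by ring.
  apply Rmult_le_compat; try nra; apply Rmult_le_compat; nra.
Qed.

(** From sin x >= x - x^3 / 6 and x^2 <= 4. *)
Lemma sin_ge_third (x : R) : (0 <= x <= 2)%R -> (x / 3 <= sin x)%R.
Proof.
  intros Hx; destruct (pre_sin_bound x 0) as [H _]; [lra|lra|].
  eapply Rle_trans; [|exact H].
  unfold sin_approx, sin_term; cbn -[pow]; unfold pow; nra.
Qed.

(** Shifting [n] by one in either direction multiplies the coefficient by a phase, so - 4 sin^2 (k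
    h) times the coefficient is the transform of a second difference, of order h^2. As |sin (k h)|
    >= |k| h / 3, the factor h^2 cancels. *)
Lemma dft_coef_bound (z tau : C) : (0 < Im tau)%R ->
  exists B, forall K k, (2 <= K)%nat -> (0 < Z.abs k <= Z.of_nat K)%Z ->
  (Cmod (dft_coef z tau K k) <= B / (IZR k * IZR k))%R.
Proof.
  intros H; set (rho := grho tau).
  set (kappa := Re (rho * rho)).
  assert (Hk : (0 < kappa)%R) by apply sector_Re_sqr, grho_sector, H.
  set (A := (1 + Cmod (rho * z) + Cmod rho)%R).
  pose proof (Cmod_ge_0 (rho * z)) as Hz0; pose proof (Cmod_ge_0 rho) as Hr0.
  assert (HA : (1 <= A)%R) by (unfold A; lra).
  (* 2 + 3 A^2 comes from [gauss_second_difference], 2 A^2 from [Cmod_gauss_line]. *)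
  destruct (gauss_le_exp (2 + 3 * (A * A) + 2 * (A * A)) kappa Hk) as (D & HD & HG).
  set (C0 := (92 * A ^ 4 * D)%R).
  assert (HA4 : (0 < A ^ 4)%R) by (apply pow_lt; lra).
  (* The final comparison is (4/9) k^2 h^2 |d| <= 4 C0 h^2 / ((2 K + 1) h), where (2 K + 1) h =
     pi. *)
  exists (9 * C0 / PI)%R; intros K k HK Hkk.
  pose proof (mesh_bounds K HK) as Hh; set (h := mesh K) in *.
  set (t := dft_term z tau K k).
  pose proof (dft_coef_hsum z tau K k H HK) as Hd; fold t in Hd.
  set (d := dft_coef z tau K k) in *.
  set (om := cexp (2 * Ci * ZtoC k * RtoC h)); set (om' := cexp (- (2 * Ci * ZtoC k * RtoC h))).
  set (N := NtoC (2 * K + 1)).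
  set (x := gline h (rho * z) (- rho)).
  set (ph := fun n => cexp (2 * Ci * ZtoC k * (RtoC h * ZtoC n))).
  set (e := fun n => / N * ph n
     * (gauss (x n + rho * RtoC h) + gauss (x n - rho * RtoC h) - 2 * gauss (x n))).
  assert (Et : forall n, t n = / N * gauss (x n) * ph n).
  { intros n; unfold t, dft_term; fold N h; rewrite dual_gauss_grho by auto; fold rho.
    replace (x n) with (rho * (z - RtoC h * ZtoC n)); [reflexivity|].
    unfold x, gline, ZtoC; rewrite RtoC_mult; ring. }
  assert (He : hsum anyZ e ((om + om' - 2) * d)).
  { assert (H1 : hsum anyZ (fun n => om * t (n - 1)%Z) (om * d)).
    { apply hsum_scal, (hsum_reindex anyZ anyZ (fun n => n - 1)%Z (fun n => n + 1)%Z t); auto;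
        intros; lia. }
    assert (H2 : hsum anyZ (fun n => om' * t (n + 1)%Z) (om' * d)).
    { apply hsum_scal, (hsum_reindex anyZ anyZ (fun n => n + 1)%Z (fun n => n - 1)%Z t); auto;
        intros; lia. }
    apply hsum_value with (om * d + om' * d - 2 * d); [ring|].
    eapply hsum_ext; [|apply hsum_minus; [apply hsum_plus; [exact H1|exact H2]
                                         |apply (hsum_scal _ 2), Hd]].
    intros n _; cbn beta; rewrite !Et; unfold e.
    replace (x (n - 1)%Z) with (x n + rho * RtoC h)
      by (unfold x, gline; rewrite minus_IZR, !RtoC_mult, RtoC_minus; ring).
    replace (x (n + 1)%Z) with (x n - rho * RtoC h)
      by (unfold x, gline; rewrite plus_IZR, !RtoC_mult, RtoC_plus; ring).
    assert (P1 : om * ph (n - 1)%Z = ph n).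
    { unfold om, ph; rewrite <- cexp_plus; f_equal; unfold ZtoC.
      rewrite minus_IZR, RtoC_minus; ring. }
    assert (P2 : om' * ph (n + 1)%Z = ph n).
    { unfold om', ph; rewrite <- cexp_plus; f_equal; unfold ZtoC.
      rewrite plus_IZR, RtoC_plus; ring. }
    transitivity (/ N * gauss (x n + rho * RtoC h) * (om * ph (n - 1)%Z)
      + / N * gauss (x n - rho * RtoC h) * (om' * ph (n + 1)%Z)
      - 2 * (/ N * gauss (x n) * ph n)); [ring|].
    rewrite P1, P2; ring. }
  pose proof (INR_odd_pos K) as HNp; set (NR := INR (2 * K + 1)) in *.
  assert (HNi : Cmod (/ N) = (/ NR)%R).
  { unfold N, NtoC; fold NR; rewrite <- RtoC_inv by lra; rewrite Cmod_R, Rabs_pos_eq; auto.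
    left; apply Rinv_0_lt_compat; auto. }
  assert (Hb : forall n, (Cmod (e n) <= / NR * C0 * (h * h) * exp (- (h * Rabs (IZR n))))%R).
  { intros n; set (u := (h * IZR n)%R).
    replace (h * Rabs (IZR n))%R with (Rabs u)
      by (unfold u; rewrite Rabs_mult, (Rabs_pos_eq h); lra).
    pose proof (Rabs_pos u) as Hu.
    assert (Hph : Cmod (ph n) = 1%R).
    { unfold ph; rewrite Cmod_cexp, <- exp_0; f_equal; unfold ZtoC, RtoC, Ci; cbn; ring. }
    assert (Hru : Cmod (RtoC u) = Rabs u) by apply Cmod_R.
    replace (/ NR * C0 * (h * h) * exp (- Rabs u))%R
      with (/ NR * 1 * (92 * A ^ 4 * (h * h) * (D * exp (- Rabs u))))%R by (unfold C0; ring).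
    unfold e; apply Cmod_mult_le; [apply Cmod_mult_le; lra|].
    eapply Rle_trans.
    { apply (gauss_second_difference _ _ A (1 + Rabs u) h); auto; [lra| |].
      - unfold x, gline; fold u; rewrite Rmult_plus_distr_l, Rmult_1_r.
        apply Cmod_plus_le; [unfold A; lra|].
        apply Cmod_mult_le; [rewrite Cmod_opp; unfold A; lra|lra].
      - apply Cmod_mult_le; [unfold A; lra|rewrite Cmod_R, Rabs_pos_eq; lra]. }
    rewrite (Rmult_assoc (92 * A ^ 4 * (h * h))).
    apply Rmult_le_compat_l; [apply Rmult_le_pos; nra|].
    eapply Rle_trans; [|apply HG, Hu].
    eapply Rle_trans.
    { apply Rmult_le_compat_l; [left; apply exp_pos|].
      apply (Cmod_gauss_line (rho * z) (- rho) A kappa u); auto; unfold A; try lra.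
      - rewrite Cmod_opp; lra.
      - right; unfold kappa; f_equal; ring. }
    rewrite <- exp_plus; apply exp_le; right; ring. }
  destruct (zsum_exp_decay e _ h Hh Hb) as [He1 He2].
  rewrite <- (hsum_unique _ _ _ _ He He1), Cmod_mult in He2.
  set (y := (IZR k * h)%R).
  assert (Eom : om + om' - 2 = RtoC (- (4 * (sin y * sin y)))).
  { assert (E1 : 2 * Ci * ZtoC k * RtoC h = ((0, 2 * y)%R : C)).
    { unfold y, ZtoC, RtoC, Ci, Cmult; cbn; f_equal; ring. }
    unfold om, om'; rewrite E1.
    unfold cexp, Cminus, Copp, Cplus, RtoC; cbn.
    rewrite Ropp_0, exp_0, cos_neg, sin_neg, cos_2a_sin; f_equal; ring. }
  assert (HNR : (NR * h = PI)%R) by (unfold h, mesh; fold NR; field; lra).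
  (* Here [|k| <= K] enters: |k| h <= pi K / (2 K + 1) stays below pi/2, away from the next zero of
     the sine. *)
  assert (Hy : (Rabs y <= 2)%R).
  { unfold y; rewrite Rabs_mult, (Rabs_pos_eq h) by lra; rewrite <- abs_IZR.
    assert (Hk2 : (2 * IZR (Z.abs k) <= NR)%R).
    { unfold NR; rewrite INR_IZR_INZ, <- mult_IZR; apply IZR_le; lia. }
    pose proof PI_4; nra. }
  assert (Hsin : (Rabs y / 3 <= Rabs (sin y))%R).
  { destruct (Rle_dec 0 y) as [Hy0|Hy0].
    - rewrite (Rabs_pos_eq y) in * by auto.
      eapply Rle_trans; [apply sin_ge_third; lra|apply Rle_abs].
    - rewrite (Rabs_left y) in * by lra; rewrite <- (Rabs_Ropp (sin y)), <- sin_neg.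
      eapply Rle_trans; [apply sin_ge_third; lra|apply Rle_abs]. }
  rewrite Eom, Cmod_R, Rabs_Ropp, Rabs_mult, Rabs_mult, (Rabs_pos_eq 4) in He2 by lra.
  assert (Hsq : (y * y / 9 <= Rabs (sin y) * Rabs (sin y))%R).
  { replace (y * y / 9)%R with (Rabs y / 3 * (Rabs y / 3))%R
      by (replace (y * y)%R with (Rabs y * Rabs y)%R
            by (rewrite <- Rabs_mult; apply Rabs_pos_eq; nra); field).
    pose proof (Rabs_pos y); apply Rmult_le_compat; lra. }
  assert (Hk0 : (IZR k <> 0)%R) by (apply not_0_IZR; lia).
  assert (HkK : (0 < IZR k * IZR k)%R) by nra.
  pose proof (Cmod_ge_0 d) as Hd0; pose proof PI_RGT_0 as HP.
  assert (HF : (4 * (IZR k * IZR k * (h * h) / 9) * Cmod d <= 4 * (/ NR * C0 * (h * h)) / h)%R).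
  { eapply Rle_trans; [|exact He2]; apply Rmult_le_compat_r; auto.
    apply Rmult_le_compat_l; [lra|].
    replace (IZR k * IZR k * (h * h))%R with (y * y)%R by (unfold y; ring); auto. }
  apply Rmult_le_reg_l with (4 * (IZR k * IZR k * (h * h) / 9))%R.
  { assert (0 < IZR k * IZR k * (h * h))%R by (apply Rmult_lt_0_compat; nra); lra. }
  eapply Rle_trans; [exact HF|].
  replace (4 * (/ NR * C0 * (h * h)) / h)%R with (4 * C0 * (h * h) / (NR * h))%R
    by (field; lra).
  rewrite HNR; right; field; split; lra.
Qed.

(** * Passage to the limit and determination of the constant *)

Definition gauss_mean (K : nat) : C := riemann_gauss (mesh K) 0 1.

Lemma gauss_mean_bounded : exists B, forall K, (2 <= K)%nat -> (Cmod (gauss_mean K) <= B)%R.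
Proof.
  destruct (gauss_le_exp (2 * (1 * 1)) 1) as (D & HD & HG); [lra|].
  exists (4 * D)%R; intros K HK; pose proof (mesh_bounds K HK) as Hh.
  unfold gauss_mean, riemann_gauss; set (h := mesh K) in *.
  replace (4 * D)%R with (4 * (D * h) / h)%R by (field; lra).
  apply (zsum_exp_decay _ (D * h) h Hh); intros n.
  rewrite (Rmult_comm D h), Rmult_assoc; apply Cmod_mult_le.
  - rewrite Cmult_1_l, Cmod_R, Rabs_pos_eq; lra.
  - replace (h * Rabs (IZR n))%R with (Rabs (h * IZR n))
      by (rewrite Rabs_mult, (Rabs_pos_eq h); lra).
    eapply Rle_trans; [|apply HG, Rabs_pos].
    apply (Cmod_gauss_line 0 1 1 1); rewrite ?Cmod_0, ?Cmod_1; try lra.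
    cbn; lra.
Qed.

(** Square exp (x/2) >= x/2. Brings the theta terms under the majorant of [tannery_zrange]. *)
Lemma inv_sqr_ge_exp (k : Z) : (k <> 0)%Z ->
  (exp (- Rabs (IZR k)) <= 4 / (IZR k * IZR k))%R.
Proof.
  intros Hk; set (x := Rabs (IZR k)).
  assert (Hk0 : (IZR k <> 0)%R) by (apply not_0_IZR; auto).
  replace (IZR k * IZR k)%R with (x * x)%R
    by (unfold x; rewrite <- Rabs_mult; apply Rabs_pos_eq; nra).
  assert (Hx : (0 < x)%R) by (apply Rabs_pos_lt; auto).
  pose proof (exp_ineq1_le (x / 2)) as H1; pose proof (exp_pos (- x)) as H2.
  assert (H3 : (exp (x / 2) * exp (x / 2) * exp (- x) = 1)%R).
  { rewrite <- !exp_plus, <- exp_0; f_equal; field. }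
  apply Rmult_le_reg_r with (x * x)%R; [nra|].
  replace (4 / (x * x) * (x * x))%R with 4%R by (field; lra).
  assert (x / 2 * (x / 2) <= exp (x / 2) * exp (x / 2))%R by (apply Rmult_le_compat; lra).
  nra.
Qed.

(** Every line gives the same limit, so each coefficient approaches [gauss_mean K / (PI * grho tau)]
    times the theta term. The factor keeps its dependence on [K], because at this point [gauss_mean]
    is known to be bounded but not to converge. *)
Lemma jacobi_limit (z tau s : C) : (0 < Im tau)%R ->
  hsum anyZ (fun n => dual_gauss tau (z - RtoC PI * ZtoC n)) s ->
  is_lim_seq (fun K => Cmod (s - gauss_mean K / (RtoC PI * grho tau) * theta3 z tau)) 0.
Proof.
  intros H Hs; set (lam := fun K => gauss_mean K / (RtoC PI * grho tau)).
  assert (Hc0 : RtoC PI * grho tau <> 0)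
    by (apply Cmult_neq_0; [apply PI_neq_0|apply grho_neq_0]).
  destruct gauss_mean_bounded as [B0 HB0].
  set (L := (B0 / Cmod (RtoC PI * grho tau))%R).
  assert (Hlam : forall K, (2 <= K)%nat -> (Cmod (lam K) <= L)%R).
  { intros K HK; unfold lam, L; rewrite Cmod_div by auto.
    apply Rmult_le_compat_r; [left; apply Rinv_0_lt_compat, Cmod_gt_0; auto|auto]. }
  (* For [K < 2] the mesh exceeds 1 and the lemmas on Riemann sums do not apply. *)
  set (b := fun K k => if le_dec 2 K then dft_coef z tau K k - lam K * theta_term z tau k else 0).
  destruct (dft_coef_bound z tau H) as [B1 HB1].
  destruct (theta_term_bound z tau H) as (D & HD & Hth).
  assert (Hb : is_lim_seq (fun K => Cmod (lsum (b K) (zrange K))) 0).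
  { apply (tannery_zrange b (B1 + L * (D * 4)) 2).
    - intros K k HK Hk; unfold b; destruct (le_dec 2 K); [|lia].
      unfold Rdiv; rewrite Rmult_plus_distr_r; apply Cmod_minus_le; [apply HB1; auto|].
      rewrite Rmult_assoc; apply Cmod_mult_le; auto.
      eapply Rle_trans; [apply Hth|]; rewrite Rmult_assoc; apply Rmult_le_compat_l; [lra|].
      apply inv_sqr_ge_exp; lia.
    - intros k.
      destruct (riemann_gauss_indep (grho tau * (z + RtoC PI * tau * ZtoC k)) (grho tau)
                  (grho_sector tau H)) as (E & HE & HR).
      set (q := theta_term z tau k / (RtoC PI * grho tau)).
      apply is_lim_seq_le_le_loc with (fun _ => 0%R) (fun K => Cmod q * E * mesh K)%R.
      + exists 2%nat; intros K HK; split; [apply Cmod_ge_0|].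
        unfold b; destruct (le_dec 2 K); [|lia].
        replace (dft_coef z tau K k - lam K * theta_term z tau k)
          with (q * (riemann_gauss (mesh K) (grho tau * (z + RtoC PI * tau * ZtoC k)) (grho tau)
                     - gauss_mean K))
          by (unfold dft_coef, q, lam; field; split; [apply grho_neq_0|apply PI_neq_0]).
        rewrite Rmult_assoc; apply Cmod_mult_le; [lra|].
        apply HR, mesh_bounds; auto.
      + apply is_lim_seq_const.
      + replace (Finite 0) with (Finite (Cmod q * E * 0)) by (f_equal; ring).
        apply is_lim_seq_mult'; [apply is_lim_seq_const|apply mesh_lim]. }
  assert (Ht : is_lim_seq (fun K => Cmod (lsum (theta_term z tau) (zrange K) - theta3 z tau)) 0).
  { apply (hsum_exhaust anyZ _ _ zrange (theta3_hsum z tau H)).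
    - apply NoDup_zrange.
    - intros; exact Logic.I.
    - intros N x; rewrite !In_zrange; lia.
    - intros x _; exists (Z.to_nat (Z.abs x)); apply In_zrange; lia. }
  apply is_lim_seq_le_le_loc with (fun _ => 0%R)
    (fun K => Cmod (lsum (b K) (zrange K))
              + L * Cmod (lsum (theta_term z tau) (zrange K) - theta3 z tau))%R.
  - exists 2%nat; intros K HK; split; [apply Cmod_ge_0|]; fold (lam K).
    assert (E : lsum (b K) (zrange K) = s - lam K * lsum (theta_term z tau) (zrange K)).
    { rewrite <- (dft_inversion z tau s K) by auto; rewrite <- lsum_scal.
      transitivity (lsum (fun k => dft_coef z tau K k + (-1) * (lam K * theta_term z tau k))
                      (zrange K)).
      - apply lsum_ext; intros k _; unfold b; destruct (le_dec 2 K); [ring|lia].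
      - rewrite lsum_plus, (lsum_scal (-1)); ring. }
    rewrite E.
    replace (s - lam K * theta3 z tau)
      with ((s - lam K * lsum (theta_term z tau) (zrange K))
            + lam K * (lsum (theta_term z tau) (zrange K) - theta3 z tau)) by ring.
    eapply Rle_trans; [apply Cmod_triangle|].
    apply Rplus_le_compat_l; apply Cmod_mult_le; auto; lra.
  - apply is_lim_seq_const.
  - replace (Finite 0) with (Finite (0 + L * 0)) by (f_equal; ring).
    apply is_lim_seq_plus'; auto.
    apply is_lim_seq_mult'; auto; apply is_lim_seq_const.
Qed.

(** The terms exp (- pi k^2) are positive, and the one at k = 0 is 1. *)
Lemma theta3_i_neq_0 : theta3 0 Ci <> 0.
Proof.
  intros E.
  assert (Hi : (0 < Im Ci)%R) by (cbn; lra).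
  destruct (theta3_hsum 0 Ci Hi) as [_ H]; rewrite E in H.
  destruct (H 1%R) as (L0 & N0 & _ & HL); [lra|].
  destruct (NoDup_union anyZ L0 [0%Z]) as (L & NL & I1 & I2 & PL);
    try (intros; exact Logic.I).
  specialize (HL L NL I1 PL).
  set (g := fun k => exp (- (PI * (IZR k * IZR k)))).
  assert (EL : forall l, lsum (theta_term 0 Ci) l = RtoC (rsum g l)).
  { induction l as [|k l IH]; [reflexivity|].
    rewrite lsum_cons, IH; unfold rsum; cbn [map fold_right]; rewrite RtoC_plus; f_equal.
    rewrite theta_term_cexp; unfold g; rewrite <- cexp_R; f_equal.
    unfold ZtoC; rewrite RtoC_opp, !RtoC_mult.
    transitivity (Ci * Ci * (RtoC PI * (RtoC (IZR k) * RtoC (IZR k)))); [ring|].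
    rewrite Ci_sqr; ring. }
  assert (H1 : (1 <= rsum g L)%R).
  { apply Rle_trans with (rsum g [0%Z]).
    - unfold rsum, g; cbn [map fold_right].
      rewrite !Rmult_0_r, Ropp_0, exp_0; lra.
    - apply rsum_incl; auto; [intros; left; apply exp_pos|repeat constructor; auto]. }
  rewrite EL in HL; replace (RtoC (rsum g L) - 0) with (RtoC (rsum g L)) in HL by ring.
  rewrite Cmod_R, Rabs_pos_eq in HL; lra.
Qed.

Lemma croot_i : croot Ci = 1.
Proof.
  unfold croot; replace (Clog (- Ci * Ci) / 2) with (RtoC 0); [apply cexp_0|].
  replace (- Ci * Ci) with (RtoC 1) by (transitivity (- (Ci * Ci)); [rewrite Ci_sqr|]; ring).
  unfold Clog; rewrite Cmod_1, ln_1, Carg_pos by (cbn; lra); cbn.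
  replace (0 / 1)%R with 0%R by field; rewrite atan_0.
  fold (RtoC 0); field.
Qed.

(* At [tau = i] and [z = 0] the two sides of the transformation formula are the
   same series, which determines the value of the Gaussian integral. *)
Lemma gauss_mean_lim : is_lim_seq (fun K => Cmod (gauss_mean K - RtoC (sqrt PI))) 0.
Proof.
  assert (Hi : (0 < Im Ci)%R) by (cbn; lra).
  assert (Hs : hsum anyZ (fun n => dual_gauss Ci (0 - RtoC PI * ZtoC n)) (theta3 0 Ci)).
  { eapply hsum_ext; [|apply (theta3_hsum 0 Ci Hi)]; intros k _; cbn beta.
    rewrite theta_term_cexp; unfold dual_gauss; f_equal.
    transitivity (Ci * Ci * (RtoC PI * (ZtoC k * ZtoC k))); [ring|rewrite Ci_sqr].
    field; split; [apply Ci_nz|apply PI_neq_0]. }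
  pose proof (jacobi_limit 0 Ci _ Hi Hs) as HL.
  set (th := theta3 0 Ci) in *; assert (Hth : th <> 0) by apply theta3_i_neq_0.
  assert (Hth' : (0 < Cmod th)%R) by (apply Cmod_gt_0; auto).
  pose proof (sqrt_lt_R0 PI PI_RGT_0) as Hsq.
  apply is_lim_seq_ext with (fun K => sqrt PI / Cmod th
     * Cmod (th - gauss_mean K / (RtoC PI * grho Ci) * th))%R.
  - intros K; unfold grho; rewrite croot_i.
    rewrite <- sqrt_PI_sqr.
    replace (th - gauss_mean K / (RtoC (sqrt PI) * RtoC (sqrt PI) * / (RtoC (sqrt PI) * 1)) * th)
      with (- (gauss_mean K - RtoC (sqrt PI)) * (th / RtoC (sqrt PI)))
      by (field; apply sqrt_PI_neq_0).
    rewrite Cmod_mult, Cmod_opp, Cmod_div by apply sqrt_PI_neq_0.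
    rewrite (Cmod_R (sqrt PI)), (Rabs_pos_eq (sqrt PI)) by lra; field; lra.
  - replace (Finite 0) with (Finite (sqrt PI / Cmod th * 0)) by (f_equal; ring).
    apply is_lim_seq_mult'; auto; apply is_lim_seq_const.
Qed.

(** Replace [gauss_mean K] in [jacobi_limit] by its limit sqrt pi; then sqrt pi / (pi grho) is
    [croot tau]. *)
Lemma jacobi_transformation (z tau : C) : (0 < Im tau)%R ->
  hsum anyZ (fun n => dual_gauss tau (z - RtoC PI * ZtoC n)) (croot tau * theta3 z tau).
Proof.
  intros H; destruct (dual_theta_summable z tau H) as [s Hs].
  apply hsum_value with s; auto.
  pose proof (jacobi_limit z tau s H Hs) as HL; set (th := theta3 z tau) in *.
  assert (Hc0 : RtoC PI * grho tau <> 0)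
    by (apply Cmult_neq_0; [apply PI_neq_0|apply grho_neq_0]).
  set (q := th / (RtoC PI * grho tau)).
  assert (Ec : RtoC (sqrt PI) * q = croot tau * th).
  { unfold q, grho; rewrite <- sqrt_PI_sqr; field.
    split; [apply croot_neq_0|apply sqrt_PI_neq_0]. }
  (* A sequence constant in [K]: its limit 0 is its value. *)
  assert (HL2 : is_lim_seq (fun K : nat => Cmod (s - croot tau * th)) 0).
  { apply is_lim_seq_le_le with (fun _ => 0%R)
      (fun K => Cmod (s - gauss_mean K / (RtoC PI * grho tau) * th)
                + Cmod q * Cmod (gauss_mean K - RtoC (sqrt PI)))%R.
    - intros K; split; [apply Cmod_ge_0|].
      rewrite <- Ec, <- Cmod_mult.
      replace (s - RtoC (sqrt PI) * q)
        with ((s - gauss_mean K / (RtoC PI * grho tau) * th)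
              + q * (gauss_mean K - RtoC (sqrt PI)))
        by (unfold q; field; split; [apply grho_neq_0|apply PI_neq_0]).
      apply Cmod_triangle.
    - apply is_lim_seq_const.
    - replace (Finite 0) with (Finite (0 + Cmod q * 0)) by (f_equal; ring).
      apply is_lim_seq_plus'; auto.
      apply is_lim_seq_mult'; [apply is_lim_seq_const|apply gauss_mean_lim]. }
  apply is_lim_seq_unique in HL2; rewrite Lim_seq_const in HL2.
  injection HL2 as E; apply Cmod_eq_0 in E.
  replace s with (s - croot tau * th + croot tau * th) by ring; rewrite E; ring.
Qed.

(* Averaging over [z = pi j / N] isolates the terms with [N | k], which tend to
   the single term [k = 0]. *)
Lemma theta3_not_identically_0 (tau : C) : (0 < Im tau)%R -> exists z, theta3 z tau <> 0.
Proof.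
  intros H; apply NNPP; intros HN.
  assert (HZ : forall z, theta3 z tau = 0).
  { intros z; destruct (Ceq_dec (theta3 z tau) 0); auto; exfalso; eauto. }
  destruct (theta_term_bound 0 tau H) as (D & HD & Hk).
  (* With N > 16 D the final estimate 1 <= 8 D exp (- N/2) contradicts exp (N/2) >= 1 + N/2. *)
  destruct (archimed_cor1 (/ (16 * D))) as (N & HN1 & HN0).
  { apply Rinv_0_lt_compat; lra. }
  assert (HNp : (0 < INR N)%R) by (apply lt_0_INR; auto).
  assert (HND : (16 * D < INR N)%R).
  { apply Rinv_lt_cancel; auto. }
  pose proof (NtoC_neq_0 N HN0) as HNC.
  assert (H1 : hsum anyZ (fun k => csum_nat N (fun j => / NtoC N
             * theta_term (RtoC PI * NtoC j / NtoC N) tau k)) 0).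
  { apply hsum_value with (csum_nat N (fun j => / NtoC N * theta3 (RtoC PI * NtoC j / NtoC N) tau)).
    - rewrite (csum_nat_ext _ _ (fun _ => 0)); [rewrite csum_nat_const; ring|].
      intros; rewrite HZ; ring.
    - apply (hsum_csum_nat anyZ N (fun j k => / NtoC N
             * theta_term (RtoC PI * NtoC j / NtoC N) tau k)).
      intros; apply hsum_scal, theta3_hsum, H. }
  set (div := fun n => (n mod Z.of_nat N = 0)%Z).
  assert (H2 : hsum anyZ (fun k => if Z.eq_dec (k mod Z.of_nat N) 0
             then theta_term 0 tau k else 0) 0).
  { eapply hsum_ext; [|exact H1]; intros k _; cbn beta.
    transitivity (/ NtoC N * theta_term 0 tau k
      * csum_nat N (fun j => cexp (2 * RtoC PI * Ci * ZtoC k / NtoC N * NtoC j))).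
    - rewrite <- csum_nat_scal; apply csum_nat_ext; intros j _.
      rewrite !theta_term_cexp, <- !Cmult_assoc; f_equal; rewrite <- cexp_plus; f_equal.
      field; auto.
    - rewrite sum_roots_of_unity by auto.
      destruct (Z.eq_dec (k mod Z.of_nat N) 0); [field; auto|ring]. }
  apply (hsum_support _ div) in H2.
  2:{ intros k _ Hn; unfold div in Hn; destruct (Z.eq_dec (k mod Z.of_nat N) 0); tauto. }
  apply (hsum_reindex anyZ _ (fun m => Z.of_nat N * m)%Z (fun n => n / Z.of_nat N)%Z) in H2.
  2:{ intros m _; split; [exact Logic.I|]; unfold div; rewrite Z.mul_comm; apply Z.mod_mul; lia. }
  2:{ intros; exact Logic.I. }
  2:{ intros m _; rewrite Z.mul_comm; apply Z.div_mul; lia. }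
  2:{ intros n [_ Hn]; unfold div in Hn; rewrite (Z.div_mod n (Z.of_nat N)) at 2; lia. }
  set (e := fun m => if Z.eq_dec m 0 then RtoC 0 else theta_term 0 tau (Z.of_nat N * m)).
  assert (H3 : hsum anyZ e (0 - 1)).
  { assert (HI : hsum anyZ (fun m => if Z.eq_dec m 0 then 1 else 0) 1).
    { apply (hsum_extend _ (fun m => m = 0%Z)).
      - intros m _ Hm; destruct (Z.eq_dec m 0); tauto.
      - apply (hsum_single _ (fun m => if Z.eq_dec m 0 then RtoC 1 else RtoC 0) 0%Z).
        intros; unfold anyZ; tauto. }
    eapply hsum_ext; [|apply hsum_minus; [exact H2|exact HI]].
    intros m _; cbn beta; unfold e.
    rewrite Z.mul_comm, Z.mod_mul by lia; destruct (Z.eq_dec 0 0) as [_|]; [|congruence].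
    destruct (Z.eq_dec m 0) as [->|]; [|ring].
    rewrite theta_term_cexp, Z.mul_0_l.
    replace (Ci * _) with (RtoC 0) by (unfold ZtoC; ring); rewrite cexp_0; ring. }
  (* For m <> 0 one has N |m| >= N/2 + |m|/2: one half supplies the small factor, the other the
     summability. *)
  assert (Hb : forall m, (Cmod (e m)
     <= D * exp (- (INR N / 2)) * exp (- (/ 2 * Rabs (IZR m))))%R).
  { intros m; unfold e; destruct (Z.eq_dec m 0) as [->|Hm].
    - rewrite Cmod_0; left; repeat apply Rmult_lt_0_compat; auto; apply exp_pos.
    - eapply Rle_trans; [apply Hk|]; rewrite Rmult_assoc; apply Rmult_le_compat_l; [lra|].
      rewrite <- exp_plus; apply exp_le.
      rewrite mult_IZR, Rabs_mult, <- INR_IZR_INZ, (Rabs_pos_eq (INR N)) by lra.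
      assert (1 <= Rabs (IZR m))%R by (rewrite <- abs_IZR; apply IZR_le; lia).
      assert (1 <= INR N)%R by (replace 1%R with (INR 1) by reflexivity; apply le_INR; lia).
      nra. }
  destruct (zsum_exp_decay e _ (/ 2) ltac:(lra) Hb) as [He1 He2].
  rewrite <- (hsum_unique _ _ _ _ H3 He1) in He2.
  replace (0 - 1) with (- (1)) in He2 by ring; rewrite Cmod_m1 in He2.
  pose proof (exp_ineq1_le (INR N / 2)) as H4; pose proof (exp_pos (- (INR N / 2))) as H5.
  assert (H6 : (exp (INR N / 2) * exp (- (INR N / 2)) = 1)%R)
    by (rewrite <- exp_plus, Rplus_opp_r; apply exp_0).
  replace (4 * (D * exp (- (INR N / 2))) / / 2)%R
    with (8 * D * exp (- (INR N / 2)))%R in He2 by field.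
  nra.
Qed.

(** * The two evaluations of the theta product sum *)

(** Serves the theta terms ([be = 0], [de = 0]) as well as their Jacobi transforms, whose completed
    squares produce linear and constant parts. *)
Lemma vprod_cexp (al be ga : C) (y de : nat -> C) (n : nat) (r : list Z) : vec n r ->
  vprod (fun j a => cexp (al * (ZtoC a * ZtoC a) + be * ZtoC a + ga * (ZtoC a * y j) + de j)) r
  = cexp (al * ZtoC (zsumsq r) + be * ZtoC (zsumv r) + ga * zdot r y + csum_nat n de).
Proof.
  intros <-; revert y de; induction r as [|a r IH]; intros y de.
  - cbn [vprod zdot]; rewrite <- cexp_0; f_equal; unfold csum_nat, ZtoC; cbn; ring.
  - cbn [vprod zdot length]; rewrite (IH (fun j => y (S j)) (fun j => de (S j))).
    rewrite csum_nat_S, <- cexp_plus; f_equal.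
    change (zsumsq (a :: r)) with (a * a + zsumsq r)%Z.
    change (zsumv (a :: r)) with (a + zsumv r)%Z.
    rewrite !ZtoC_plus, !ZtoC_mult; ring.
Qed.

Lemma vprod_ext (f g : nat -> Z -> C) (r : list Z) :
  (forall j a, f j a = g j a) -> vprod f r = vprod g r.
Proof.
  revert f g; induction r as [|a r IH]; intros f g E; cbn; [reflexivity|].
  rewrite E; f_equal; apply IH; auto.
Qed.

Lemma zdot_div (r : list Z) (y : nat -> C) (c : C) : c <> 0 ->
  zdot r (fun j => y j / c) = zdot r y / c.
Proof.
  intros Hc; revert y; induction r as [|a r IH]; intros y; cbn [zdot]; [field; auto|].
  rewrite (IH (fun j => y (S j))); field; auto.
Qed.

Lemma hsum_theta_vec (n : nat) (w : nat -> C) (tau : C) : (0 < Im tau)%R ->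
  hsum (vec n) (fun r => qpow tau (ZtoC (zsumsq r) / 2) * cexp (2 * Ci * zdot r w))
    (cprod_nat n (fun j => theta3 (w j) tau)).
Proof.
  intros H.
  eapply hsum_ext; [|apply (hsum_vprod n (fun j => theta_term (w j) tau))].
  - intros r Hr.
    rewrite (vprod_ext _ (fun j a => cexp (RtoC PI * Ci * tau * (ZtoC a * ZtoC a)
       + 0 * ZtoC a + 2 * Ci * (ZtoC a * w j) + 0))).
    + rewrite (vprod_cexp _ _ _ w (fun _ => 0) n r Hr), csum_nat_const.
      unfold qpow; rewrite <- cexp_plus; f_equal; field.
    + intros j a; rewrite theta_term_cexp; f_equal; ring.
  - intros j _; apply theta3_hsum, H.
Qed.

Lemma Im_scal_pos (c : R) (tau : C) : (0 < c)%R -> (0 < Im tau)%R -> (0 < Im (RtoC c * tau))%R.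
Proof. intros; rewrite im_scal_l; nra. Qed.

(** * Factorization by division with remainder *)

Definition modulus (m n : nat) : C := NtoC m * NtoC m * NtoC n.

Lemma modulus_R (m n : nat) : modulus m n = RtoC (INR m * INR m * INR n).
Proof. unfold modulus, NtoC; now rewrite !RtoC_mult. Qed.

Lemma modulus_pos (m n : nat) : (0 < m)%nat -> (0 < n)%nat -> (0 < INR m * INR m * INR n)%R.
Proof. intros Hm Hn; apply lt_0_INR in Hm, Hn; repeat apply Rmult_lt_0_compat; auto. Qed.

Lemma Im_modulus (m n : nat) (tau : C) : (0 < m)%nat -> (0 < n)%nat ->
  (0 < Im tau)%R -> (0 < Im (modulus m n * tau))%R.
Proof.
  intros; rewrite modulus_R; apply Im_scal_pos; auto; apply modulus_pos; auto.
Qed.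

(** One representative of each class of Z^n modulo (1, ..., 1), since adding t (1, ..., 1) changes
    the coordinate sum by n t. It merges the inner sums of [Fmn_alt] into one series. *)
Definition residue_vec (n : nat) : list Z -> Prop :=
  fun r => vec n r /\ (0 <= zsumv r < Z.of_nat n)%Z.

Lemma Fmn_alt_hsum (m n : nat) (y : nat -> C) (tau : C) :
  (0 < Im tau)%R -> (0 < m)%nat -> (0 < n)%nat ->
  hsum (residue_vec n)
    (fun r => qpow tau (- (NtoC m * NtoC m * ZtoC (zsumv r) * ZtoC (zsumv r)) / 2)
       * (qpow tau (NtoC m * NtoC m * NtoC n * ZtoC (zsumsq r) / 2)
          * cexp (- (2 * Ci * zdot r y))))
    (Fmn_alt m n y tau).
Proof.
  intros H Hm Hn.
  set (phi := fun r => qpow tau (NtoC m * NtoC m * NtoC n * ZtoC (zsumsq r) / 2)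
                       * cexp (- (2 * Ci * zdot r y))).
  assert (HS : exists s, hsum (vec n) phi s).
  { exists (cprod_nat n (fun j => theta3 (y j / -1) (modulus m n * tau))).
    eapply hsum_ext; [|apply hsum_theta_vec, Im_modulus; auto].
    intros r Hr; cbn beta; rewrite zdot_div
      by (intros E; apply (f_equal Re) in E; cbn in E; lra).
    unfold phi, qpow, modulus; rewrite <- !cexp_plus; f_equal; field. }
  destruct HS as [s HS].
  set (F := fun (k : nat) r => qpow tau (- (NtoC m * NtoC m * NtoC k * NtoC k) / 2)
        * (if Z.eq_dec (zsumv r) (Z.of_nat k) then phi r else 0)).
  assert (H1 : forall k, In k (seq 0 n) -> hsum (vec n) (F k)
     (qpow tau (- (NtoC m * NtoC m * NtoC k * NtoC k) / 2)
      * latsum n (fun r => if Z.eq_dec (zsumv r) (Z.of_nat k) then phi r else 0))).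
  { intros k _; apply hsum_scal.
    destruct (hsum_subset _ (fun r => zsumv r = Z.of_nat k) _ _ HS) as [t Ht].
    assert (G : hsum (vec n) (fun r => if Z.eq_dec (zsumv r) (Z.of_nat k) then phi r else 0) t).
    { apply (hsum_extend _ (fun r => zsumv r = Z.of_nat k)).
      - intros r _ Hr; destruct (Z.eq_dec (zsumv r) (Z.of_nat k)); tauto.
      - eapply hsum_ext; [|exact Ht]; intros r [_ Hr].
        destruct (Z.eq_dec (zsumv r) (Z.of_nat k)); tauto. }
    now rewrite (latsum_hsum n _ t G). }
  apply (hsum_sigma_list (vec n) F _ (seq 0 n) (seq_NoDup n 0)) in H1.
  fold (csum_nat n) in H1.
  apply (hsum_support _ (fun p => zsumv (snd p) = Z.of_nat (fst p))) in H1.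
  2:{ intros [k r] _ Hr; cbn [fst snd] in *; unfold F.
      destruct (Z.eq_dec (zsumv r) (Z.of_nat k)); [tauto|ring]. }
  apply (hsum_reindex (residue_vec n) _ (fun r => (Z.to_nat (zsumv r), r)) snd) in H1.
  - eapply hsum_ext; [|exact H1]; intros r [Hr Hs]; cbn [fst snd]; unfold F.
    rewrite Z2Nat.id by lia; destruct (Z.eq_dec (zsumv r) (zsumv r)); [|congruence].
    rewrite <- (ZtoC_nat (Z.to_nat (zsumv r))), Z2Nat.id by lia; reflexivity.
  - intros r [Hr Hs]; cbn [fst snd]; rewrite in_seq, Z2Nat.id by lia; repeat split; auto; lia.
  - intros [k r] [[Hk Hr] Hs]; cbn [fst snd] in *; apply in_seq in Hk; split; auto; lia.
  - reflexivity.
  - intros [k r] [[Hk Hr] Hs]; cbn [fst snd] in *; rewrite Hs, Nat2Z.id; reflexivity.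
Qed.

Definition theta_product_sum (m n : nat) (y : nat -> C) (tau z : C) : C :=
  csum_nat (m * n) (fun k =>
    qpow tau (NtoC k * NtoC k / 2) * cexp (2 * NtoC k * Ci * z) *
    cprod_nat n (fun j =>
      theta3 (NtoC m * z + y j + NtoC k * NtoC m * RtoC PI * tau)
             (NtoC m * NtoC m * NtoC n * tau))).

(* Expanding the product, the pair [(k, r)] contributes the theta term of index
   [k + m (r_1 + ... + r_n)] times a weight invariant under [r -> r + (t, ..., t)];
   dividing with remainder makes the index and the class of [r] independent. *)
Lemma theta_product_sum_alt (m n : nat) (y : nat -> C) (tau z : C) :
  (0 < Im tau)%R -> (0 < m)%nat -> (0 < n)%nat -> csum_nat n y = 0 ->
  theta_product_sum m n y tau z = Fmn_alt m n y tau * theta3 z tau.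
Proof.
  intros H Hm Hn Hy.
  set (w := fun (k : nat) j => NtoC m * z + y j + NtoC k * NtoC m * RtoC PI * tau).
  set (f := fun (k : nat) r => qpow tau (NtoC k * NtoC k / 2) * cexp (2 * NtoC k * Ci * z)
     * (qpow (modulus m n * tau) (ZtoC (zsumsq r) / 2) * cexp (2 * Ci * zdot r (w k)))).
  assert (Hdot : forall k r, vec n r -> zdot r (w k)
     = (NtoC m * z + NtoC k * NtoC m * RtoC PI * tau) * ZtoC (zsumv r) + zdot r y).
  { intros k r _; unfold w; generalize y; clear.
    induction r as [|a r IH]; intros y; cbn [zdot]; [unfold ZtoC; cbn; ring|].
    rewrite (IH (fun j => y (S j))).
    change (zsumv (a :: r)) with (a + zsumv r)%Z; rewrite ZtoC_plus; ring. }
  assert (HL : hsum (fun p => In (fst p) (seq 0 (m * n)) /\ vec n (snd p))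
                 (fun p => f (fst p) (snd p)) (theta_product_sum m n y tau z)).
  { apply (hsum_sigma_list (vec n) f _ (seq 0 (m * n)) (seq_NoDup _ _)).
    intros k _; apply hsum_scal, hsum_theta_vec, Im_modulus; auto. }
  pose proof (hsum_prod _ _ _ _ _ _ (theta3_hsum z tau H) (Fmn_alt_hsum m n y tau H Hm Hn)) as HR.
  set (mn := (Z.of_nat m * Z.of_nat n)%Z); assert (Hmn : (0 < mn)%Z) by (unfold mn; lia).
  set (nz := Z.of_nat n); assert (Hnz : (0 < nz)%Z) by (unfold nz; lia).
  (* The ceiling of [zsumv r / n]: the only [t] for which the reflected and shifted vector, of sum
     [n t - zsumv r], is in [residue_vec n]. *)
  set (tt := fun r => (- ((- zsumv r) / nz))%Z).
  set (ph := fun p : nat * list Z =>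
     ((Z.of_nat (fst p) + Z.of_nat m * zsumv (snd p))%Z, vaff (-1) (tt (snd p)) (snd p))).
  (* With N = k + m (sum of r) and new sum s = n t - (sum of r), one has N + m s = k + m n t;
     division by [m n] recovers both [k] and [t]. *)
  set (ps := fun p : Z * list Z => let v := (fst p + Z.of_nat m * zsumv (snd p))%Z in
     (Z.to_nat (v mod mn), vaff (-1) (v / mn) (snd p))).
  assert (Hres : forall r, vec n r -> zsumv (vaff (-1) (tt r) r) = ((- zsumv r) mod nz)%Z).
  { intros r Hr; rewrite (zsumv_vaff n) by auto; fold nz; unfold tt.
    rewrite Z.mod_eq by lia; ring. }
  apply (hsum_reindex (fun p => In (fst p) (seq 0 (m * n)) /\ vec n (snd p)) _ ph ps) in HR.
  - rewrite Cmult_comm; eapply hsum_unique; [exact HL|].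
    eapply hsum_ext; [|exact HR]; intros [k r] [Hk Hr]; cbn [fst snd] in *; unfold ph; cbn [fst snd].
    rewrite theta_term_cexp; unfold f, qpow; rewrite <- !cexp_plus; f_equal.
    (* [Hy] makes the dot product with [y] invariant under the diagonal shift. *)
    rewrite (zdot_vaff n), (zsumsq_vaff n), (zsumv_vaff n), Hdot, Hy by auto.
    rewrite !ZtoC_plus, !ZtoC_mult, !ZtoC_nat; unfold modulus.
    change (ZtoC (-1)) with (RtoC (-1)); change (ZtoC 2) with (RtoC 2); field.
  - intros [k r] [Hk Hr]; cbn [fst snd] in *; unfold ph; cbn [fst snd]; split; [exact Logic.I|].
    split; [apply vec_vaff; auto|]; rewrite Hres by auto; apply Z.mod_pos_bound; auto.
  - intros [N r] [_ [Hr Hs]]; cbn [fst snd] in *; unfold ps; cbn [fst snd]; split; [|apply vec_vaff; auto].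
    apply in_seq.
    pose proof (Z.mod_pos_bound (N + Z.of_nat m * zsumv r) mn Hmn); unfold mn in *; lia.
  - intros [k r] [Hk Hr]; cbn [fst snd] in *; unfold ps, ph; cbn [fst snd].
    apply in_seq in Hk; rewrite Hres by auto.
    replace (Z.of_nat k + Z.of_nat m * zsumv r + Z.of_nat m * (- zsumv r mod nz))%Z
      with (Z.of_nat k + tt r * mn)%Z
      by (rewrite Z.mod_eq by lia; unfold tt, mn; fold nz; ring).
    rewrite Z.mod_add, Z.div_add, Z.mod_small, Z.div_small by (unfold mn; lia).
    rewrite Nat2Z.id, vaff_vaff; f_equal.
    transitivity (vaff 1 0 r); [f_equal; ring|apply vaff_id].
  - intros [N r] [_ [Hr Hs]]; cbn [fst snd] in *; unfold ps, ph; cbn [fst snd].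
    set (v := (N + Z.of_nat m * zsumv r)%Z).
    assert (Es : zsumv (vaff (-1) (v / mn) r) = (- zsumv r + nz * (v / mn))%Z).
    { rewrite (zsumv_vaff n) by auto; unfold nz; ring. }
    assert (Et : tt (vaff (-1) (v / mn) r) = (v / mn)%Z).
    { unfold tt; rewrite Es.
      replace (- (- zsumv r + nz * (v / mn)))%Z with (zsumv r + (- (v / mn)) * nz)%Z by ring.
      rewrite Z.div_add, Z.div_small by lia; ring. }
    rewrite Et, Es, Z2Nat.id, vaff_vaff
      by (pose proof (Z.mod_pos_bound v mn Hmn); lia).
    f_equal.
    + rewrite Z.mod_eq by lia; unfold v, mn; fold nz; ring.
    + transitivity (vaff 1 0 r); [f_equal; ring|apply vaff_id].
Qed.

(** * Factorization after Jacobi's transformation *)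

Lemma Im_opp_inv (tau : C) : (0 < Im tau)%R -> (0 < Im (-1 / tau))%R.
Proof.
  intros H; destruct tau as [a b]; unfold Im in H; cbn in H.
  unfold Cdiv, Cinv, Cmult, Im, RtoC; cbn.
  assert (0 < a * (a * 1) + b * (b * 1))%R by nra.
  replace (-1 * (- b / (a * (a * 1) + b * (b * 1))) + 0 * (a / (a * (a * 1) + b * (b * 1))))%R
    with (b / (a * (a * 1) + b * (b * 1)))%R by (field; lra).
  apply Rdiv_lt_0_compat; auto.
Qed.

Lemma Gmn_hsum (m n : nat) (y : nat -> C) (tau : C) : (0 < Im tau)%R ->
  hsum (fun r => vec n r /\ zsumv r = 0%Z)
    (fun r => NtoC m * NtoC n
       * (qpow tau (ZtoC (zsumsq r) / 2) * cexp (2 * Ci * zdot r y))) (Gmn m n y tau).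
Proof.
  intros H; unfold Gmn; apply hsum_scal.
  destruct (hsum_subset _ (fun r => zsumv r = 0%Z) _ _ (hsum_theta_vec n y tau H)) as [t Ht].
  rewrite (latsum_hsum n _ t); auto.
  apply (hsum_extend _ (fun r => zsumv r = 0%Z)).
  - intros r _ Hr; destruct (Z.eq_dec (zsumv r) 0); tauto.
  - eapply hsum_ext; [|exact Ht]; intros r [_ Hr]; destruct (Z.eq_dec (zsumv r) 0); tauto.
Qed.

Lemma cprod_nat_mult (n : nat) (c : C) (f : nat -> C) :
  cprod_nat n (fun j => c * f j) = c ^ n * cprod_nat n f.
Proof.
  revert f; induction n as [|n IH]; intros f; [unfold cprod_nat; cbn; ring|].
  rewrite !cprod_nat_S, IH; cbn; ring.
Qed.

Definition gauss_factor (m n : nat) (y : nat -> C) (tau : C) : C :=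
  cexp (csum_nat n (fun j => y j * y j) / (modulus m n * RtoC PI * tau * Ci)).

(* After Jacobi's transformation of every factor the sum over [k] selects the
   vectors [r] with [m n | r_1 + ... + r_n], i.e. [r = r' + (m t, ..., m t)] with
   [r'] of sum zero. *)
Lemma theta_product_sum_dual (m n : nat) (y : nat -> C) (tau z : C) :
  (0 < Im tau)%R -> (0 < m)%nat -> (0 < n)%nat -> csum_nat n y = 0 ->
  croot (modulus m n * tau) ^ n * theta_product_sum m n y tau z
  = croot tau * theta3 z tau
    * (gauss_factor m n y tau
       * Gmn m n (fun j => y j / (modulus m n * tau)) (-1 / (modulus m n * tau))).
Proof.
  intros H Hm Hn Hy; set (M := modulus m n).
  pose proof (Im_modulus m n tau Hm Hn H) as HM; fold M in HM.
  assert (HMt : M * tau <> 0) by (apply tau_neq_0; auto).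
  pose proof (tau_neq_0 tau H) as Ht0; pose proof PI_neq_0 as HP0; pose proof Ci_nz as HCi.
  pose proof (NtoC_neq_0 m Hm) as Hm0; pose proof (NtoC_neq_0 n Hn) as Hn0.
  assert (HM0 : M <> 0) by (unfold M, modulus; repeat apply Cmult_neq_0; auto).
  set (w := fun (k : nat) j => NtoC m * z + y j + NtoC k * NtoC m * RtoC PI * tau).
  set (S2 := csum_nat n (fun j => y j * y j)).
  set (f := fun (k : nat) r => qpow tau (NtoC k * NtoC k / 2) * cexp (2 * NtoC k * Ci * z)
     * vprod (fun j a => dual_gauss (M * tau) (w k j - RtoC PI * ZtoC a)) r).
  assert (HL : hsum (vec n) (fun r => csum_nat (m * n) (fun k => f k r))
                 (croot (M * tau) ^ n * theta_product_sum m n y tau z)).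
  { unfold theta_product_sum; rewrite <- csum_nat_scal.
    apply hsum_csum_nat; intros k _.
    eapply hsum_value; [|apply hsum_scal, hsum_vprod; intros j _; apply jacobi_transformation, HM].
    rewrite cprod_nat_mult; unfold w, M, modulus; ring. }
  set (E0 := fun r => cexp (- Ci * (z * z) / (RtoC PI * tau) - Ci * S2 / (RtoC PI * (M * tau))
     + 2 * Ci * z * ZtoC (zsumv r) / (NtoC m * NtoC n * tau)
     - Ci * RtoC PI * ZtoC (zsumsq r) / (M * tau) + 2 * Ci * zdot r y / (M * tau))).
  (* The squares of the [w k j] contribute - 2 i k z - pi i tau k^2, which cancels the prefactor of
     the [k]-th summand; the only trace of [k] left is a root of unity. *)
  assert (Hf : forall k r, vec n r -> f k r
     = E0 r * cexp (2 * RtoC PI * Ci * ZtoC (zsumv r) / NtoC (m * n) * NtoC k)).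
  { intros k r Hr; unfold f.
    rewrite (vprod_ext _ (fun j a => cexp (- Ci * RtoC PI / (M * tau) * (ZtoC a * ZtoC a)
       + 2 * Ci * (NtoC m * z + NtoC k * NtoC m * RtoC PI * tau) / (M * tau) * ZtoC a
       + 2 * Ci / (M * tau) * (ZtoC a * y j)
       + - Ci / (RtoC PI * (M * tau)) * (w k j * w k j)))).
    2:{ intros j a; unfold dual_gauss, w; f_equal; field; auto. }
    rewrite (vprod_cexp _ _ _ y (fun j => - Ci / (RtoC PI * (M * tau)) * (w k j * w k j)) n r Hr).
    rewrite csum_nat_scal.
    assert (EW : csum_nat n (fun j => w k j * w k j)
       = NtoC n * ((NtoC m * z + NtoC k * NtoC m * RtoC PI * tau)
                   * (NtoC m * z + NtoC k * NtoC m * RtoC PI * tau)) + S2).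
    { set (b := NtoC m * z + NtoC k * NtoC m * RtoC PI * tau).
      transitivity (csum_nat n (fun j => b * b + (2 * b * y j + y j * y j))).
      - apply csum_nat_ext; intros j _; unfold w, b; ring.
      - rewrite csum_nat_plus, csum_nat_const, csum_nat_plus, csum_nat_scal, Hy.
        unfold S2; ring. }
    rewrite EW; unfold E0, qpow; rewrite <- !cexp_plus, NtoC_mult; f_equal.
    unfold M, modulus; field; auto. }
  assert (H1 : hsum (vec n) (fun r => if Z.eq_dec (zsumv r mod Z.of_nat (m * n)) 0
                 then NtoC (m * n) * E0 r else 0)
                 (croot (M * tau) ^ n * theta_product_sum m n y tau z)).
  { eapply hsum_ext; [|exact HL]; intros r Hr; cbn beta.
    rewrite (csum_nat_ext _ _ (fun k => E0 r
       * cexp (2 * RtoC PI * Ci * ZtoC (zsumv r) / NtoC (m * n) * NtoC k)))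
      by (intros; apply Hf; auto).
    rewrite csum_nat_scal, sum_roots_of_unity by lia.
    destruct (Z.eq_dec (zsumv r mod Z.of_nat (m * n)) 0); ring. }
  apply (hsum_support _ (fun r => zsumv r mod Z.of_nat (m * n) = 0)%Z) in H1.
  2:{ intros r _ Hr; destruct (Z.eq_dec (zsumv r mod Z.of_nat (m * n)) 0); tauto. }
  pose proof (hsum_scal _ (gauss_factor m n y tau) _ _
    (Gmn_hsum m n (fun j => y j / (M * tau)) (-1 / (M * tau)) (Im_opp_inv _ HM))) as HG.
  pose proof (hsum_prod _ _ _ _ _ _ (jacobi_transformation z tau H) HG) as HR.
  cbv beta in HR.
  set (mz := Z.of_nat m) in *.
  assert (Hmn : Z.of_nat (m * n) = (mz * Z.of_nat n)%Z) by (unfold mz; lia).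
  assert (Hmz : (0 < mz * Z.of_nat n)%Z) by (unfold mz; lia).
  apply (hsum_reindex
    (fun p : Z * list Z => anyZ (fst p) /\ vec n (snd p) /\ zsumv (snd p) = 0%Z) _
    (fun p => vaff 1 (mz * fst p) (snd p))
    (fun r => ((zsumv r / (mz * Z.of_nat n))%Z,
               vaff 1 (- (mz * (zsumv r / (mz * Z.of_nat n)))) r))) in H1.
  - eapply hsum_unique; [exact H1|].
    eapply hsum_ext; [|exact HR]; intros [t r] [_ [Hr Hs]]; cbn [fst snd] in *.
    assert (Es : zsumv (vaff 1 (mz * t) r) = (t * Z.of_nat (m * n))%Z).
    { rewrite (zsumv_vaff n), Hs by auto; rewrite Hmn; ring. }
    rewrite Es, Z.mod_mul by lia; destruct (Z.eq_dec 0 0) as [_|]; [|congruence].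
    unfold E0; rewrite Es, (zsumsq_vaff n), (zdot_vaff n), Hs, Hy by auto.
    rewrite zdot_div by auto.
    unfold gauss_factor, dual_gauss; fold M S2.
    set (X := cexp (- Ci * _ / _)); set (Y := cexp (S2 / _)); unfold qpow.
    rewrite <- cexp_plus.
    match goal with |- X * (Y * (_ * cexp ?a)) = _ * cexp ?b =>
      transitivity (NtoC m * NtoC n * (X * Y * cexp a)); [ring|];
      rewrite NtoC_mult; f_equal; unfold X, Y; rewrite <- !cexp_plus; f_equal
    end.
    (* [field] treats [Ci] as an indeterminate, so its inverse is first rewritten as [- Ci]. *)
    replace (S2 / (M * RtoC PI * tau * Ci)) with (/ Ci * (S2 / (M * RtoC PI * tau)))
      by (field; auto).
    rewrite Ci_inv, !ZtoC_plus, !ZtoC_mult, !ZtoC_nat, NtoC_mult.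
    unfold mz; rewrite ZtoC_nat.
    change (ZtoC 1) with (RtoC 1); change (ZtoC 2) with (RtoC 2); change (ZtoC 0) with (RtoC 0).
    unfold M, modulus; field; auto.
  - intros [t r] [_ [Hr Hs]]; cbn [fst snd] in *; split; [apply vec_vaff; auto|].
    rewrite (zsumv_vaff n), Hs, Hmn by auto.
    replace (1 * 0 + Z.of_nat n * (mz * t))%Z with (t * (mz * Z.of_nat n))%Z by ring.
    apply Z.mod_mul; lia.
  - intros r [Hr Hs]; cbn [fst snd]; split; [exact Logic.I|].
    split; [apply vec_vaff; auto|].
    rewrite (zsumv_vaff n) by auto; rewrite Hmn in Hs.
    pose proof (Z.div_mod (zsumv r) (mz * Z.of_nat n) ltac:(lia)) as E; rewrite Hs in E.
    rewrite E at 1; ring.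
  - intros [t r] [_ [Hr Hs]]; cbn [fst snd] in *.
    rewrite (zsumv_vaff n), Hs by auto.
    replace (1 * 0 + Z.of_nat n * (mz * t))%Z with (t * (mz * Z.of_nat n))%Z by ring.
    rewrite Z.div_mul, vaff_vaff by lia; f_equal.
    transitivity (vaff 1 0 r); [f_equal; ring|apply vaff_id].
  - intros r [Hr Hs]; cbn [fst snd]; rewrite vaff_vaff.
    transitivity (vaff 1 0 r); [f_equal; ring|apply vaff_id].
Qed.

(** * Branches of the powers and conclusion *)

(** In the right half-plane the argument is the arctangent of a quotient, which a positive factor
    does not change. *)
Lemma Clog_scal (c : R) (w : C) : (0 < c)%R -> (0 < Re w)%R ->
  Clog (RtoC c * w) = RtoC (ln c) + Clog w.
Proof.
  intros Hc Hw; unfold Clog.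
  assert (Hw0 : (0 < Cmod w)%R) by (apply Cmod_gt_0; intros ->; cbn in Hw; lra).
  rewrite !Carg_pos by (rewrite ?re_scal_l; nra).
  rewrite re_scal_l, im_scal_l, Cmod_mult, Cmod_R, Rabs_pos_eq, ln_mult by lra.
  unfold Cplus, RtoC; cbn; f_equal.
  rewrite Rplus_0_l; f_equal; field; lra.
Qed.

Lemma cexp_mul_nat (n : nat) (a : C) : cexp a ^ n = cexp (NtoC n * a).
Proof.
  induction n as [|n IH].
  - replace (NtoC 0 * a) with (RtoC 0) by (unfold NtoC; cbn; ring).
    rewrite cexp_0; reflexivity.
  - change (cexp a ^ S n) with (cexp a * cexp a ^ n); rewrite IH, <- cexp_plus; f_equal.
    unfold NtoC; rewrite S_INR, RtoC_plus; ring.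
Qed.

(** By [Clog_scal] everything is the exponential of a combination of log (-i tau) and ln (m^2 n):
    the first has coefficient (1 - n)/2 + n/2 = 1/2, the second - n/2 + n/2 = 0. *)
Lemma Fmn_normalization (m n : nat) (tau : C) :
  (0 < Im tau)%R -> (0 < m)%nat -> (0 < n)%nat ->
  Defs.Cpow (- Ci * tau) ((1 - NtoC n) / 2)
  / RtoC (Rpower (INR m * INR m * INR n) (INR n / 2)) * croot (modulus m n * tau) ^ n
  = croot tau.
Proof.
  intros H Hm Hn; pose proof (modulus_pos m n Hm Hn) as HM.
  unfold Defs.Cpow; destruct (Ceq_dec (- Ci * tau) 0) as [E|_].
  { exfalso; apply (f_equal Re) in E; rewrite Re_opp_Ci in E; cbn in E; lra. }
  unfold croot; set (l := Clog (- Ci * tau)).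
  replace (- Ci * (modulus m n * tau)) with (RtoC (INR m * INR m * INR n) * (- Ci * tau))
    by (rewrite modulus_R; ring).
  rewrite Clog_scal by (rewrite ?Re_opp_Ci; auto); fold l.
  rewrite cexp_mul_nat; unfold Rpower; set (L := ln _).
  rewrite <- cexp_R; unfold Cdiv; rewrite <- cexp_opp, <- !cexp_plus; f_equal.
  unfold NtoC; rewrite RtoC_mult, RtoC_div by lra; field.
Qed.

Theorem theorem2p1 (tau : C) (Htau : (0 < Im tau)%R) (m n : nat)
  (Hm : (0 < m)%nat) (Hn : (0 < n)%nat) (y : nat -> C)
  (Hy : csum_nat n y = 0) :
  (forall z : C,
     csum_nat (m * n) (fun k =>
       qpow tau (NtoC k * NtoC k / 2) * cexp (2 * NtoC k * Ci * z) *
       cprod_nat n (fun j =>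
         theta3 (NtoC m * z + y j + NtoC k * NtoC m * RtoC PI * tau)
                (NtoC m * NtoC m * NtoC n * tau)))
     = Fmn m n y tau * theta3 z tau)
  /\ Fmn m n y tau = Fmn_alt m n y tau.
Proof.
  assert (HF : forall z, theta_product_sum m n y tau z = Fmn m n y tau * theta3 z tau).
  { intros z.
    pose proof (theta_product_sum_dual m n y tau z Htau Hm Hn Hy) as HD.
    pose proof (Fmn_normalization m n tau Htau Hm Hn) as HN.
    set (c := Defs.Cpow _ _ / RtoC _) in HN.
    assert (Hr : croot (modulus m n * tau) ^ n <> 0) by apply Cpow_nz, croot_neq_0.
    change (Fmn m n y tau) with (c * gauss_factor m n y tau
      * Gmn m n (fun j => y j / (modulus m n * tau)) (- 1 / (modulus m n * tau))).
    set (G := Gmn m n _ _) in *; set (g := gauss_factor m n y tau) in *.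
    set (r := croot (modulus m n * tau) ^ n) in *; rewrite <- HN in HD.
    set (S := theta_product_sum m n y tau z) in *.
    transitivity (r * S / r); [field; auto|rewrite HD; field; auto]. }
  split; [exact HF|].
  destruct (theta3_not_identically_0 tau Htau) as [z Hz].
  pose proof (HF z) as E1.
  rewrite (theta_product_sum_alt m n y tau z Htau Hm Hn Hy) in E1.
  transitivity (Fmn m n y tau * theta3 z tau / theta3 z tau); [field; auto|].
  rewrite <- E1; field; auto.
Qed.
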